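(* Let $\mathfrak g=\mathfrak{gl}_N$ and let $(\mathfrak g,\theta)=(\mathfrak g,\mathfrak k,\mathfrak p)$ be a symmetric Lie algebra of type AI, AII or AIII. Let $S_G$ be a $G$-sheet of $\mathfrak g$ intersecting $\mathfrak p$, let $e\in S_G\cap\mathfrak p$ be nilpotent, let $(e,h,f)$ be a normal $\mathfrak{sl}_2$-triple, and define $X$ by $e+X=S_G\cap(e+\mathfrak g^f)$ and $X_{\mathfrak p}=X\cap\mathfrak p$. Then $$G.(e+X_{\mathfrak p})=G.(S_G\cap\mathfrak p).$$ Moreover, in types AI and AII a stronger version holds, namely $e+X\subset\mathfrak p$.
   Context: $\mathbb K$ is an algebraically closed field of characteristic zero, $V=\mathbb K^N$ and $\mathfrak g=\mathfrak{gl}_N=\mathfrak{gl}(V)$. $\theta$ is an involution of the Lie algebra $\mathfrak g$, with $+1$-eigenspace $\mathfrak k$ and $-1$-eigenspace $\mathfrak p$. Up to isomorphism the types are: (AI) $\mathfrak k=\{x: \chi(xu,v)=-\chi(u,xv)\ \forall u,v\in V\}\cong\mathfrak{so}_N$ and $\mathfrak p=\{x:\chi(xu,v)=\chi(u,xv)\ \forall u,v\in V\}$ for a nondegenerate symmetric bilinear form $\chi$ on $V$; (AII) the same definitions with $\chi$ a nondegenerate alternating form ($N$ even), $\mathfrak k\cong\mathfrak{sp}_N$; (AIII) $V=V_a\oplus V_b$, $\mathfrak k=\mathfrak{gl}(V_a)\oplus\mathfrak{gl}(V_b)$, $\mathfrak p=\mathrm{Hom}(V_a,V_b)\oplus\mathrm{Hom}(V_b,V_a)$.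 $G$ is the adjoint group of $\mathfrak g$ (connected algebraic subgroup of $\mathrm{GL}(\mathfrak g)$ with Lie algebra $\mathrm{ad}(\mathfrak g)$). A $G$-sheet is an irreducible component of some $\mathfrak g^{(m)}=\{x\in\mathfrak g:\dim G.x=m\}$. Each $G$-sheet contains a unique nilpotent $G$-orbit, which meets $\mathfrak p$ whenever the sheet does. An $\mathfrak{sl}_2$-triple $(e,h,f)$ satisfies $[h,e]=2e$, $[h,f]=-2f$, $[e,f]=h$; it is normal if $e,f\in\mathfrak p$ and $h\in\mathfrak k$. $\mathfrak g^f$ is the centralizer of $f$ in $\mathfrak g$. *)

(* Defs.v *)
From mathcomp Require Import all_boot all_order all_algebra.
From mathcomp Require Import mathcomp_extra boolp classical_sets.
From mathcomp Require Import mpoly.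

Set Implicit Arguments.
Unset Strict Implicit.
Unset Printing Implicit Defensive.

Import GRing.Theory.
Local Open Scope classical_set_scope.
Local Open Scope ring_scope.

Section Zariski.
Variables (K : fieldType) (V : vectType K).
Implicit Types (A B C : set V) (x v : V).

(* Polynomial functions on V are written in the coordinates of a fixed basis;
   the notions defined from them do not depend on that basis. *)
Definition vcoord x : 'I_(\dim {:V}) -> K := fun i => coord (vbasis {:V}) i x.

Definition peval (p : {mpoly K[\dim {:V}]}) x : K := p.@[vcoord x].

Definition pdiff (p : {mpoly K[\dim {:V}]}) x v : K :=
  \sum_(i < \dim {:V}) (p^`M(i)).@[vcoord x] * vcoord v i.

Definition zariski_closed A : Prop :=
  exists I : set {mpoly K[\dim {:V}]},
    A = [set x | forall p, I p -> peval p x = 0].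

Definition irreducible_set A : Prop :=
  A !=set0 /\
  forall C1 C2, zariski_closed C1 -> zariski_closed C2 ->
    A `<=` C1 `|` C2 -> A `<=` C1 \/ A `<=` C2.

Definition connected_set A : Prop :=
  forall C1 C2, zariski_closed C1 -> zariski_closed C2 ->
    A `<=` C1 `|` C2 -> A `&` C1 !=set0 -> A `&` C2 !=set0 ->
    A `&` C1 `&` C2 !=set0.

Definition irreducible_component A C : Prop :=
  [/\ C `<=` A, irreducible_set C
    & forall B, irreducible_set B -> C `<=` B -> B `<=` A -> B = C].

(* Algebraic independence over K of the restrictions to A of f_1, ..., f_d. *)
Definition alg_independent_on A d (f : 'I_d -> {mpoly K[\dim {:V}]}) : Prop :=
  forall P : {mpoly K[d]},
    (forall x, A x -> P.@[fun i => peval (f i) x] = 0) -> P = 0.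

(* The dimension of A is the largest number of regular functions on its closure
   that are algebraically independent over K. When A is irreducible this is the
   transcendence degree over K of the function field of the closure of A. *)
Definition zariski_dim A (d : nat) : Prop :=
  (exists f : 'I_d -> {mpoly K[\dim {:V}]}, alg_independent_on A f) /\
  ~ (exists f : 'I_d.+1 -> {mpoly K[\dim {:V}]}, alg_independent_on A f).

End Zariski.

Section AlgebraicGroups.
Variables (K : fieldType) (V : vectType K).

Definition general_linear : set 'End(V) := [set g | lker g == 0%VS].

Definition algebraic_subgroup (H : set 'End(V)) : Prop :=
  [/\ H \1%VF,
      forall g h, H g -> H h -> H (g \o h)%VF,
      forall g, H g -> H (g^-1)%VF
    & exists2 Z : set 'End(V), zariski_closed Z & H = Z `&` general_linear].

(* The tangent space at the identity. As GL(V) is open in End(V), it is cut out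
   by the differentials of the polynomial functions on End(V) vanishing on H. *)
Definition lie_algebra (H : set 'End(V)) : set 'End(V) :=
  [set D | forall p, (forall g, H g -> peval p g = 0) ->
           pdiff p \1%VF D = 0].

End AlgebraicGroups.

Section GeneralLinearLieAlgebra.
Variables (K : fieldType) (N : nat).
Local Notation gl := 'M[K]_N.
Local Notation V := 'cV[K]_N.
Implicit Types (x y e h f : gl) (S X : set gl).

Definition bracket x y : gl := x *m y - y *m x.

Definition ad x : 'End(gl) := linfun (bracket x).

Definition adjoint_group (G : set 'End(gl)) : Prop :=
  [/\ algebraic_subgroup G, connected_set G & lie_algebra G = range ad].

Definition adjoint_orbit (G : set 'End(gl)) x : set gl := [set g x | g in G].

Definition orbit_saturation (G : set 'End(gl)) X : set gl :=
  [set g x | g in G & x in X].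

Definition orbit_dim_locus (G : set 'End(gl)) (m : nat) : set gl :=
  [set x | zariski_dim (adjoint_orbit G x) m].

Definition sheet (G : set 'End(gl)) S : Prop :=
  exists m, irreducible_component (orbit_dim_locus G m) S.

Definition lie_involution (theta : 'End(gl)) : Prop :=
  (forall x y, theta (bracket x y) = bracket (theta x) (theta y)) /\
  (forall x, theta (theta x) = x).

Definition k_space (theta : 'End(gl)) : set gl := [set x | theta x = x].
Definition p_space (theta : 'End(gl)) : set gl := [set x | theta x = - x].

Definition nondegenerate_form (chi : V -> V -> K) : Prop :=
  (forall u, (forall v, chi u v = 0) -> u = 0) /\
  (forall v, (forall u, chi u v = 0) -> v = 0).

Definition given_by_form (chi : V -> V -> K) (theta : 'End(gl)) : Prop :=
  k_space theta = [set x | forall u v, chi (x *m u) v = - chi u (x *m v)] /\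
  p_space theta = [set x | forall u v, chi (x *m u) v = chi u (x *m v)].

(* The three families below are stable under all automorphisms of the Lie
   algebra gl_N, so being of a given type "up to isomorphism" amounts to
   belonging to the family. *)
Definition type_AI (theta : 'End(gl)) : Prop :=
  exists chi : {biscalar V},
    [/\ nondegenerate_form chi, forall u v, chi u v = chi v u
      & given_by_form chi theta].

Definition type_AII (theta : 'End(gl)) : Prop :=
  exists chi : {biscalar V},
    [/\ nondegenerate_form chi, forall u, chi u u = 0
      & given_by_form chi theta].

Definition maps_into x (U W : {vspace V}) : Prop :=
  forall u, u \in U -> x *m u \in W.

Definition type_AIII (theta : 'End(gl)) : Prop :=
  exists Va Vb : {vspace V},
    [/\ (Va + Vb)%VS = fullv, (Va :&: Vb)%VS = 0%VS,
        k_space theta = [set x | maps_into x Va Va /\ maps_into x Vb Vb]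
      & p_space theta = [set x | maps_into x Va Vb /\ maps_into x Vb Va]].

Definition nilpotent_mx x : Prop := exists k, x ^+ k = 0.

Definition sl2_triple e h f : Prop :=
  [/\ bracket h e = e *+ 2, bracket h f = - (f *+ 2) & bracket e f = h].

Definition normal_sl2_triple (theta : 'End(gl)) e h f : Prop :=
  [/\ sl2_triple e h f, p_space theta e, p_space theta f & k_space theta h].

Definition lie_centralizer f : set gl := [set y | bracket f y = 0].

Definition translate_set e X : set gl := [set e + y | y in X].

End GeneralLinearLieAlgebra.

(* Main.v *)
Require Import Defs.
From HB Require Import structures.
From mathcomp Require Import all_boot all_order all_algebra.
From mathcomp Require Import mathcomp_extra boolp classical_sets.
From mathcomp Require Import mpoly.
From mathcomp Require Import perm zify ring.
Set Implicit Arguments.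
Unset Strict Implicit.
Unset Printing Implicit Defensive.
Import Order.TTheory GRing.Theory Num.Theory.
Local Open Scope classical_set_scope.
Local Open Scope ring_scope.

(** The set p is the fixed-point set of an involution x |-> x* of gl_N: the
    adjoint with respect to the form in types AI and AII, and x* = - s x s in
    type AIII, with s = 1 on V_a and s = - 1 on V_b. This map fixes e and f and
    anticommutes with ad f, so it preserves the slice e + g^f. The theorem
    follows from two facts about the slice: a point of the sheet S has a
    conjugate in it (slice_meets), and two points x, y of it for which the
    space of z with x z = z y is at least as large as g^e are equal
    (slice_unique). Given x in S and in p, its conjugate x' in the slice again
    lies in S, the matrices x' and x'* are similar, so x' = x'* and x' is in p.
    In types AI and AII, x* is similar to the transpose of x for every x, and a
    matrix has as many intertwiners with its transpose as with itself, so all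
    of e + X is fixed.

    Uniqueness is a leading-term argument for the grading of gl_N by the
    eigenvalues of ad h: the intertwiners of two points of the slice have
    leading terms in g^e, which is concentrated in nonnegative weights; by
    dimension, 1 is one of these leading terms, and gl = im ad e + ker ad f
    forces the intertwiner that has it to be 1.

    Existence rests on the invariant factors. Let kappa_i(x) be the largest
    dimension of a submodule of K^N, with x acting, generated by i vectors: it
    is the sum of the degrees of the first i invariant factors, it is upper
    semicontinuous in the sense that the conditions kappa_i <= k are closed,
    and the sum of all kappa_i is an affine function of the dimension of the
    centralizer (idim_degs). On a sheet this dimension is constant, so by
    irreducibility each kappa_i is constant too (sheet_kappa), and a point y
    of S has the invariant-factor degrees of e, that is, the sizes of the
    Jordan blocks of e. Hence y is similar to a block companion matrix C of
    that shape; in a Jordan basis of e adapted to h (graded_jordan), C - e has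
    weights at most 0, and such a C is moved into the slice weight by weight.

    That the dimension of the centralizer is constant on S, and that S is
    stable under conjugation, requires comparing G with GL_N, where G is known
    only through its Lie algebra. Conjugations belong to G because each
    equation of G pulls back to a function on a line of matrices all of whose
    derivatives at the identity vanish (Ad_in_G). Conversely, G normalizes the
    inner derivations, and the linear automorphisms of gl_N that do so are
    conjugations composed with scalings of sl_N and of the center, and
    possibly with the transposition (normalizer_classification). As Lie(G)
    has no direction along these scalings, they have bounded order in G
    (torus_exponent). So an orbit of G consists of finitely many orbits of
    GL_N, and has dimension rank(ad z) (orbit_dim); this is computed with
    transcendence degrees, the lower bound from the tangent space and the
    upper bound from a rational parametrization. *)

(** * Matrix polynomials, similarity and companion matrices *)

Section MatrixPolynomials.
Variable K : fieldType.
Implicit Types (p q : {poly K}).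

(** Evaluation of a polynomial at a matrix that may have size 0, where the
    square matrices form a trivial ring: splitting off blocks ends there. *)
Definition pmx n : 'M[K]_n -> {poly K} -> 'M[K]_n :=
  if n is n'.+1 then @horner_mx K n' else fun _ _ => 0.

Lemma pmxD n (x : 'M_n) p q : pmx x (p + q) = pmx x p + pmx x q.
Proof. by case: n x => [|n] x; rewrite ?addr0 //= rmorphD. Qed.

Lemma pmxM n (x : 'M_n) p q : pmx x (p * q) = pmx x p *m pmx x q.
Proof. by case: n x => [|n] x; [rewrite mulmx0 | rewrite /= rmorphM]. Qed.

Lemma pmxC n (x : 'M_n) c : pmx x c%:P = c%:M.
Proof. by case: n x => [|n] x; [rewrite flatmx0 [RHS]flatmx0 | rewrite /= horner_mx_C]. Qed.

Lemma pmxX n (x : 'M_n) : pmx x 'X = x.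
Proof. by case: n x => [|n] x; [rewrite flatmx0 [RHS]flatmx0 | rewrite /= horner_mx_X]. Qed.

Lemma pmx0 n (x : 'M_n) : pmx x 0 = 0.
Proof. by rewrite -[0]/(0%:P) pmxC raddf0. Qed.

Lemma pmxZ n (x : 'M_n) c p : pmx x (c *: p) = c *: pmx x p.
Proof. by rewrite -mul_polyC pmxM pmxC mul_scalar_mx. Qed.

Lemma pmxXn n (x : 'M_n) k : pmx x 'X^k = x ^+ k.
Proof.
by case: n x => [|n] x; [rewrite flatmx0 [RHS]flatmx0 | rewrite /= rmorphXn /= horner_mx_X].
Qed.

Arguments pmx n x p : simpl never.

Lemma pmx_sum n (x : 'M_n) (I : Type) (r : seq I) (P : pred I) (F : I -> {poly K}) :
  pmx x (\sum_(i <- r | P i) F i) = \sum_(i <- r | P i) pmx x (F i).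
Proof. exact: (big_morph _ (pmxD x) (pmx0 x)). Qed.

Lemma pmxE n (x : 'M_n) p : pmx x p = \sum_(i < size p) p`_i *: x ^+ i.
Proof.
rewrite -{1}[p]coefK poly_def pmx_sum; apply: eq_bigr => i _.
by rewrite pmxZ pmxXn.
Qed.

Lemma pmx_tr n (x : 'M_n) p : pmx x^T p = (pmx x p)^T.
Proof.
rewrite !pmxE linear_sum; apply: eq_bigr => i _ /=.
rewrite linearZ /=; congr (_ *: _).
elim: (val i) => [|k IH]; first by rewrite !expr0 trmx1.
by rewrite exprS exprSr trmx_mul IH.
Qed.

Lemma pmx_intertwine m n (x : 'M_m) (y : 'M_n) (P : 'M_(n, m)) p :
  P *m x = y *m P -> P *m pmx x p = pmx y p *m P.
Proof.
move=> Pxy; elim/poly_ind: p => [|p c IH].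
  by rewrite !pmx0 mulmx0 mul0mx.
rewrite !pmxD !pmxM !pmxX !pmxC mulmxDr mulmxDl mulmxA IH -mulmxA Pxy mulmxA.
by rewrite mul_mx_scalar mul_scalar_mx.
Qed.

Lemma pmx_comm n (x : 'M_n) p : x *m pmx x p = pmx x p *m x.
Proof. exact: pmx_intertwine. Qed.

Lemma pmx_block m n (x : 'M_m) (y : 'M_n) p :
  pmx (block_mx x 0 0 y) p = block_mx (pmx x p) 0 0 (pmx y p).
Proof.
elim/poly_ind: p => [|p c IH]; first by rewrite !pmx0 block_mx0.
rewrite !pmxD !pmxM !pmxX !pmxC IH mulmx_block !mulmx0 !mul0mx !addr0 !add0r.
by rewrite scalar_mx_block add_block_mx !addr0.
Qed.

End MatrixPolynomials.

Section Similarity.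
Variable K : fieldType.

(** Similarity of matrices of formally different sizes: a canonical form of x
    has size the sum of its block sizes, which is equal to n only up to a proof. *)
Definition simmx m n (x : 'M[K]_m) (y : 'M[K]_n) :=
  exists P : 'M_(n, m), exists Q : 'M_(m, n),
    [/\ P *m Q = 1%:M, Q *m P = 1%:M & P *m x = y *m P].

Lemma simmx_refl n (x : 'M_n) : simmx x x.
Proof. by exists 1%:M, 1%:M; rewrite !mul1mx mulmx1. Qed.

Lemma simmx_sym m n (x : 'M_m) (y : 'M_n) : simmx x y -> simmx y x.
Proof.
case=> P [Q [PQ QP Pxy]]; exists Q, P; split=> //.
by rewrite -[LHS]mulmx1 -PQ !mulmxA -[Q *m y *m P]mulmxA -Pxy mulmxA QP mul1mx.
Qed.

Lemma simmx_trans l m n (x : 'M_l) (y : 'M_m) (z : 'M_n) :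
  simmx x y -> simmx y z -> simmx x z.
Proof.
case=> P [Q [PQ QP Pxy]] [P' [Q' [PQ' QP' Pyz]]].
exists (P' *m P), (Q *m Q'); split.
- by rewrite mulmxA -(mulmxA P') PQ mulmx1.
- by rewrite mulmxA -(mulmxA Q) QP' mulmx1.
- by rewrite -mulmxA Pxy mulmxA Pyz mulmxA.
Qed.

Lemma rank_simmx m n (x : 'M_m) (y : 'M_n) p :
  simmx x y -> \rank (pmx x p) = \rank (pmx y p).
Proof.
suff le m' n' (x' : 'M[K]_m') (y' : 'M_n') : simmx x' y' -> (\rank (pmx x' p) <= \rank (pmx y' p))%N.
  by move=> s; apply/eqP; rewrite eqn_leq !le //; apply: simmx_sym.
case=> P [Q [PQ QP Pxy]].
rewrite -[pmx x' p]mul1mx -QP -mulmxA (pmx_intertwine _ Pxy) mulmxA.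
exact: leq_trans (mxrankM_maxl _ _) (mxrankM_maxr _ _).
Qed.

Lemma simmx_block m1 m2 n1 n2 (x1 : 'M_m1) (x2 : 'M_m2) (y1 : 'M_n1) (y2 : 'M_n2) :
  simmx x1 y1 -> simmx x2 y2 -> simmx (block_mx x1 0 0 x2) (block_mx y1 0 0 y2).
Proof.
case=> P [Q [PQ QP Pxy]] [P' [Q' [PQ' QP' Pxy']]].
exists (block_mx P 0 0 P'), (block_mx Q 0 0 Q').
by rewrite !mulmx_block !mulmx0 !mul0mx !addr0 !add0r PQ PQ' QP QP' Pxy Pxy' -!scalar_mx_block.
Qed.

End Similarity.

Section Companion.
Variable K : fieldType.
Implicit Types (p q : {poly K}).

Definition cmx d p : 'M[K]_d :=
  \matrix_(i, j) (if i == d.-1 :> nat then - p`_j else (i.+1 == j :> nat)%:R).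

Definition krylov n d (v : 'rV[K]_n) (x : 'M[K]_n) : 'M_(d, n) :=
  \matrix_(i < d) (v *m x ^+ i).

Lemma krylovM n d (v : 'rV_n) (x : 'M_n) p :
  p \is monic -> size p = d.+1 -> v *m pmx x p = 0 ->
  krylov d v x *m x = cmx d p *m krylov d v x.
Proof.
move=> pmon szp vp; apply/row_matrixP => i.
rewrite !row_mul !rowK -mulmxA -[x ^+ i *m x]/(x ^+ i * x) -exprSr.
case: (eqVneq (i : nat) d.-1) => [id1|nid1].
  have dS : i.+1 = d by rewrite id1 prednK // (leq_ltn_trans _ (ltn_ord i)).
  rewrite dS.
  have -> : row i (cmx d p) = \row_j - p`_j.
    by apply/rowP => j; rewrite !mxE id1 eqxx.
  move: vp; rewrite pmxE szp big_ord_recr /= mulmxDr.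
  have -> : p`_d = 1 by move/monicP: pmon; rewrite lead_coefE szp.
  rewrite scale1r => /eqP; rewrite addrC addr_eq0 => /eqP ->.
  rewrite [RHS]mulmx_sum_row mulmx_sumr -sumrN; apply: eq_bigr => j _.
  by rewrite !mxE rowK -scalemxAr scaleNr.
have iltd : (i.+1 < d)%N by have := ltn_ord i; case: (d) (i) nid1 => [[]//|d'] j /=; rewrite ltnS leq_eqVlt => /negPf ->.
rewrite (_ : row i _ = delta_mx 0 (Ordinal iltd)); last first.
  by apply/rowP => j; rewrite !mxE eqxx (negPf nid1) eq_sym.
by rewrite -rowE rowK.
Qed.

Lemma row0_cmx d p (g : {poly K}) : (size g <= d.+1)%N ->
  delta_mx 0 0 *m pmx (cmx d.+1 p) g = poly_rV g.
Proof.
move=> szg.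
have e0 k : (k < d.+1)%N ->
    (delta_mx 0 0 : 'rV[K]_d.+1) *m cmx d.+1 p ^+ k = \row_j (k == j :> nat)%:R.
  elim: k => [|k IH] kd.
    by rewrite expr0 mulmx1; apply/rowP => j; rewrite !mxE eqxx /= eq_sym.
  rewrite exprSr -[_ * _]/(_ *m _) mulmxA IH 1?ltnW //.
  have -> : \row_(j < d.+1) (k == j)%:R = delta_mx 0 (Ordinal (ltnW kd)) :> 'rV[K]__.
    by apply/rowP => j; rewrite !mxE eqxx /= eq_sym.
  rewrite -rowE; apply/rowP => j; rewrite !mxE /=.
  by rewrite ltn_eqF.
rewrite pmxE mulmx_sumr; apply/rowP => j; rewrite summxE mxE.
under eq_bigr => i _ do rewrite -scalemxAr e0 ?(leq_trans (ltn_ord i)) // !mxE.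
case: (ltnP j (size g)) => jg.
  rewrite (bigD1 (Ordinal jg)) //= eqxx mulr1 big1 ?addr0 // => i ne.
  by rewrite (_ : (i == j :> nat) = false) ?mulr0 //; apply: negbTE; apply: contraNneq ne => ij; apply/eqP/val_inj.
rewrite nth_default // big1 // => i _.
by rewrite ltn_eqF ?mulr0 //; apply: leq_trans jg.
Qed.

Lemma rank_cmx_ge d p q : q != 0 -> (d - (size q).-1 <= \rank (pmx (cmx d p) q))%N.
Proof.
move=> q0; case: d => [|d] //; set D := (size q).-1.
case: (leqP d.+1 D) => [/eqP -> // | Dd].
set r := (d.+1 - D)%N.
pose A : 'M_(r, d.+1) := \matrix_(i < r) poly_rV ('X^i * q).
have szq : size q = D.+1 by rewrite prednK // lt0n size_poly_eq0.
have szr (u : 'rV[K]_r) : (size (rVpoly u * q)%R <= d.+1)%N.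
  apply: leq_trans (size_polyMleq _ _) _; rewrite szq addnS /=.
  apply: (@leq_trans (r + D)%N); first by rewrite leq_add2r size_poly.
  by rewrite /r subnK // ltnW.
have Au (u : 'rV_r) : u *m A = poly_rV (rVpoly u * q).
  rewrite mulmx_sum_row /rVpoly poly_def mulr_suml linear_sum /=.
  apply: eq_bigr => i _; rewrite rowK insubT //= => lt.
  by rewrite -scalerAl linearZ /=; congr (u _ _ *: _); apply: val_inj.
have rfA : row_free A.
  apply: inj_row_free => u; rewrite Au => /(congr1 rVpoly).
  rewrite poly_rV_K // linear0 => /eqP; rewrite mulf_eq0 (negPf q0) orbF => /eqP.
  by move/(congr1 (@poly_rV _ r)); rewrite rVpolyK linear0.
rewrite -(eqP (rfA : \rank A == r)); apply: mxrankS; apply/row_subP => i.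
rewrite rowK -(@row0_cmx d p) ?pmxM ?mulmxA ?submxMl //.
have := szr (delta_mx 0 i); rewrite rVpoly_delta //.
Qed.

Lemma cmx_root d p : p \is monic -> size p = d.+1 -> pmx (cmx d p) p = 0.
Proof.
move=> pmon szp; case: d szp => [|d] szp; first by rewrite flatmx0.
have := Cayley_Hamilton (@cmx d.+1 p).
have E : char_poly (@cmx d.+1 p) = p.
  rewrite -[RHS](@companionmxK _ p) ?/companionmx ?szp //.
by rewrite E.
Qed.

(** For a divisor q of p the two rank bounds from q(C)(p/q)(C) = 0 meet. *)
Lemma rank_cmx_dvd d p q : p \is monic -> size p = d.+1 -> q \is monic -> q %| p ->
  \rank (pmx (cmx d p) q) = (d - (size q).-1)%N.
Proof.
move=> pmon szp qmon /dvdpP [r pE].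
have p0 : p != 0 by rewrite monic_neq0.
have q0 : q != 0 by rewrite monic_neq0.
have r0 : r != 0 by apply: contra_neq p0; rewrite pE => ->; rewrite mul0r.
have szrq : (d = (size r).-1 + (size q).-1)%N.
  have := szp; rewrite pE size_mul // => /(congr1 predn) /= <-.
  rewrite -(prednK (_ : 0 < size r)%N) ?lt0n ?size_poly_eq0 //.
  by rewrite -{1}(prednK (_ : 0 < size q)%N) ?lt0n ?size_poly_eq0 // !addSn addnS.
have := mulmx0_rank_max (_ : pmx (cmx d p) r *m pmx (cmx d p) q = 0).
rewrite -pmxM -pE cmx_root // => /(_ erefl).
have := rank_cmx_ge d p q0; have := rank_cmx_ge d p r0.
move: (\rank _) (\rank _) szrq => a b; lia.
Qed.

End Companion.

(** * The rational canonical form *)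

Section Splitting.
Variable K : fieldType.

(** If the pairing of the rows of A with the columns of L is perfect, the
    annihilator of L is a complement of the row space of A, stable under
    every matrix that preserves the column space of L. *)
Lemma split_dual n d (A : 'M[K]_(d, n)) (L : 'M[K]_(n, d)) :
  A *m L \in unitmx ->
  exists n', exists W : 'M[K]_(n', n), exists Q1 : 'M[K]_(n, d), exists Q2 : 'M[K]_(n, n'),
    [/\ (d + n')%N = n, col_mx A W *m row_mx Q1 Q2 = 1%:M, row_mx Q1 Q2 *m col_mx A W = 1%:M
      & forall y : 'M_n, (exists Y, y *m L = L *m Y) -> W *m y = W *m y *m Q2 *m W].
Proof.
move=> uAL.
have dL : \rank L = d.
  apply/eqP; rewrite eqn_leq rank_leq_col /=.
  by rewrite -{1}(mxrank_unit uAL) mxrankM_maxr.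
have dn : (d <= n)%N by rewrite -dL rank_leq_row.
have [W [WL Wfree WE]] : exists W : 'M_(\rank (kermx L), n),
    [/\ W *m L = 0, row_free W & (W :=: kermx L)%MS].
  exists (row_base (kermx L)); split; first by apply/eqP; rewrite -sub_kermx eq_row_base.
    exact: row_base_free.
  exact: eq_row_base.
have fP : row_free (col_mx A W).
  apply: inj_row_free => u; rewrite -[u]hsubmxK mul_row_col => u0.
  have /(congr1 (mulmx^~ L)) /= := u0.
  rewrite mulmxDl -!mulmxA WL mulmx0 addr0 mul0mx => /(congr1 (mulmx^~ (invmx (A *m L)))).
  rewrite mul0mx mulmxK // => u1; move: u0; rewrite u1 mul0mx add0r => u2.
  have /row_freeP[B WB] := Wfree.
  move/(congr1 (mulmx^~ B)): u2; rewrite -mulmxA WB mulmx1 mul0mx => ->.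
  by rewrite row_mx0.
have dn' : (d + \rank (kermx L))%N = n by rewrite mxrank_ker dL subnKC.
have FP : row_full (col_mx A W).
  by rewrite /row_full (eqP (fP : \rank _ == _)) dn'.
pose Q := pinvmx (col_mx A W).
exists (\rank (kermx L)), W, (lsubmx Q), (rsubmx Q); rewrite hsubmxK; split=> //.
- by rewrite /Q mulmxVp.
- by rewrite /Q mulVpmx.
move=> y [Y yL].
have /submxP[c Wy] : (W *m y <= W)%MS.
  by rewrite WE sub_kermx -mulmxA yL mulmxA WL mul0mx.
rewrite Wy; congr (_ *m _); rewrite -mulmxA.
have /(congr1 drsubmx) : col_mx A W *m row_mx (lsubmx Q) (rsubmx Q) = 1%:M by rewrite hsubmxK /Q mulmxVp.
by rewrite mul_col_row block_mxKdr scalar_mx_block block_mxKdr => ->; rewrite mulmx1.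
Qed.

(** A cyclic block generated by v, with a functional l detecting its top
    vector, has an x-stable complement as soon as p kills l. *)
Lemma split_cyclic n d (x : 'M[K]_n) (v : 'rV_n) (l : 'cV_n) (p : {poly K}) :
  p \is monic -> size p = d.+1 -> v *m pmx x p = 0 -> pmx x p *m l = 0 ->
  (forall k, (k < d)%N -> v *m x ^+ k *m l = ((k == d.-1)%:R)%:M) ->
  exists n', exists W : 'M[K]_(n', n), exists Q1 : 'M[K]_(n, d), exists Q2 : 'M[K]_(n, n'),
    [/\ (d + n')%N = n, col_mx (krylov d v x) W *m row_mx Q1 Q2 = 1%:M,
       row_mx Q1 Q2 *m col_mx (krylov d v x) W = 1%:M,
       W *m x = W *m x *m Q2 *m W
      & forall y : 'M_n, (exists D : 'M_d, y *m (krylov d l^T x^T)^T = (krylov d l^T x^T)^T *m D) ->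
          W *m y = W *m y *m Q2 *m W].
Proof.
move=> pmon szp vp pl vl.
pose L := \matrix_(i < n, j < d) (x ^+ (d.-1 - j) *m l) i 0.
pose M := (krylov d l^T x^T)^T.
have trX k : (x^T) ^+ k = (x ^+ k)^T by rewrite -!pmxXn pmx_tr.
have Mcol j : col j M = x ^+ j *m l.
  by rewrite /M -tr_row rowK trX -trmx_mul trmxK.
have Lcol j : col j L = x ^+ (d.-1 - j) *m l.
  by apply/colP => i; rewrite !mxE.
have ML : L = col_perm (perm (@rev_ord_inj d)) M.
  apply/matrixP => i j; rewrite [RHS]mxE permE.
  transitivity ((col j L) i 0); first by rewrite [RHS]mxE.
  transitivity ((col (rev_ord j) M) i 0); last by rewrite [LHS]mxE.
  by rewrite Lcol Mcol /= (_ : (d.-1 - j = d - j.+1)%N) //; lia.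
have uAL : krylov d v x *m M \in unitmx.
  have E i j : (krylov d v x *m L) i j = (v *m x ^+ (i + (d.-1 - j)) *m l) 0 0.
    transitivity ((row i (krylov d v x) *m col j L) 0 0).
      by rewrite colE -row_mul mulmxA -colE !mxE; apply: eq_bigr => k _; rewrite !mxE.
    by rewrite rowK Lcol exprD -[_ * _]/(_ *m _) !mulmxA.
  have trig : is_trig_mx (krylov d v x *m L).
    apply/is_trig_mxP => i j ij; rewrite E vl.
      by rewrite mxE (_ : (_ == _) = false) //; have := ltn_ord j; lia.
    by have := ltn_ord j; lia.
  have : krylov d v x *m L \in unitmx.
    rewrite unitmxE (det_trig trig) big1 ?unitr1 // => i _; rewrite E vl.
      by rewrite mxE (_ : (_ == _) = true) //; have := ltn_ord i; lia.
    by have := ltn_ord i; lia.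
  by rewrite ML col_permE mulmxA unitmx_mul => /andP[].
have [n' [W [Q1 [Q2 [dn PQ QP st]]]]] := split_dual uAL.
exists n', W, Q1, Q2; split=> //; apply: st; exists (cmx d p)^T.
have pl' : l^T *m pmx x^T p = 0 by rewrite pmx_tr -trmx_mul pl trmx0.
by have := krylovM pmon szp pl' => /(congr1 trmx); rewrite !trmx_mul trmxK.
Qed.

End Splitting.

Section RCF.
Variable K : closedFieldType.

Lemma closed_infinite (s : seq K) : exists a, a \notin s.
Proof.
case: s => [|z s]; first by exists 0.
have [a ra] : exists a, root (\prod_(z <- z :: s) ('X - z%:P) + 1) a.
  by apply/closed_rootP; rewrite size_polyDl size_prod_XsubC // size_poly1.
exists a; apply: contraTN ra => ins; rewrite /root hornerD hornerC.
by rewrite (rootP (_ : root _ a)) ?add0r ?oner_eq0 // root_prod_XsubC.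
Qed.

(** A vector space over an infinite field is not a finite union of proper
    subspaces. *)
Lemma avoid_kernels n m (Ms : seq 'M[K]_(n, m)) :
  (forall M, M \in Ms -> M != 0) -> exists v : 'rV_n, forall M, M \in Ms -> v *m M != 0.
Proof.
elim: Ms => [|M Ms IH] nz; first by exists 0.
have [v vP] : exists v : 'rV_n, forall M, M \in Ms -> v *m M != 0.
  by apply: IH => M' M's; apply: nz; rewrite inE M's orbT.
have [w wM] : exists w : 'rV_n, w *m M != 0.
  have /rowV0Pn[_ /submxP[w ->] ne] : M != 0 by apply: nz; rewrite inE eqxx.
  by exists w.
(* The finitely many values of s for which v + s w may fall into a kernel
   that does not contain w. *)
pose bad := flatten [seq [seq - (v *m M') 0 j / (w *m M') 0 j | j <- enum 'I_m] | M' <- M :: Ms].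
have [s sbad] := closed_infinite bad.
exists (v + s *: w) => M' M's; apply/eqP => vs0.
have vw j : (v *m M') 0 j = - s * (w *m M') 0 j.
  move/rowP/(_ j): vs0; rewrite mulmxDl -scalemxAl !mxE => /eqP.
  by rewrite addr_eq0 mulNr => /eqP.
case: (eqVneq (w *m M') 0) => [wM'|/rV0Pn[j wj]]; last first.
  move/negP: sbad; apply; apply/flatten_mapP; exists M' => //.
  apply/mapP; exists j; rewrite ?mem_enum //.
  by rewrite vw -mulNr opprK mulfK.
have vM' : v *m M' = 0 by apply/rowP => j; rewrite vw wM' !mxE mulr0.
move: M's; rewrite inE => /orP[/eqP E|M's]; first by rewrite -E wM' eqxx in wM.
by move: (vP _ M's); rewrite vM' eqxx.
Qed.

(** A vector avoiding the kernels of p/(X - z) at the roots z of the minimal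
    polynomial p is annihilated by no proper divisor of p. *)
Lemma cyclic_vector n (x : 'M[K]_n.+1) :
  exists v : 'rV_n.+1, forall q, v *m pmx x q = 0 -> mxminpoly x %| q.
Proof.
set p := mxminpoly x.
have pmon : p \is monic by apply: mxminpoly_monic.
have p0 : p != 0 by apply: monic_neq0.
have [rs pE] := closed_field_poly_normal p.
rewrite (monicP pmon) scale1r in pE.
have fac z : z \in rs -> exists2 q, p = q * ('X - z%:P) & q != 0.
  move=> zrs; have /factor_theorem[q qE] : root p z by rewrite pE root_prod_XsubC.
  by exists q => //; apply: contra_neq p0; rewrite qE => ->; rewrite mul0r.
have [|v vP] := @avoid_kernels n.+1 n.+1 [seq pmx x (p %/ ('X - z%:P)) | z <- rs].
  move=> _ /mapP[z zrs ->]; apply/eqP => /mxminpoly_min; have [q qE q0] := fac _ zrs.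
  rewrite -/p {2}qE mulpK ?polyXsubC_eq0 // => /(dvdp_leq q0).
  by rewrite qE size_mul ?polyXsubC_eq0 // size_XsubC addn2 /= ltnn.
exists v => q vq; set g := gcdp q p.
have [a [b [c gE]]] : exists a b c, g = c * (a * q + b * p).
  by have [[a b] /= /andP[/dvdpP[c gE] _]] := Bezoutp q p; exists a, b, c.
have vg : v *m pmx x g = 0.
  have px : pmx x p = 0 by apply: mx_root_minpoly.
  rewrite gE mulrC pmxM pmxD (pmxM x b) px mulmx0 addr0 (mulrC a) pmxM.
  by rewrite !mulmxA vq !mul0mx.
have /dvdpP[r rE] : g %| p by apply: dvdp_gcdr.
have [/closed_rootP[z rz]|] := boolP (size r != 1%N).
  have zrs : z \in rs by rewrite -root_prod_XsubC -pE rE rootM rz.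
  have /factor_theorem[r' r'E] := rz.
  case/eqP: (vP _ (map_f _ zrs)).
  rewrite rE r'E -mulrA [(_ - _) * g]mulrC mulrA mulpK ?polyXsubC_eq0 //.
  by rewrite mulrC pmxM mulmxA vg mul0mx.
rewrite negbK => /size_poly1P[k k0 rk].
by rewrite rE rk mul_polyC dvdpZl // dvdp_gcdl.
Qed.
End RCF.

Section Frobenius.
Variable K : fieldType.
Implicit Types (p q : {poly K}) (ps : seq {poly K}) (ds : seq nat).

(** The block sizes are given apart from the polynomials, so that the canonical
    forms of e and of another matrix with the same degrees have the same type. *)
Fixpoint fmx ds ps : 'M[K]_(sumn ds) :=
  if ds is d :: ds' then block_mx (cmx d (head 0 ps)) 0 0 (fmx ds' (behead ps)) else 0.

Definition degs ps : seq nat := [seq (size p).-1 | p <- ps].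

Definition block_polys ps := all (fun p => (p \is monic) && (1 < size p)%N) ps.

Definition invariant_factors ps := block_polys ps && pairwise (fun p q => q %| p) ps.

Lemma rank_fmx ps q :
  \rank (pmx (fmx (degs ps) ps) q) = (\sum_(p <- ps) \rank (pmx (cmx (size p).-1 p) q))%N.
Proof.
elim: ps => [|p ps IH]; first by rewrite big_nil flatmx0 mxrank0.
by rewrite big_cons /= pmx_block rank_diag_block_mx IH.
Qed.

(** Invariant factors before a are multiples of p_a, later ones divide it. *)
Lemma rank_invariant_factor n (x : 'M_n) ps a :
  invariant_factors ps -> simmx x (fmx (degs ps) ps) -> (a < size ps)%N ->
  (\rank (pmx x (nth 0%R ps a)) + a * nth 0 (degs ps) a = sumn (take a (degs ps)))%N.
Proof.
move=> /andP[/allP bps chain] sx las; set q := nth 0%R ps a.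
rewrite (rank_simmx q sx) rank_fmx (nth_map 0) // -/q.
have qin : q \in ps by apply: mem_nth.
have /andP[qmon _] := bps _ qin.
rewrite -{1}[ps](cat_take_drop a) big_cat /= [X in (_ + X + _)%N]big1_seq; last first.
  move=> p /andP[_ pin].
  have pps : p \in ps by apply: mem_drop pin.
  have /andP[pmon szp] := bps _ pps.
  have /dvdpP[r ->] : p %| q.
    case/(nthP 0): pin => k; rewrite size_drop nth_drop => lk <-.
    case: k lk => [|k] lk; first by rewrite addn0 dvdpp.
    apply: (elimT (pairwiseP 0) chain a (a + k.+1)%N); rewrite -?topredE //=.
      by rewrite -ltn_subRL.
    by rewrite -addn1 leq_add2l.
  by rewrite pmxM cmx_root ?mulmx0 ?mxrank0 // prednK // ltnW.
rewrite addn0 /degs -map_take.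
have : {in take a ps, forall p, \rank (pmx (cmx (size p).-1 p) q) = ((size p).-1 - (size q).-1)%N
          /\ ((size q).-1 <= (size p).-1)%N}.
  move=> p pin; have pps : p \in ps by apply: mem_take pin.
  have /andP[pmon szp] := bps _ pps.
  have qp : q %| p.
    case/(nthP 0): pin => k; rewrite size_takel ?(ltnW las) // => lk <-.
    rewrite nth_take //; by apply: (elimT (pairwiseP 0) chain k a); rewrite -?topredE //= (ltn_trans lk las).
  rewrite rank_cmx_dvd //; last by rewrite prednK // ltnW.
  by rewrite -!subn1 leq_sub2r // dvdp_leq ?monic_neq0.
have sz : size (take a ps) = a by rewrite size_takel // ltnW.
rewrite -[X in (_ + X * _)%N]sz; elim: (take a ps) => [|p s IH] E; first by rewrite big_nil.
have [Ep lep] := E _ (mem_head _ _); rewrite big_cons Ep /= -IH.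
  by rewrite mulSn addnACA subnK.
by move=> p' p's; apply: E; rewrite inE p's orbT.
Qed.

End Frobenius.

(** The minimal polynomial splits off a cyclic block by duality; the other
    invariant factors divide it because it kills the complement. *)
Theorem rational_canonical_form (K : closedFieldType) n (x : 'M[K]_n) :
  exists ps, [/\ invariant_factors ps, simmx x (fmx (degs ps) ps)
    & forall q, pmx x q = 0 -> all (fun p => p %| q) ps].
Proof.
have [m] := ubnP n; elim: m n x => // m IH [|n] x lnm.
  exists [::]; split=> //; rewrite flatmx0 /=; exact: simmx_refl.
set p := mxminpoly x; set d := (size p).-1.
have pmon : p \is monic by apply: mxminpoly_monic.
have szp : size p = d.+1 by rewrite /d /p size_mxminpoly.
have dgt0 : (0 < d)%N by rewrite /d /p size_mxminpoly mxminpoly_nonconstant.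
have px : pmx x p = 0 by apply: mx_root_minpoly.
have [v vP] := cyclic_vector x.
have vK (u : 'rV_d) : u *m krylov d v x = v *m pmx x (rVpoly u).
  rewrite mulmx_sum_row /rVpoly poly_def pmx_sum mulmx_sumr; apply: eq_bigr => i _.
  rewrite rowK insubT // => lt; rewrite pmxZ pmxXn -scalemxAr.
  by congr (u _ _ *: _); apply: val_inj.
have /row_freeP[B KB] : row_free (krylov d v x).
  apply: inj_row_free => u; rewrite vK => /vP pu.
  have /eqP u0 : rVpoly u == 0.
    by apply: contraTT pu => nz; apply/negP => /(dvdp_leq nz); rewrite -/p szp leqNgt ltnS size_poly.
  by rewrite -[u]rVpolyK u0 linear0.
have ld : (d.-1 < d)%N by rewrite prednK.
(* The functional l takes the last coordinate with respect to the Krylov vectors. *)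
pose l := B *m delta_mx (Ordinal ld) (0 : 'I_1).
have vp : v *m pmx x p = 0 by rewrite px mulmx0.
have pl : pmx x p *m l = 0 by rewrite px mul0mx.
have vl k : (k < d)%N -> v *m x ^+ k *m l = ((k == d.-1)%:R)%:M.
  move=> lk; transitivity (row (Ordinal lk) (krylov d v x) *m l); first by rewrite rowK.
  rewrite -row_mul mulmxA KB mul1mx; apply/matrixP => i j; rewrite !ord1 !mxE eqxx andbT mulr1n.
  by congr (_%:R).
have [n' [W [Q1 [Q2 [dn PQ QP Wx _]]]]] := split_cyclic pmon szp vp pl vl.
set x' := W *m x *m Q2.
have Px : col_mx (krylov d v x) W *m x = block_mx (cmx d p) 0 0 x' *m col_mx (krylov d v x) W.
  by rewrite mul_block_col mul_col_mx (krylovM pmon szp vp) Wx !mul0mx addr0 add0r.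
have [] := IH n' x'; first by lia.
move=> ps [inv sx' dv].
have kx' q : pmx x q = 0 -> pmx x' q = 0.
  move=> xq; have /esym := pmx_intertwine q Px; rewrite xq mulmx0.
  move/(congr1 (mulmx^~ (row_mx Q1 Q2))); rewrite -mulmxA PQ mulmx1 mul0mx pmx_block.
  by move/(congr1 drsubmx); rewrite block_mxKdr -[0]submxK block_mxKdr => ->; apply/matrixP => i j; rewrite !mxE.
exists (p :: ps); split.
- move: inv => /andP[bps ch]; rewrite /invariant_factors /= pmon szp ltnS dgt0 -/(block_polys ps) bps ch !andbT /=.
  by apply: dv; apply: kx'.
- apply: simmx_trans (_ : simmx _ (block_mx (cmx d p) 0 0 x')) _.
    by exists (col_mx (krylov d v x) W), (row_mx Q1 Q2).
  by apply: simmx_block => //; exact: simmx_refl.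
- by move=> q xq; rewrite /= mxminpoly_min //= dv // kx'.
Qed.

(** * Intertwiners *)

Section DimensionTools.
Variable K : fieldType.

Lemma dim_inj_le (A B : vectType K) (T : {linear A -> B}) (U : {vspace A}) (W : {vspace B}) :
  injective T -> (forall a, a \in U -> T a \in W) -> (\dim U <= \dim W)%N.
Proof.
move=> injT TU.
have <- : \dim (linfun T @: U) = \dim U.
  apply: limg_dim_eq; apply/eqP; rewrite -subv0; apply/subvP => a.
  rewrite memv_cap memv_ker lfunE memv0 => /andP[_ /eqP Ta].
  by apply/eqP/injT; rewrite Ta linear0.
by apply: dimvS; apply/subvP => _ /memv_imgP[a aU ->]; rewrite lfunE TU.
Qed.

Lemma dim_param (A B : vectType K) (T : {linear A -> B}) (U : {vspace B}) :
  injective T -> (forall b, b \in U <-> exists a, b = T a) -> \dim U = \dim {:A}.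
Proof.
move=> injT UP; apply/eqP; rewrite eqn_leq; apply/andP; split; last first.
  by apply: (@dim_inj_le _ _ T) => // a _; apply/UP; exists a.
have <- : \dim (linfun T @: fullv) = \dim {:A}.
  apply: limg_dim_eq; apply/eqP; rewrite -subv0; apply/subvP => a.
  rewrite memv_cap memv_ker lfunE memv0 => /andP[_ /eqP Ta].
  by apply/eqP/injT; rewrite Ta linear0.
by apply: dimvS; apply/subvP => b /UP[a ->]; apply/memv_imgP; exists a; rewrite ?memvf ?lfunE.
Qed.

End DimensionTools.

Section Intertwiners.
Variable K : fieldType.

Definition itw m n (x : 'M[K]_m) (y : 'M[K]_n) (z : 'M[K]_(m, n)) := x *m z - z *m y.

Lemma itw_is_linear m n (x : 'M_m) (y : 'M_n) : linear (@itw m n x y).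
Proof.
move=> a u v; rewrite /itw mulmxDr mulmxDl -scalemxAr -scalemxAl scalerBr.
by rewrite opprD addrACA.
Qed.
HB.instance Definition _ m n x y :=
  GRing.isLinear.Build K 'M[K]_(m, n) 'M[K]_(m, n) *:%R (@itw m n x y) (itw_is_linear x y).

(** For a fixed block companion matrix x this dimension is the sum of those of
    the kernels of the p(y), p running through the polynomials of the blocks: so
    it is computed by ranks, both for centralizers and for matrices compared with
    their transposes. *)
Definition idim m n (x : 'M[K]_m) (y : 'M[K]_n) : nat := \dim (lker (linfun (itw x y))).

Lemma itwP m n (x : 'M_m) (y : 'M_n) z :
  reflect (x *m z = z *m y) (z \in lker (linfun (itw x y))).
Proof. by rewrite memv_ker lfunE subr_eq0; apply: eqP. Qed.

Lemma idim_siml l m n (x : 'M_l) (x' : 'M_m) (y : 'M_n) :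
  simmx x x' -> idim x y = idim x' y.
Proof.
suff le l' m' (u : 'M[K]_l') (u' : 'M_m') : simmx u u' -> (idim u y <= idim u' y)%N.
  by move=> s; apply/eqP; rewrite eqn_leq !le //; apply: simmx_sym.
case=> P [Q [PQ QP Pxy]].
apply: (@dim_inj_le _ _ _ (mulmx P)) => [z1 z2 /(congr1 (mulmx Q))|z /itwP uz].
  by rewrite !mulmxA QP !mul1mx.
by apply/itwP; rewrite mulmxA -Pxy -!mulmxA uz.
Qed.

Lemma idim_simr l m n (x : 'M_l) (y : 'M_m) (y' : 'M_n) :
  simmx y y' -> idim x y = idim x y'.
Proof.
suff le m' n' (u : 'M[K]_m') (u' : 'M_n') : simmx u u' -> (idim x u' <= idim x u)%N.
  by move=> s; apply/eqP; rewrite eqn_leq !le //; apply: simmx_sym.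
case=> P [Q [PQ QP Pxy]].
apply: (@dim_inj_le _ _ _ (mulmxr P)) => [z1 z2 /(congr1 (mulmx^~ Q))|z /itwP uz].
  by rewrite /= -!mulmxA PQ !mulmx1.
by apply/itwP; rewrite /= mulmxA uz -!mulmxA Pxy.
Qed.

Lemma idim_block m1 m2 n (x1 : 'M_m1) (x2 : 'M_m2) (y : 'M_n) :
  idim (block_mx x1 0 0 x2) y = (idim x1 y + idim x2 y)%N.
Proof.
have cu_lin : linear (fun z : 'M[K]_(m1, n) => col_mx z (0 : 'M_(m2, n))).
  by move=> a u v; rewrite scale_col_mx add_col_mx scaler0 addr0.
have cd_lin : linear (fun z : 'M[K]_(m2, n) => col_mx (0 : 'M_(m1, n)) z).
  by move=> a u v; rewrite scale_col_mx add_col_mx scaler0 addr0.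
pose cuL := GRing.isLinear.Build K _ _ _ _ cu_lin.
pose cdL := GRing.isLinear.Build K _ _ _ _ cd_lin.
pose cu : {linear _ -> _} := HB.pack (fun z : 'M[K]_(m1, n) => col_mx z (0 : 'M_(m2, n))) cuL.
pose cd : {linear _ -> _} := HB.pack (fun z : 'M[K]_(m2, n) => col_mx (0 : 'M_(m1, n)) z) cdL.
set U1 := lker (linfun (itw x1 y)); set U2 := lker (linfun (itw x2 y)).
have d1 : \dim (linfun cu @: U1) = \dim U1.
  apply: limg_dim_eq; apply/eqP; rewrite -subv0; apply/subvP => a.
  rewrite memv_cap memv_ker lfunE memv0 /= => /andP[_ /eqP].
  by rewrite -col_mx0 => /eq_col_mx[-> _].
have d2 : \dim (linfun cd @: U2) = \dim U2.
  apply: limg_dim_eq; apply/eqP; rewrite -subv0; apply/subvP => a.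
  rewrite memv_cap memv_ker lfunE memv0 /= => /andP[_ /eqP].
  by rewrite -col_mx0 => /eq_col_mx[_ ->].
rewrite /idim -/U1 -/U2 -d1 -d2 -dimv_disjoint_sum; last first.
  apply/eqP; rewrite -subv0; apply/subvP => a; rewrite memv_cap memv0.
  case/andP=> /memv_imgP[b1 _ ->] /memv_imgP[b2 _]; rewrite !lfunE /=.
  by move=> /eq_col_mx[-> _]; rewrite col_mx0.
congr (\dim _); apply/vspaceP => z; apply/itwP/memv_addP.
  rewrite -[z]vsubmxK mul_block_col mul_col_mx !mul0mx addr0 add0r => /eq_col_mx[e1 e2].
  exists (cu (usubmx z)).
    by apply/memv_imgP; exists (usubmx z); rewrite ?lfunE //; apply/itwP.
  exists (cd (dsubmx z)).
    by apply/memv_imgP; exists (dsubmx z); rewrite ?lfunE //; apply/itwP.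
  by rewrite /= add_col_mx addr0 add0r.
move=> [_ /memv_imgP[z1 /itwP e1 ->] [_ /memv_imgP[z2 /itwP e2 ->]] ->].
rewrite !lfunE /= add_col_mx addr0 add0r.
by rewrite mul_block_col mul_col_mx !mul0mx addr0 add0r e1 e2.
Qed.

(** An intertwiner out of a companion block is determined by the image of the
    cyclic generator, any vector killed by p(y). *)
Lemma idim_cmx d n (y : 'M_n) p : (0 < d)%N -> p \is monic -> size p = d.+1 ->
  idim (cmx d p) y = (n - \rank (pmx y p))%N.
Proof.
case: d => // d _ pmon szp.
set R := row_base (kermx (pmx y p)).
have kl : linear (fun u : 'rV[K]_(\rank (kermx (pmx y p))) => krylov d.+1 (u *m R) y).
  move=> a u v; apply/row_matrixP => i.
  by rewrite linearD linearZ /= !rowK mulmxDl mulmxDl -!scalemxAl.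
pose kL := GRing.isLinear.Build K _ _ _ _ kl.
pose T : {linear _ -> _} := HB.pack (fun u : 'rV[K]_(\rank (kermx (pmx y p))) => krylov d.+1 (u *m R) y) kL.
rewrite -mxrank_ker /idim (@dim_param _ _ _ T).
- by rewrite dimvf dim_matrix [LHS]mul1n.
- move=> u v /(congr1 (row 0)); rewrite /= !rowK expr0 !mulmx1 => uv.
  have /row_freeP[B RB] : row_free R by apply: row_base_free.
  by rewrite -[u]mulmx1 -RB mulmxA uv -mulmxA RB mulmx1.
move=> z; split=> [/itwP Cz|[u ->]].
  have := pmx_intertwine p (esym Cz); rewrite cmx_root // mul0mx => zp.
  have /submxP[u uR] : (row 0 z <= R)%MS by rewrite eq_row_base sub_kermx -row_mul zp row0.
  exists u; rewrite /= -uR; apply/row_matrixP => i; rewrite rowK -row_mul.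
  have := pmx_intertwine 'X^i (esym Cz); rewrite !pmxXn => ->.
  rewrite row_mul rowE -pmxXn row0_cmx ?size_polyXn // rowE; congr (_ *m _).
  by apply/rowP => j; rewrite !mxE coefXn eqxx.
apply/itwP; rewrite /= -(@krylovM _ _ _ _ _ p) //.
by apply/eqP; rewrite -sub_kermx mulmx_sub // eq_row_base.
Qed.

Lemma idim_fmx n ps (y : 'M_n) : block_polys ps ->
  idim (fmx (degs ps) ps) y = (\sum_(p <- ps) (n - \rank (pmx y p)))%N.
Proof.
elim: ps => [|p ps IH].
  move=> _; rewrite big_nil /idim; apply/eqP; rewrite -leqn0.
  by apply: leq_trans (dimvS (subvf _)) _; rewrite dimvf.
move=> /andP[/andP[pmon szp] bps]; rewrite big_cons /= idim_block IH //.
have sz : size p = (size p).-1.+1 by rewrite prednK // ltnW.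
rewrite (@idim_cmx _ _ _ p) //.
by move: szp; rewrite sz.
Qed.

End Intertwiners.

(** * Degrees of the invariant factors *)

Section Kappa.
Variable K : fieldType.
Implicit Types (ps : seq {poly K}) (ds : seq nat).

(** The submodule generated by the rows of B is gen_space n B x, by
    Cayley-Hamilton; the bound on the exponents varies in inductions over blocks. *)
Definition gen_space m i n (B : 'M[K]_(i, n)) (x : 'M[K]_n) : 'M[K]_n :=
  (\sum_(j < m) <<B *m x ^+ j>>)%MS.

Lemma gen_space_sub m i n (B : 'M_(i, n)) (x : 'M_n) j : (j < m)%N -> 
  (B *m x ^+ j <= gen_space m B x)%MS.
Proof.
move=> lj; rewrite /gen_space; apply: (submx_trans _ (sumsmx_sup (Ordinal lj) _ (submx_refl _))) => //.
by rewrite genmxE.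
Qed.

(** Reduction modulo q: all but the first deg q powers fall into the image of
    q(x). *)
Lemma rank_gen_space_le m i n (B : 'M_(i, n)) (x : 'M_n) q : q \is monic ->
  (\rank (gen_space m B x) <= \rank (pmx x q) + i * (size q).-1)%N.
Proof.
move=> qmon; set D := (size q).-1.
have le : (gen_space m B x <= pmx x q + gen_space D B x)%MS.
  apply/sumsmx_subP => j _; rewrite genmxE -pmxXn (divp_eq 'X^j q) pmxD mulmxDr.
  apply: addmx_sub_adds; first by rewrite pmxM mulmxA submxMl.
  have szm : (size ('X^j %% q)%R <= D)%N.
    rewrite -ltnS /D prednK ?ltn_modp ?monic_neq0 // lt0n size_poly_eq0 monic_neq0 //.
  rewrite pmxE mulmx_sumr summx_sub // => k _.
  by rewrite -scalemxAr scalemx_sub // gen_space_sub // (leq_trans (ltn_ord k)).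
apply: leq_trans (mxrankS le) _; apply: leq_trans (mxrank_adds_leqif _ _) _.
rewrite leq_add2l /gen_space.
apply: leq_trans (_ : (\sum_(j < D) i <= _)%N); last by rewrite sum_nat_const card_ord mulnC.
elim/big_ind2: _ => [|a b A1 A2 h1 h2|k _]; first by rewrite mxrank0.
  by apply: leq_trans (mxrank_adds_leqif _ _) (leq_add _ _).
by rewrite mxrank_gen rank_leq_row.
Qed.

(** The first unit vector of each companion block generates the block. *)
Lemma gen_space_fmx i ds ps : all (ltn 0) ds ->
  exists B : 'M[K]_(i, sumn ds), exists2 A : 'M[K]_(sumn (take i ds), sumn ds), row_free A
    & forall m, (sumn ds <= m)%N -> (A <= gen_space m B (fmx ds ps))%MS.
Proof.
elim: i ds ps => [|i IH] [|d ds] ps //=.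
- by move=> _; exists 0, 0 => [|m _]; rewrite ?sub0mx //; apply: inj_row_free => u _; apply: thinmx0.
- by move=> _; exists 0, 0 => [|m _]; rewrite ?sub0mx //; apply: inj_row_free => u _; apply: thinmx0.
- by move=> _; exists 0, 0 => [|m _]; rewrite ?sub0mx //; apply: inj_row_free => u _; apply: thinmx0.
move=> /andP[d0 ds0]; have [B [A fA AB]] := IH ds (behead ps) ds0.
case: d d0 => // d _; set C := cmx d.+1 (head 0 ps).
exists (block_mx (delta_mx 0 0 : 'rV_d.+1) 0 0 B), (block_mx 1%:M 0 0 A).
  apply: inj_row_free => u; rewrite -[u]hsubmxK mul_row_block !mulmx0 addr0 add0r mulmx1.
  rewrite -row_mx0 => /eq_row_mx[-> uA]; have /row_freeP[A' AA'] := fA.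
  by rewrite -[rsubmx u]mulmx1 -AA' mulmxA uA mul0mx row_mx0.
move=> m lm.
have pw j : block_mx C 0 0 (fmx ds (behead ps)) ^+ j = block_mx (C ^+ j) 0 0 (fmx ds (behead ps) ^+ j).
  by rewrite -!pmxXn pmx_block.
have gen j : (j < m)%N -> (row_mx ((delta_mx 0 0 : 'rV_d.+1) *m C ^+ j) 0 <= 
    gen_space m (block_mx (delta_mx 0 0 : 'rV_d.+1) 0 0 B) (block_mx C 0 0 (fmx ds (behead ps))))%MS.
  move=> lj; apply: submx_trans (gen_space_sub _ _ lj); rewrite pw mulmx_block !mulmx0 !mul0mx !addr0 !add0r.
  by have := submx_refl (block_mx ((delta_mx 0 0 : 'rV_d.+1) *m C ^+ j) 0 0 (B *m fmx ds (behead ps) ^+ j)); rewrite {1}block_mxEv col_mx_sub => /andP[].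
have gen2 j : (j < m)%N -> (row_mx 0 (B *m fmx ds (behead ps) ^+ j) <= 
    gen_space m (block_mx (delta_mx 0 0 : 'rV_d.+1) 0 0 B) (block_mx C 0 0 (fmx ds (behead ps))))%MS.
  move=> lj; apply: submx_trans (gen_space_sub _ _ lj); rewrite pw mulmx_block !mulmx0 !mul0mx !addr0 !add0r.
  by have := submx_refl (block_mx ((delta_mx 0 0 : 'rV_d.+1) *m C ^+ j) 0 0 (B *m fmx ds (behead ps) ^+ j)); rewrite {1}block_mxEv col_mx_sub => /andP[].
rewrite block_mxEv col_mx_sub; apply/andP; split.
  apply/row_subP => j; rewrite row_row_mx row0 rowE mulmx1.
  have -> : delta_mx 0 j = (delta_mx 0 0 : 'rV_d.+1) *m C ^+ j.
    rewrite -pmxXn row0_cmx ?size_polyXn //.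
    by apply/rowP => k; rewrite !mxE coefXn eqxx.
  by apply: gen; have := ltn_ord j; move: lm; lia.
have lm' : (sumn ds <= m)%N by lia.
have mE z : row_mx 0 z = z *m row_mx (0 : 'M[K]_(_, d.+1)) 1%:M by rewrite mul_mx_row mulmx0 mulmx1.
rewrite mE; apply: submx_trans (submxMr _ (AB m lm')) _.
rewrite /gen_space sumsmxMr_gen; apply/sumsmx_subP => j _.
by rewrite genmxE (eqmxMr _ (genmxE _)) -mE gen2.
Qed.

Lemma sumn_take_nth ds a : sumn (take a.+1 ds) = (sumn (take a ds) + nth 0 ds a)%N.
Proof.
case: (ltnP a (size ds)) => h; first by rewrite (take_nth 0) // -cats1 sumn_cat /= addn0.
by rewrite nth_default // addn0 !take_oversize // ltnW.
Qed.

Lemma sumn_take_le ds a : (sumn (take a ds) <= sumn ds)%N.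
Proof. by rewrite -{2}(cat_take_drop a ds) sumn_cat leq_addr. Qed.

Lemma all_degs_gt0 ps : block_polys ps -> all (ltn 0) (degs ps).
Proof.
move=> /allP bps; apply/allP => _ /mapP[p pin ->]; have /andP[_] := bps _ pin.
by case: (size p) => [|[]].
Qed.

Lemma simmx_dim m n (x : 'M[K]_m) (y : 'M[K]_n) : simmx x y -> n = m.
Proof.
move=> [P [Q [PQ QP _]]].
have := mxrankM_maxl P Q; rewrite PQ mxrank1 => h1.
have := mxrankM_maxl Q P; rewrite QP mxrank1 => h2.
have h3 := rank_leq_col P; have h4 := rank_leq_col Q.
by apply/eqP; rewrite eqn_leq (leq_trans h1 h3) (leq_trans h2 h4).
Qed.

(** The function kappa_i is the sum of the first i degrees: the upper bound is
    reduction modulo the next invariant factor, and the first unit vectors of the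
    blocks attain it. *)
Lemma rank_gen_space n (x : 'M_n) ps i k :
  invariant_factors ps -> simmx x (fmx (degs ps) ps) ->
  (forall B : 'M_(i, n), (\rank (gen_space n B x) <= k)%N) <-> (sumn (take i (degs ps)) <= k)%N.
Proof.
move=> inv sx; have /andP[bps _] := inv; have [P [Q [PQ QP Px]]] := sx.
have dn : sumn (degs ps) = n := simmx_dim sx.
split=> [H|le B].
  have [B [A fA AB]] := gen_space_fmx i ps (all_degs_gt0 bps).
  apply: leq_trans (H (B *m P)); rewrite -(eqP (fA : \rank A == _)).
  have -> : \rank A = \rank (A *m P).
    apply/eqP; rewrite eqn_leq [(\rank (A *m P) <= _)%N]mxrankM_maxl andbT.
    by rewrite -{1}[A]mulmx1 -PQ mulmxA mxrankM_maxl.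
  apply: mxrankS; apply: submx_trans (submxMr _ (AB n _)) _; first by rewrite dn.
  rewrite /gen_space sumsmxMr_gen; apply/sumsmx_subP => j _.
  rewrite genmxE (eqmxMr _ (genmxE _)) -mulmxA -pmxXn -(pmx_intertwine _ Px) mulmxA pmxXn.
  exact: gen_space_sub.
case: (ltnP i (size ps)) => h; last first.
  apply: leq_trans le; rewrite take_oversize ?size_map // dn; exact: rank_leq_col.
apply: leq_trans le; rewrite -(rank_invariant_factor inv sx h) (nth_map 0) //.
apply: rank_gen_space_le.
by have /allP/(_ _ (mem_nth 0 h))/andP[] := bps.
Qed.

(** Upper bounds for the ranks are the closed conditions, and it is through them
    that the degrees of the invariant factors are controlled on a sheet. *)
Definition kappa_le n (x : 'M[K]_n) i k := forall B : 'M_(i, n), (\rank (gen_space n B x) <= k)%N.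

(** The centralizer has dimension the sum over a of n - rank p_a(x), where
    rank_invariant_factor gives the ranks; the terms a * d_a are then removed by
    Abel summation. *)
Lemma idim_degs n (x : 'M_n) ps : invariant_factors ps -> simmx x (fmx (degs ps) ps) ->
  (idim x x + 2 * (\sum_(a < n) sumn (take a (degs ps))) + n = 2 * n * n)%N.
Proof.
move=> inv sx; have /andP[bps _] := inv.
have dn : sumn (degs ps) = n := simmx_dim sx.
set ka := fun a => sumn (take a (degs ps)); set la := fun a => nth 0 (degs ps) a.
have kS a : ka a.+1 = (ka a + la a)%N by apply: sumn_take_nth.
have kn a : (ka a <= n)%N by rewrite -[X in (_ <= X)%N]dn; apply: sumn_take_le.
have szps : (size ps <= n)%N.
  rewrite -dn -(size_map (fun p : {poly K} => (size p).-1)) -/(degs ps).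
  by elim: (degs ps) (all_degs_gt0 bps) => //= d ds IH /andP[d0 /IH]; lia.
have kN : ka n = n by rewrite /ka take_oversize ?size_map // dn.
have E : idim x x = (\sum_(a < n) (n + a * la a - ka a))%N.
  rewrite (idim_siml _ sx) idim_fmx // (big_nth 0) big_mkord.
  rewrite (big_ord_widen n (fun a => n - \rank (pmx x (nth 0%R ps a)))%N) // big_mkcond /=.
  apply: eq_bigr => a _; case: ifP => h.
    have := rank_invariant_factor inv sx h; rewrite -/(la a) -/(ka a).
    have := rank_leq_col (pmx x (nth 0%R ps a)).
    by move: (\rank _) (la a) (ka a) => r l k; lia.
  by rewrite /la /ka nth_default ?size_map 1?leqNgt ?h // take_oversize ?size_map 1?leqNgt ?h // dn muln0 addn0 subnn.
have F m : (m <= n)%N -> (\sum_(a < m) (n + a * la a - ka a) + 2 * \sum_(a < m) ka a + ka m = m * n + m * ka m)%N.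
  elim: m => [|m IH] lm; first by rewrite !big_ord0 /ka take0.
  rewrite !big_ord_recr /=; have := IH (ltnW lm); have := kn m; rewrite (kS m).
  move: (ka m) (la m) (\sum_(a < m) _)%N (\sum_(a < m) _)%N => k l s1 s2; nia.
have := F n (leqnn n); rewrite kN -E; move: (\sum_(a < n) _)%N => s; nia.
Qed.

(** The partial sums of the degrees are ordered termwise and have equal totals by
    idim_degs, so they coincide. *)
Lemma degs_eq n (x y : 'M[K]_n) (ps qs : seq {poly K}) :
  invariant_factors ps -> simmx x (fmx (degs ps) ps) ->
  invariant_factors qs -> simmx y (fmx (degs qs) qs) ->
  (forall i, (i < n)%N -> (sumn (take i (degs ps)) <= sumn (take i (degs qs)))%N) ->
  idim x x = idim y y -> degs ps = degs qs.
Proof.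
move=> invp sx invq sy le E.
have := idim_degs invp sx; have := idim_degs invq sy; rewrite E => h1 h2.
have sE : (\sum_(a < n) sumn (take a (degs ps)) = \sum_(a < n) sumn (take a (degs qs)))%N by lia.
have dn (z : 'M_n) (rs : seq {poly K}) : simmx z (fmx (degs rs) rs) -> sumn (degs rs) = n.
  exact: simmx_dim.
have szn (z : 'M_n) (rs : seq {poly K}) : invariant_factors rs -> simmx z (fmx (degs rs) rs) -> (size (degs rs) <= n)%N.
  move=> /andP[/all_degs_gt0 bps _] /dn <-.
  by elim: (degs rs) bps => //= d ds IH /andP[d0 /IH]; lia.
have kE i : sumn (take i (degs ps)) = sumn (take i (degs qs)).
  case: (ltnP i n) => h; last first.
    have s1 := leq_trans (szn _ _ invp sx) h; have s2 := leq_trans (szn _ _ invq sy) h.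
    by rewrite !take_oversize // (dn _ _ sx) (dn _ _ sy).
  have E2 (F : 'I_n -> nat) : (\sum_(a < n) F a = F (Ordinal h) + \sum_(a < n | a != Ordinal h) F a)%N.
    by rewrite (bigD1 (Ordinal h)).
  move: sE; rewrite !E2 /= => sE; apply/eqP; rewrite eqn_leq le //=.
  rewrite -(leq_add2r (\sum_(a < n | a != Ordinal h) sumn (take a (degs ps)))) sE leq_add2l.
  by apply: leq_sum => a _; apply: le.
have nE i : nth 0%N (degs ps) i = nth 0%N (degs qs) i.
  by have := kE i.+1; rewrite !sumn_take_nth kE => /addnI.
have szE s t : all (ltn 0) s -> (forall i, nth 0%N s i = nth 0%N t i) -> (size s <= size t)%N.
  move=> /allP s0 st; rewrite leqNgt; apply/negP => lt.
  by have := s0 _ (mem_nth 0%N lt); rewrite st nth_default.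
apply: (@eq_from_nth _ 0%N) => [|i _]; last exact: nE.
apply/eqP; rewrite eqn_leq !szE //; apply: all_degs_gt0.
  by case/andP: invq.
by case/andP: invp.
Qed.

End Kappa.

(** * Representations of sl_2 *)

Section Char0.
Variables (K : fieldType) (charK : [pchar K] =i pred0).

Lemma natr_eq0 n : ((n%:R : K) == 0) = (n == 0)%N.
Proof. exact: (pcharf0P K).1. Qed.

Lemma natr_inj (m n : nat) : (m%:R : K) = n%:R -> m = n.
Proof.
wlog le : m n / (m <= n)%N => [H E|].
  by case: (leqP m n) => h; [apply: H | apply/esym; apply: H => //; apply: ltnW].
move=> /esym/eqP; rewrite -subr_eq0 -natrB // natr_eq0 subn_eq0 => le2.
by apply/eqP; rewrite eqn_leq le.
Qed.

Lemma intr_eq0 (k : int) : ((k%:~R : K) == 0) = (k == 0).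
Proof.
case: k => n; first exact: natr_eq0.
rewrite NegzE [_%:~R]rmorphN [LHS]oppr_eq0; exact: natr_eq0.
Qed.

Lemma intr_inj (k l : int) : (k%:~R : K) = l%:~R -> k = l.
Proof. by move/eqP; rewrite -subr_eq0 -rmorphB /= intr_eq0 subr_eq0 => /eqP. Qed.
End Char0.

Section Sl2.
Variables (K : fieldType) (charK : [pchar K] =i pred0) (W : vectType K).
Implicit Types (E H F : 'End(W)) (w u v : W) (U : {vspace W}).

Definition sl2_ops E H F := [/\ forall w, H (E w) = E (H w) + E w *+ 2,
  forall w, H (F w) = F (H w) - F w *+ 2 & forall w, E (F w) - F (E w) = H w].

Definition nil_op E := exists m, forall w, iter m E w = 0.

Lemma sl2_ops_flip E H F : sl2_ops E H F -> sl2_ops F (- H) E.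
Proof.
case=> hE hF eF; split=> w; rewrite ?opp_lfunE.
- by rewrite hF linearN opprB addrC.
- by rewrite hE linearN opprD.
- by rewrite -eF opprB.
Qed.

Fixpoint hprod H (mus : seq K) w :=
  if mus is mu :: mus' then hprod H mus' (H w - mu *: w) else w.

Lemma hprodD H mus u v : hprod H mus (u + v) = hprod H mus u + hprod H mus v.
Proof.
elim: mus u v => //= mu mus IH u v; rewrite -IH; congr (hprod _ _ _).
by rewrite linearD scalerDr opprD addrACA.
Qed.

Lemma hprodZ H mus a u : hprod H mus (a *: u) = a *: hprod H mus u.
Proof.
elim: mus u => //= mu mus IH u; rewrite -IH; congr (hprod _ _ _).
by rewrite linearZ /= scalerBr !scalerA mulrC.
Qed.

Lemma hprod0 H mus : hprod H mus 0 = 0.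
Proof. by rewrite -[X in hprod _ _ X](scale0r 0) hprodZ scale0r. Qed.

Lemma hprod_eigen H mus mu v : H v = mu *: v ->
  hprod H mus v = (\prod_(nu <- mus) (mu - nu)) *: v.
Proof.
move=> Hv; elim: mus => [|nu mus IH] /=; first by rewrite big_nil scale1r.
by rewrite big_cons Hv -scalerBl hprodZ IH scalerA.
Qed.

(** Induction on the product: if H u - mu u is a sum of eigenvectors for other
    values k, dividing each of them by k - mu and subtracting them from u leaves
    an eigenvector for mu. *)
Lemma hprod_decomp H U mus u : (forall v, v \in U -> H v \in U) -> uniq mus -> u \in U ->
  hprod H mus u = 0 -> exists g : K -> W, u = \sum_(mu <- mus) g mu
    /\ forall mu, mu \in mus -> g mu \in U /\ H (g mu) = mu *: g mu.
Proof.
move=> HU; elim: mus u => [|mu mus IH] u /=.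
  by move=> _ _ ->; exists (fun _ => 0); rewrite big_nil.
move=> /andP[nin un] uU hu.
have u'U : H u - mu *: u \in U by rewrite rpredB ?HU ?rpredZ.
have [g [gE gP]] := IH _ un u'U hu.
pose g1 nu := (nu - mu)^-1 *: g nu.
pose S := \sum_(nu <- mus) g1 nu.
have SU : S \in U.
  by rewrite /S big_seq; apply: rpred_sum => nu /gP[gU _]; apply: rpredZ.
exists (fun nu => if nu == mu then u - S else g1 nu).
rewrite big_cons eqxx; split.
  have -> : \sum_(nu <- mus) (if nu == mu then u - S else g1 nu) = S.
    apply: eq_big_seq => nu nus; case: eqP => // E; by rewrite -E nus in nin.
  by rewrite subrK.
move=> nu; rewrite inE; case: (eqVneq nu mu) => [-> _|ne /= /gP[gU gH]]; last first.
  by split; [apply: rpredZ | rewrite linearZ /= gH !scalerA mulrC].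
split; first by rewrite rpredB.
have HS : H S = mu *: S + (H u - mu *: u).
  rewrite gE /S linear_sum scaler_sumr -big_split; apply: eq_big_seq => k ks /=.
  have [_ gk] := gP _ ks; rewrite linearZ /= gk !scalerA.
  have nz : k - mu != 0 by rewrite subr_eq0; apply: contraNneq nin => <-.
  rewrite -{3}[g k]scale1r -(mulVf nz) -scalerDl; congr (_ *: _); ring.
by rewrite linearB /= HS scalerBr opprD addrCA subKr addrC.
Qed.

Section Triple.
Variables (E H F : 'End(W)) (sl2 : sl2_ops E H F) (nilE : nil_op E).

Lemma HE w : H (E w) = E (H w) + E w *+ 2. Proof. by have [h _ _] := sl2. Qed.
Lemma HF w : H (F w) = F (H w) - F w *+ 2. Proof. by have [_ h _] := sl2. Qed.
Lemma EF w : E (F w) = F (E w) + H w. Proof. by have [_ _ h] := sl2; rewrite -h addrC subrK. Qed.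
Lemma FE w : F (E w) = E (F w) - H w. Proof. by rewrite EF addrK. Qed.

Lemma H_iterE k w : H (iter k E w) = iter k E (H w) + iter k E w *+ (2 * k).
Proof.
elim: k w => [|k IH] w; first by rewrite muln0 mulr0n addr0.
by rewrite iterS HE IH linearD linearMn /= -!iterS -addrA -mulrnDr mulnS addnC.
Qed.

Lemma iterD k u v : iter k E (u + v) = iter k E u + iter k E v.
Proof. by elim: k u v => //= k IH u v; rewrite IH linearD. Qed.
Lemma iterZ k a u : iter k E (a *: u) = a *: iter k E u.
Proof. by elim: k => //= k ->; rewrite linearZ. Qed.

Lemma F_iterE k u : F u = 0 -> 
  F (iter k.+1 E u) = - k.+1%:R *: iter k E (H u + k%:R *: u).
Proof.
move=> Fu; elim: k => [|k IH]; first by rewrite /= FE Fu linear0 sub0r scale0r addr0 scaleN1r.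
rewrite iterS FE IH H_iterE.
have -> : E (- k.+1%:R *: iter k E (H u + k%:R *: u)) =
    - k.+1%:R *: iter k.+1 E (H u) - (k.+1%:R * k%:R) *: iter k.+1 E u.
  by rewrite iterD iterZ linearZ linearD linearZ /= scalerDr scalerA mulNr !scaleNr.
rewrite iterD iterZ; set x := iter k.+1 E (H u); set y := iter k.+1 E u.
rewrite scalerDr scalerA -[y *+ _]scaler_nat opprD addrACA -!scaleNr -scalerDl.
rewrite -[- x]scaleN1r -scalerDl; congr (_ *: _ + _ *: _); rewrite ?natrM -?[k.+2%:R]natr1 -?[k.+1%:R]natr1; ring.
Qed.

Definition neg_weights m : seq K := [seq - i%:R | i <- iota 0 m].

(** On ker F the composite F^k E^k is, up to a nonzero scalar, H (H + 1) ... (H + k - 1). *)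
Lemma iterF_iterE k u : F u = 0 -> exists2 c : K, c != 0 &
  iter k F (iter k E u) = c *: hprod H (neg_weights k) u.
Proof.
have snoc mus mu v : hprod H (rcons mus mu) v = H (hprod H mus v) - mu *: hprod H mus v.
  by elim: mus v => //= nu mus IH v.
elim: k u => [|k IH] u Fu; first by exists 1; rewrite ?oner_eq0 // scale1r.
have FHu : F (H u + k%:R *: u) = 0.
  have := HF u; rewrite Fu linear0 mul0rn subr0 => h.
  by rewrite linearD linearZ /= Fu scaler0 addr0 -h.
rewrite iterSr F_iterE //.
have [c c0 cE] := IH _ FHu.
have iterFZ j a v : iter j F (a *: v) = a *: iter j F v by elim: j => //= j ->; rewrite linearZ.
exists (- k.+1%:R * c); first by rewrite mulf_eq0 oppr_eq0 negb_or (natr_eq0 charK).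
rewrite iterFZ cE scalerA; congr (_ *: _).
rewrite hprodD hprodZ /neg_weights -addn1 iotaD map_cat cats1 snoc scaleNr opprK; congr (_ + _).
move: (map _ _) => mus; elim: mus u {Fu FHu c c0 cE IH} => //= mu mus IH' v.
by rewrite -IH' (linearB H); congr (hprod _ _ (_ - _)); rewrite linearZ.
Qed.

Lemma neg_weights_uniq m : uniq (neg_weights m).
Proof.
rewrite map_inj_uniq ?iota_uniq // => i j /oppr_inj.
exact: (natr_inj charK).
Qed.

Lemma kerF_killed : exists m, forall u, F u = 0 -> hprod H (neg_weights m) u = 0.
Proof.
have [m Em] := nilE; exists m => u Fu.
have [c c0] := iterF_iterE m Fu; rewrite Em.
have -> : iter m F 0 = 0 by elim: m {Em} => //= m ->; rewrite linear0.
by move/esym/eqP; rewrite scaler_eq0 (negPf c0) => /eqP.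
Qed.

Lemma kerF_weight u mu : F u = 0 -> H u = mu *: u -> u != 0 -> exists n, mu = - n%:R.
Proof.
move=> Fu Hu u0; have [m km] := kerF_killed.
have := km _ Fu; rewrite (hprod_eigen _ Hu) => /eqP.
rewrite scaler_eq0 (negPf u0) orbF prodf_seq_eq0 => /hasP[_ /mapP[n _ ->]] /=.
by rewrite opprK addr_eq0 => /eqP ->; exists n.
Qed.

Lemma kerF_decomp U u : (forall v, v \in U -> F v = 0) -> (forall v, v \in U -> H v \in U) -> u \in U ->
  exists s : seq (nat * W), u = \sum_(x <- s) x.2 /\
    forall x, x \in s -> x.2 \in U /\ H x.2 = - x.1%:R *: x.2.
Proof.
move=> UF UH uU; have [m km] := kerF_killed.
have [g [-> gP]] := hprod_decomp UH (neg_weights_uniq m) uU (km _ (UF _ uU)).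
exists [seq (i, g (- i%:R)) | i <- iota 0 m]; rewrite !big_map; split=> // x /mapP[i im ->].
by apply: gP; apply: map_f.
Qed.

End Triple.

(** One may assume that E v is an eigenvector of weight - i and, after correcting
    v by ker E, that v has weight - i - 2; if E v <> 0, then no F^j v vanishes. *)
Lemma imE_kerF E H F z : sl2_ops E H F -> nil_op E -> nil_op F -> F (E z) = 0 -> E z = 0.
Proof.
move=> sl2 nE nF FEz.
pose U := (lker F :&: limg E)%VS.
have UF v : v \in U -> F v = 0 by rewrite memv_cap memv_ker => /andP[/eqP].
have UH v : v \in U -> H v \in U.
  rewrite !memv_cap !memv_ker => /andP[/eqP Fv /memv_imgP[w _ vE]].
  have := HF sl2 v; rewrite Fv linear0 mul0rn subr0 => <-; rewrite eqxx /=.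
  by rewrite vE (HE sl2) -scaler_nat -linearZ -linearD memv_img ?memvf.
have [|s [zE sP]] := kerF_decomp sl2 nE UF UH (u := E z).
- by rewrite memv_cap memv_ker FEz eqxx memv_img ?memvf.
rewrite zE big1_seq // => -[i x] /andP[_ /sP[/= xU Hx]].
move: xU; rewrite memv_cap memv_ker => /andP[/eqP Fx /memv_imgP[v _ xE]].
have sl2' := sl2_ops_flip sl2.
pose U' := lker E.
have U'E w : w \in U' -> E w = 0 by rewrite memv_ker => /eqP.
have U'H w : w \in U' -> (- H) w \in U'.
  rewrite !memv_ker => /eqP Ew; have h := HE sl2 w.
  by rewrite Ew linear0 mul0rn addr0 in h; rewrite opp_lfunE raddfN oppr_eq0; apply/eqP; exact: esym h.
have kU : H v + (i.+2)%:R *: v \in U'.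
  rewrite memv_ker linearD linearZ /= -xE.
  have := HE sl2 v; rewrite -xE Hx => /eqP; rewrite -subr_eq => /eqP <-.
  by rewrite -scaler_nat -scalerBl -scalerDl (_ : _ + _ = 0) ?scale0r // -[i.+2]addn2 natrD; ring.
have [t [kE tP]] := kerF_decomp sl2' nF U'E U'H kU.
(* The correction k' in ker E solves (H + i + 2) k' = (H + i + 2) v. *)
pose k' := \sum_(y <- t) ((y.1 + i.+2)%N%:R)^-1 *: y.2.
pose v' := v - k'.
have Ek' : E k' = 0.
  rewrite /k' linear_sum big1_seq // => y /andP[_ /tP[yU _]].
  by rewrite linearZ /= U'E ?scaler0.
have Hk' : H k' + i.+2%:R *: k' = \sum_(y <- t) y.2.
  rewrite /k' linear_sum scaler_sumr -big_split; apply: eq_big_seq => y /tP[_ Hy] /=.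
  have {}Hy : H y.2 = y.1%:R *: y.2.
    by move: Hy; rewrite opp_lfunE scaleNr => /oppr_inj.
  rewrite linearZ /= Hy !scalerA -[RHS]scale1r -scalerDl; congr (_ *: _).
  have nz : ((y.1 + i.+2)%N%:R : K) != 0 by rewrite (natr_eq0 charK) addnS.
  by rewrite [X in _ + X]mulrC -mulrDr -natrD mulVf.
have Ev' : E v' = x by rewrite linearB /= Ek' subr0 -xE.
have Hv' : H v' = - i.+2%:R *: v'.
  apply/eqP; rewrite scaleNr -addr_eq0 /v' linearB /= scalerBr addrACA.
  by rewrite -opprD Hk' -kE subrr.
have E_iter j : E (iter j.+1 F v') = - (j.+1 * (i.+2 + j))%N%:R *: iter j F v'.
  have hw l : H (iter l F v') = - (i.+2 + 2 * l)%N%:R *: iter l F v'.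
    elim: l => [|l IH]; first by rewrite muln0 addn0.
    rewrite iterS (HF sl2) IH linearZ /= -scaler_nat -scalerBl; congr (_ *: _).
    by rewrite -opprD -natrD; congr (- _%:R); lia.
  elim: j => [|j IH]; first by rewrite /= (EF sl2) Ev' Fx add0r Hv' mul1n addn0.
  rewrite iterS (EF sl2) hw IH linearZ /= -scalerDl; congr (_ *: _).
  by rewrite -opprD -natrD; congr (- _%:R); nia.
have [m Fm] := nF.
suff : v' = 0 by move=> v0; rewrite -Ev' v0 linear0.
have : iter m F v' = 0 := Fm v'.
elim: m {Fm} => // j IH Fj; apply: IH.
have /esym/eqP := E_iter j; rewrite Fj linear0 scaler_eq0 oppr_eq0 (natr_eq0 charK).
by case/orP=> [|/eqP //]; rewrite muln_eq0.
Qed.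

(** By imE_kerF, im E meets ker F trivially, and so do im F and ker E; adding the
    two dimension inequalities shows that both sums are the whole space. *)
Lemma imE_add_kerF E H F : sl2_ops E H F -> nil_op E -> nil_op F ->
  (limg E + lker F)%VS = fullv.
Proof.
move=> sl2 nE nF; have sl2' := sl2_ops_flip sl2.
have cap E' H' F' : sl2_ops E' H' F' -> nil_op E' -> nil_op F' -> (limg E' :&: lker F')%VS = 0%VS.
  move=> s nE' nF'; apply/eqP; rewrite -subv0; apply/subvP => w; rewrite memv_cap memv_ker memv0.
  by case/andP=> /memv_imgP[z _ ->] /eqP FEz; rewrite (imE_kerF s).
have d1 := dimv_disjoint_sum (cap _ _ _ sl2 nE nF).
have d2 := dimv_disjoint_sum (cap _ _ _ sl2' nF nE).
have e1 := limg_ker_dim E fullv; have e2 := limg_ker_dim F fullv.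
rewrite !capfv in e1 e2.
have l1 := dimvS (subvf (limg E + lker F)); have l2 := dimvS (subvf (limg F + lker E)).
apply/eqP; rewrite eqEdim subvf d1 /=.
move: l1 l2; rewrite d1 d2; move: e1 e2.
by move: (\dim (limg E)) (\dim (limg F)) (\dim (lker E)) (\dim (lker F)) (\dim {:W}) => a b c d n; lia.
Qed.

(** Iterating W = im E + ker F writes w as a sum of vectors E^j u with u in ker F,
    and ker F is spanned by weight vectors. *)
Lemma weight_decomp E H F w : sl2_ops E H F -> nil_op E -> nil_op F ->
  exists s : seq (int * W), w = \sum_(x <- s) x.2 /\
    forall x, x \in s -> H x.2 = x.1%:~R *: x.2.
Proof.
move=> sl2 nE nF; pose good w := exists s : seq (int * W), w = \sum_(x <- s) x.2 /\
    forall x, x \in s -> H x.2 = x.1%:~R *: x.2.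
have gD u v : good u -> good v -> good (u + v).
  move=> [s [-> sP]] [t [-> tP]]; exists (s ++ t); rewrite big_cat; split=> // x.
  by rewrite mem_cat => /orP[/sP|/tP].
have gE u : good u -> good (E u).
  move=> [s [-> sP]]; exists [seq (x.1 + 2, E x.2) | x <- s]; rewrite big_map linear_sum.
  split=> // _ /mapP[x /sP Hx ->] /=; rewrite (HE sl2) Hx linearZ /= rmorphD /= scalerDl.
  by rewrite -scaler_nat.
have gF u : F u = 0 -> good u.
  move=> Fu; have [|||s [uE sP]] := kerF_decomp sl2 nE (U := lker F) (u := u).
  - by move=> v; rewrite memv_ker => /eqP.
  - move=> v; rewrite !memv_ker => /eqP Fv; have := HF sl2 v.
    by rewrite Fv linear0 mul0rn subr0 => <-.
  - by rewrite memv_ker Fu.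
  exists [seq (- (x.1%:Z), x.2) | x <- s]; rewrite big_map; split=> // _ /mapP[x /sP[_ Hx] ->] /=.
  by rewrite Hx rmorphN.
have step k : forall u, exists v u', [/\ u = u' + iter k E v & good u'].
  elim: k => [|k IH] u; first by exists u, 0; rewrite add0r; split=> //; exists [::]; rewrite big_nil.
  have [v [u' [uE gu']]] := IH u.
  have : v \in (limg E + lker F)%VS by rewrite (imE_add_kerF sl2) ?memvf.
  case/memv_addP=> _ /memv_imgP[v1 _ ->] [v2]; rewrite memv_ker => /eqP Fv2 vE.
  exists v1, (u' + iter k E v2); split; last first.
    apply: gD => //; elim: (k) => [|j gj]; [exact: gF | exact: gE].
  by rewrite uE vE iterD -addrA iterSr [iter k E v2 + _]addrC.
have [m Em] := nE; have [v [u' [-> gu']]] := step m w.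
by rewrite Em addr0.
Qed.

End Sl2.

(** * sl_2-triples of matrices *)

Section MatrixTriples.
Variables (K : fieldType) (charK : [pchar K] =i pred0).

Definition sl2_mx n (e h f : 'M[K]_n) := [/\ h *m e - e *m h = e *+ 2,
  h *m f - f *m h = - (f *+ 2) & e *m f - f *m e = h].

(** From [h, q(f)] = - 2 f q'(f) the minimal polynomial p of f divides X p',
    so p is a power of X. *)
Lemma nilpotent_of_weight n (h f : 'M[K]_n) : h *m f - f *m h = - (f *+ 2) -> exists k, f ^+ k = 0.
Proof.
case: n h f => [|n] h f; first by exists 0%N; apply: flatmx0.
rewrite -![_ *m _]/(_ * _) => hf.
have pM q r : pmx f (q * r) = pmx f q * pmx f r by apply: pmxM.
have fc q : f * pmx f q = pmx f q * f by apply: pmx_comm.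
have hq q : h * pmx f q - pmx f q * h = - (f * pmx f q^`() *+ 2).
  elim/poly_ind: q => [|q c IH]; first by rewrite deriv0 !pmx0 !mulr0 mul0r mul0rn subr0 oppr0.
  rewrite derivD derivM derivX derivC addr0 mulr1 !pmxD !pM !pmxX !pmxC.
  have cc : h * c%:M = c%:M * h by rewrite -[LHS]/(h *m _) -[RHS]/(_ *m h) mul_mx_scalar mul_scalar_mx.
  rewrite mulrDr mulrDl cc opprD addrACA subrr addr0.
  have -> : h * (pmx f q * f) - pmx f q * f * h = (h * pmx f q - pmx f q * h) * f + pmx f q * (h * f - f * h).
    by rewrite mulrBl mulrBr !mulrA addrA subrK.
  rewrite IH hf mulNr mulrN -opprD mulrnAl mulrnAr -mulrnDl mulrDr.
  by rewrite mulrA (fc q).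
set p := mxminpoly f.
have pmon : p \is monic by apply: mxminpoly_monic.
have pf : pmx f p = 0 by apply: mx_root_minpoly.
have /mxminpoly_min : horner_mx f ('X * p^`()) = 0.
  have := hq p; rewrite pf mulr0 mul0r subr0 => /esym/eqP.
  rewrite oppr_eq0 -scaler_nat scaler_eq0 (natr_eq0 charK) /= => /eqP E.
  by rewrite -[LHS]/(pmx f _) pM pmxX.
rewrite -/p => /dvdpP[q qE].
have p0 : p != 0 by apply: monic_neq0.
have szq : (size q <= 1)%N.
  case: (eqVneq q 0) => [->|q0]; first by rewrite size_poly0.
  have := congr1 (fun r : {poly K} => size r) qE; rewrite /= [RHS]size_mul // => sE.
  have le : (size ('X * p^`())%R <= size p)%N.
    rewrite mulrC; apply: leq_trans (size_polyMleq _ _) _; rewrite size_polyX addn2 /=.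
    exact: lt_size_deriv.
  move: le; rewrite sE; have : (0 < size p)%N by rewrite lt0n size_poly_eq0.
  by move: (size p) (size q) => a b; lia.
have [c qc] : exists c, q = c%:P by exists q`_0; apply: size1_polyC.
(* In X p' = c p the coefficient c is the degree of p, so only the top term
   of p survives. *)
have co k : p`_k *+ k = c * p`_k.
  have := congr1 (fun r : {poly K} => r`_k) qE; rewrite qc coefCM coefXM coef_deriv.
  by case: k => [|k] //; rewrite mulr0n.
have cE : c = (size p).-1%:R.
  have := co (size p).-1; rewrite -lead_coefE (monicP pmon) mulr1 => <- //.
exists (size p).-1; rewrite -pmxXn (_ : 'X^_ = p) //.
apply/polyP => k; rewrite coefXn; case: eqP => [->|ne]; first by rewrite -lead_coefE (monicP pmon).
have /eqP := co k; rewrite cE -[p`_k *+ k]mulr_natl -subr_eq0 -mulrBl mulf_eq0 subr_eq0 => /orP[/eqP E|/eqP -> //].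
by case: ne; apply: (natr_inj charK).
Qed.

Lemma sl2_mx_rows n (e h f : 'M[K]_n) : sl2_mx e h f ->
  sl2_ops (linfun (mulmxr f) : 'End('rV[K]_n)) (linfun (mulmxr h)) (linfun (mulmxr e)).
Proof.
case=> he hf ef; split=> w; rewrite !lfunE /= -?mulmxA.
- have -> : f *m h = h *m f + f *+ 2 by rewrite -[f *+ 2]opprK -hf opprB addrC subrK.
  by rewrite mulmxDr (raddfMn (mulmx w)).
- have -> : e *m h = h *m e - e *+ 2 by rewrite -he opprB addrC subrK.
  by rewrite mulmxBr (raddfMn (mulmx w)).
- by rewrite -mulmxBr ef.
Qed.

Lemma sl2_mx_ad n (e h f : 'M[K]_n) : sl2_mx e h f ->
  sl2_ops (linfun (itw e e)) (linfun (itw h h)) (linfun (itw f f)).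
Proof.
have jac (a b z : 'M[K]_n) : itw a a (itw b b z) = itw b b (itw a a z) + itw (itw a a b) (itw a a b) z.
  rewrite /itw !mulmxBr !mulmxBl !mulmxA.
  set t1 := a *m b *m z; set t2 := a *m z *m b; set t3 := b *m z *m a; set t4 := z *m b *m a.
  set t5 := b *m a *m z; set t6 := z *m a *m b.
  clearbody t1 t2 t3 t4 t5 t6; apply/matrixP => i j; rewrite !mxE; ring.
case=> he hf ef; split=> w; rewrite !lfunE /=.
- rewrite jac (_ : itw h h e = e *+ 2) //; congr (_ + _).
  by rewrite /itw mulmxDl mulmxDr !mulr2n opprD addrACA.
- rewrite jac (_ : itw h h f = - (f *+ 2)) //; congr (_ + _).
  have sc c : itw (c *: f) (c *: f) w = c *: itw f f w by rewrite /itw -scalemxAl -scalemxAr scalerBr.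
  have -> : - (f *+ 2) = (- 2%:R) *: f by rewrite scaleNr scaler_nat.
  by rewrite sc scaleNr scaler_nat.
- by rewrite jac addrC addKr (_ : itw e e f = h).
Qed.

Lemma nil_op_rows n (e : 'M[K]_n) : (exists k, e ^+ k = 0) -> nil_op (linfun (mulmxr e) : 'End('rV[K]_n)).
Proof.
move=> [k ek]; exists k => w.
have -> : iter k (linfun (mulmxr e) : 'End('rV[K]_n)) w = w *m e ^+ k.
  elim: (k) => [|j IH]; first by rewrite expr0 mulmx1.
  by rewrite iterS IH lfunE /= -mulmxA -[_ *m e]/(_ * e) -exprSr.
by rewrite ek mulmx0.
Qed.

Lemma nil_op_ad n (e : 'M[K]_n) : (exists k, e ^+ k = 0) -> nil_op (linfun (itw e e)).
Proof.
move=> [k ek]; exists (k + k)%N => z.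
have P j : exists c : nat -> K, iter j (linfun (itw e e)) z = \sum_(i < j.+1) c i *: (e ^+ i *m z *m e ^+ (j - i)).
  elim: j => [|j [c E]].
    by exists (fun _ => 1); rewrite big_ord1 scale1r expr0 mul1mx mulmx1.
  exists (fun i => (if i is i'.+1 then c i' else 0) - (if (i <= j)%N then c i else 0)).
  rewrite iterS E lfunE /= /itw.
  have -> : e *m \sum_(i < j.+1) c i *: (e ^+ i *m z *m e ^+ (j - i)) =
      \sum_(i < j.+1) c i *: (e ^+ i.+1 *m z *m e ^+ (j - i)).
    by rewrite mulmx_sumr; apply: eq_bigr => i _; rewrite -scalemxAr !mulmxA -[e *m _]/(e * _) -exprS.
  have -> : (\sum_(i < j.+1) c i *: (e ^+ i *m z *m e ^+ (j - i))) *m e =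
      \sum_(i < j.+1) c i *: (e ^+ i *m z *m e ^+ (j - i).+1).
    by rewrite mulmx_suml; apply: eq_bigr => i _; rewrite -scalemxAl -mulmxA -[_ *m e]/(_ * e) -exprSr.
  under [RHS]eq_bigr => i _ do rewrite scalerBl.
  rewrite sumrB; congr (_ - _).
    rewrite [RHS]big_ord_recl scale0r add0r; apply: eq_bigr => i _.
    by rewrite lift0 subSS.
  rewrite [RHS]big_ord_recr /= ltnn scale0r addr0; apply: eq_bigr => i _.
  by rewrite -ltnS ltn_ord subSn // -ltnS.
have [c ->] := P (k + k)%N; apply: big1 => i _.
have e0 j : (k <= j)%N -> e ^+ j = 0 by move=> h; rewrite -(subnK h) exprD ek mulr0.
case: (leqP k i) => h; first by rewrite e0 // !mul0mx scaler0.
by rewrite (e0 (k + k - i)%N) ?mulmx0 ?scaler0 //; lia.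
Qed.

(** The weights are integers rather than elements of K so that they are ordered. *)
Definition int_diag n (h : 'M[K]_n) m (P : 'M[K]_(m, n)) (w : 'rV[int]_m) :=
  P *m h = diag_mx (map_mx intr w) *m P.

Lemma int_diagonalizable n (h : 'M[K]_n) :
  (forall v : 'rV_n, exists s : seq (int * 'rV[K]_n), v = \sum_(x <- s) x.2 /\
     forall x, x \in s -> x.2 *m h = x.1%:~R *: x.2) ->
  exists P : 'M_n, exists2 w, P \in unitmx & int_diag h P w.
Proof.
move=> sp.
have [s sP] := fin_all_exists (fun i : 'I_n => sp (delta_mx 0 i)).
pose mus := undup [seq x.1 | x <- flatten [seq s i | i <- enum 'I_n]].
pose rs := [seq k%:~R | k <- mus] : seq K.
have urs : uniq rs by rewrite map_inj_uniq ?undup_uniq //; apply: intr_inj.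
have inmus i x : x \in s i -> x.1 \in mus.
  move=> xs; rewrite mem_undup; apply: map_f; apply/flatten_mapP; exists i => //.
  by rewrite mem_enum.
have full : (\sum_(r <- rs) eigenspace h r :=: 1%:M)%MS.
  apply/eqmxP; rewrite submx1 /=; apply/row_subP => i; rewrite rowE mulmx1.
  have [-> sE] := sP i; rewrite big_seq; apply: summx_sub => x xs.
  have xr : x.1%:~R \in rs by apply: map_f; apply: inmus xs.
  rewrite (big_rem _ xr) /=; apply: submx_trans (addsmxSl _ _).
  by apply/eigenspaceP; apply: sE.
have [_ /(_ (ex_intro2 _ _ rs urs full))[P Pu /diagonalizable_forPex[D]]] := @diagonalizablePeigen _ _ h.
move=> /simmxPp PD; have {}PD : P *m h = diag_mx D *m P.
  by apply: PD; rewrite stablemx_unit.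
have Din j : D 0 j \in rs.
  pose v := row j P.
  have vh : v *m h = D 0 j *: v by rewrite -row_mul PD row_mul row_diag_mx -scalemxAl -rowE.
  have v0 : v != 0.
    apply: contraTneq Pu => v0; rewrite -row_free_unit; apply/negP => /row_freeP[B PB].
    have := congr1 (row j) PB; rewrite row_mul -/v v0 mul0mx => /rowP/(_ j).
    by rewrite !mxE eqxx => /esym/eqP; rewrite oner_eq0.
  pose Hh : 'End('rV[K]_n) := linfun (mulmxr h).
  have HE x a : x *m h = a *: x -> Hh x = a *: x by rewrite /Hh lfunE.
  have kill u : hprod Hh rs u = 0.
    rewrite -[u]mulmx1 mulmx_sum_row.
    elim/big_ind: _ => [|a b A0 B0|i _]; [|by rewrite hprodD A0 B0 addr0|].
      exact: hprod0.
    rewrite hprodZ rowE mulmx1; have [-> sE] := sP i.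
    apply/eqP; rewrite scaler_eq0; apply/orP; right; apply/eqP.
    rewrite big_seq; elim/big_ind: _ => [|a b A0 B0|x xs].
    - exact: hprod0.
    - by rewrite hprodD A0 B0 addr0.
    rewrite (hprod_eigen rs (HE _ _ (sE _ xs))) (big_rem (x.1%:~R : K)) /=; last first.
      by apply: map_f; apply: inmus xs.
    by rewrite subrr mul0r scale0r.
  have := kill v; rewrite (hprod_eigen rs (HE _ _ vh)) => /eqP.
  rewrite scaler_eq0 (negPf v0) orbF prodf_seq_eq0 => /hasP[r rrs] /=.
  by rewrite subr_eq0 => /eqP ->.
have Dint j : exists k : int, D 0 j = k%:~R by have /mapP[k _ ->] := Din j; exists k.
have [w wP] := fin_all_exists Dint.
exists P, (\row_j w j) => //; rewrite /int_diag PD; congr (diag_mx _ *m _).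
by apply/rowP => j; rewrite !mxE wP.
Qed.

Lemma sl2_int_diag n (e h f : 'M[K]_n) : sl2_mx e h f -> (exists k, e ^+ k = 0) ->
  exists P : 'M_n, exists2 w, P \in unitmx & int_diag h P w.
Proof.
move=> sl2 ne; apply: int_diagonalizable => v.
have nf : exists k, f ^+ k = 0 by case: sl2 => _ /nilpotent_of_weight.
have [s [vE sP]] := weight_decomp charK v (sl2_mx_rows sl2) (nil_op_rows nf) (nil_op_rows ne).
by exists s; split=> // x /sP; rewrite lfunE.
Qed.

End MatrixTriples.

(** * The grading by weights *)

Section Grading.
Variables (K : fieldType) (charK : [pchar K] =i pred0) (n : nat) (w : 'rV[int]_n).
Implicit Types (A B x y : 'M[K]_n) (k l : int).

Definition wt (i j : 'I_n) : int := w 0 i - w 0 j.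
Definition gr k A : 'M[K]_n := \matrix_(i, j) (if wt i j == k then A i j else 0).
Definition low k A := forall i j, k < wt i j -> A i j = 0.
Definition hw : 'M[K]_n := diag_mx (map_mx intr w).

Lemma wtD i j m : wt i j + wt j m = wt i m.
Proof. by rewrite /wt addrA subrK. Qed.

Lemma gr_is_linear k : linear (gr k).
Proof.
by move=> a u v; apply/matrixP => i j; rewrite !mxE; case: ifP; rewrite ?mulr0 ?addr0.
Qed.
HB.instance Definition _ k := GRing.isLinear.Build K 'M[K]_n 'M[K]_n *:%R (gr k) (gr_is_linear k).

Lemma grE k A i j : gr k A i j = if wt i j == k then A i j else 0.
Proof. by rewrite mxE. Qed.

Lemma gr_idem k A : gr k (gr k A) = gr k A.
Proof. by apply/matrixP => i j; rewrite !grE; case: (wt i j == k). Qed.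

Lemma itw_hw A : itw hw hw A = \matrix_(i, j) ((wt i j)%:~R * A i j).
Proof.
apply/matrixP => i j; rewrite /itw /hw mul_diag_mx mul_mx_diag !mxE /wt rmorphB /=.
by rewrite mulrBl [A i j * _]mulrC.
Qed.

Lemma gr_weight k A : itw hw hw (gr k A) = k%:~R *: gr k A.
Proof.
by rewrite itw_hw; apply/matrixP => i j; rewrite !mxE; case: eqP => [->|]; rewrite ?mulr0.
Qed.

Lemma weight_gr k A : itw hw hw A = k%:~R *: A -> gr k A = A.
Proof.
rewrite itw_hw => E; apply/matrixP => i j; rewrite grE; case: eqP => // ne.
move/matrixP/(_ i j): E; rewrite !mxE => /eqP; rewrite -subr_eq0 -mulrBl mulf_eq0 subr_eq0.
by case/orP=> /eqP // /(intr_inj charK).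
Qed.

Lemma gr_eq A B : (forall k, gr k A = gr k B) -> A = B.
Proof. by move=> E; apply/matrixP => i j; move/matrixP/(_ i j): (E (wt i j)); rewrite !grE eqxx. Qed.

Lemma low_gr k A : low k (gr k A).
Proof. by move=> i j lt; rewrite grE; case: eqP => // E; rewrite E ltxx in lt. Qed.

Lemma low_le k l A : k <= l -> low k A -> low l A.
Proof. by move=> kl lA i j lt; apply: lA; apply: le_lt_trans lt. Qed.

Lemma lowD k A B : low k A -> low k B -> low k (A + B).
Proof. by move=> lA lB i j lt; rewrite mxE lA // lB // addr0. Qed.
Lemma lowN k A : low k A -> low k (- A).
Proof. by move=> lA i j lt; rewrite mxE lA // oppr0. Qed.
Lemma lowB k A B : low k A -> low k B -> low k (A - B).
Proof. by move=> lA lB; apply: lowD => //; apply: lowN. Qed.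

Lemma low1 : low 0 1%:M.
Proof. by move=> i j; rewrite mxE; case: eqP => // ->; rewrite /wt subrr ltxx. Qed.

Lemma gr01 : gr 0 1%:M = 1%:M.
Proof.
apply/matrixP => i j; rewrite grE; case: (eqVneq i j) => [->|ne]; first by rewrite /wt subrr eqxx.
by rewrite mxE (negPf ne) if_same.
Qed.

Lemma lowM k l A B : low k A -> low l B -> low (k + l) (A *m B).
Proof.
move=> lA lB i j lt; rewrite mxE big1 // => m _.
case: (ltP k (wt i m)) => h; first by rewrite lA // mul0r.
rewrite lB ?mulr0 //; rewrite -(wtD i m j) in lt.
by rewrite ltNge; apply: contraTN lt => h2; rewrite -leNgt lerD.
Qed.

Lemma gr_high k l A : low k A -> k < l -> gr l A = 0.
Proof. by move=> lA lt; apply/matrixP => i j; rewrite grE mxE; case: eqP => // E; rewrite lA // E. Qed.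

Lemma grM k l A B : low k A -> low l B -> gr (k + l) (A *m B) = gr k A *m gr l B.
Proof.
move=> lA lB; apply/matrixP => i j; rewrite grE !mxE.
case: eqP => E.
  apply: eq_bigr => m _; rewrite !grE -(wtD i m j) in E *.
  case: (ltgtP (wt i m) k) => h1; last 1 first.
  - by move: E; rewrite h1 => /addrI ->; rewrite eqxx.
  - by rewrite mul0r lB ?mulr0 //; move: E h1; lia.
  - by rewrite lA // !mul0r.
rewrite big1 // => m _; rewrite !grE.
case: eqP => E1; rewrite ?mul0r //; case: eqP => E2; rewrite ?mulr0 //.
by case: E; rewrite -(wtD i m j) E1 E2.
Qed.

Lemma grMl k l A B : gr k A = A -> gr (k + l) (A *m B) = A *m gr l B.
Proof.
move=> hA; apply/matrixP => i j; rewrite grE !mxE.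
have A0 m : wt i m != k -> A i m = 0 by move=> ne; rewrite -hA grE (negPf ne).
case: eqP => E.
  apply: eq_bigr => m _; rewrite grE; case: (eqVneq (wt i m) k) => [h|/A0 ->]; last by rewrite !mul0r.
  by move: E; rewrite -(wtD i m j) h => /addrI ->; rewrite eqxx.
rewrite big1 // => m _; rewrite grE; case: (eqVneq (wt i m) k) => [h|/A0 ->]; last by rewrite mul0r.
case: eqP => E2; rewrite ?mulr0 //; by case: E; rewrite -(wtD i m j) h E2.
Qed.

Lemma grMr k l A B : gr k B = B -> gr (k + l) (A *m B) = gr l A *m B.
Proof.
move=> hB; apply/matrixP => i j; rewrite grE !mxE.
have B0 m : wt m j != k -> B m j = 0 by move=> ne; rewrite -hB grE (negPf ne).
case: eqP => E.
  apply: eq_bigr => m _; rewrite grE; case: (eqVneq (wt m j) k) => [h|/B0 ->]; last by rewrite !mulr0.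
  by move: E; rewrite -(wtD i m j) h addrC => /addrI ->; rewrite eqxx.
rewrite big1 // => m _; rewrite grE; case: (eqVneq (wt m j) k) => [h|/B0 ->]; last by rewrite mulr0.
case: eqP => E2; rewrite ?mul0r //; by case: E; rewrite -(wtD i m j) h E2 addrC.
Qed.

Lemma gr_itw k l A B : gr k A = A -> gr (k + l) (itw A A B) = itw A A (gr l B).
Proof. by move=> hA; rewrite /itw linearB /= grMl // grMr. Qed.

Lemma low_bound : exists m : nat, forall A, low m%:Z A /\ (low (- m%:Z - 1) A -> A = 0).
Proof.
pose F i : nat := (\max_j absz (wt i j))%N.
pose m : nat := (\max_i F i)%N.
have le i j : (absz (wt i j) <= m)%N.
  by apply: leq_trans (@leq_bigmax _ F i); apply: (@leq_bigmax _ (fun j => absz (wt i j)) j).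
exists m => A; split=> [i j|lA].
  by have := le i j; lia.
apply/matrixP => i j; rewrite mxE; apply: lA.
by have := le i j; lia.
Qed.

(** Its kernel makes the matrices of weights at most k into a subspace. *)
Definition up k A : 'M[K]_n := \matrix_(i, j) (if k < wt i j then A i j else 0).
Lemma up_is_linear k : linear (up k).
Proof.
by move=> a u v; apply/matrixP => i j; rewrite !mxE; case: ifP; rewrite ?mulr0 ?addr0.
Qed.
HB.instance Definition _ k := GRing.isLinear.Build K 'M[K]_n 'M[K]_n *:%R (up k) (up_is_linear k).
Definition low_space k : {vspace 'M[K]_n} := lker (linfun (up k)).

Lemma low_spaceP k A : reflect (low k A) (A \in low_space k).
Proof.
rewrite memv_ker lfunE; apply: (iffP eqP) => [/matrixP E i j lt|lA].
  by move: (E i j); rewrite !mxE lt.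
by apply/matrixP => i j; rewrite !mxE; case: ifP => // /lA.
Qed.

Lemma low_pred k A : low k A -> gr k A = 0 -> low (k - 1) A.
Proof.
move=> lA gA i j lt; case: (eqVneq (wt i j) k) => [E|ne].
  by move/matrixP/(_ i j): gA; rewrite grE E eqxx mxE.
by apply: lA; move: lt ne; lia.
Qed.

Lemma dim_low_space (U : {vspace 'M[K]_n}) k :
  (\dim (U :&: low_space (k - 1)) + \dim (linfun (gr k) @: (U :&: low_space k)) = \dim (U :&: low_space k))%N.
Proof.
rewrite -(limg_ker_dim (linfun (gr k)) (U :&: low_space k)); congr (\dim _ + _)%N.
apply/vspaceP => A; rewrite !memv_cap -andbA; congr (_ && _); rewrite [A \in lker (linfun (gr k))]memv_ker lfunE.
apply/idP/andP => [/low_spaceP lA|[/low_spaceP lA /eqP gA]]; last by apply/low_spaceP; apply: low_pred.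
split; first by apply/low_spaceP; apply: low_le lA; lia.
by rewrite /= (gr_high lA) //; lia.
Qed.

(** The leading terms of I form a graded subspace of those of Z, and the
    dimension of a subspace is the sum of the dimensions of its spaces of leading
    terms, so the two coincide in each weight. *)
Lemma leading_terms (I Z : {vspace 'M[K]_n}) :
  (forall k A, A \in I -> low k A -> exists2 B, B \in Z & low k B /\ gr k B = gr k A) ->
  (\dim Z <= \dim I)%N ->
  forall k B, B \in Z -> low k B -> exists2 A, A \in I & low k A /\ gr k A = gr k B.
Proof.
move=> IZ dZI.
have sub k : (linfun (gr k) @: (I :&: low_space k) <= linfun (gr k) @: (Z :&: low_space k))%VS.
  apply/subvP => v /memv_imgP[A]; rewrite memv_cap => /andP[AI /low_spaceP lA] ->.
  have [B BZ [lB gE]] := IZ _ _ AI lA.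
  by rewrite lfunE /= -gE; apply/memv_imgP; exists B; rewrite ?lfunE // memv_cap BZ; apply/low_spaceP.
have [m mP] := low_bound.
pose kk (j : nat) : int := j%:Z - m%:Z - 1.
pose a j := \dim (I :&: low_space (kk j)); pose z j := \dim (Z :&: low_space (kk j)).
pose da j := \dim (linfun (gr (kk j)) @: (I :&: low_space (kk j))).
pose dz j := \dim (linfun (gr (kk j)) @: (Z :&: low_space (kk j))).
have kkS j : kk j.+1 - 1 = kk j by rewrite /kk; lia.
have aS j : (a j + da j.+1 = a j.+1)%N by have := dim_low_space I (kk j.+1); rewrite kkS.
have zS j : (z j + dz j.+1 = z j.+1)%N by have := dim_low_space Z (kk j.+1); rewrite kkS.
have daz j : (da j <= dz j)%N by apply: dimvS.
have F0 : low_space (kk 0%N) = 0%VS.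
  apply/eqP; rewrite -subv0; apply/subvP => A /low_spaceP lA; rewrite memv0; apply/eqP.
  by apply: (mP A).2; apply: low_le lA; rewrite /kk; lia.
have F1 : low_space (kk (2 * m + 1)%N) = fullv.
  apply/eqP; rewrite eqEsubv subvf; apply/subvP => A _; apply/low_spaceP.
  by apply: low_le (mP A).1; rewrite /kk; lia.
have a0 : a 0%N = 0%N by rewrite /a F0 capv0 dimv0.
have z0 : z 0%N = 0%N by rewrite /z F0 capv0 dimv0.
have a1 : a (2 * m + 1)%N = \dim I by rewrite /a F1 capvf.
have z1 : z (2 * m + 1)%N = \dim Z by rewrite /z F1 capvf.
have le j : (a j <= z j)%N.
  by elim: j => [|j IH]; rewrite ?a0 ?z0 // -aS -zS leq_add.
have ge j : (j <= 2 * m + 1)%N -> (z j <= a j)%N.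
  move=> lj; rewrite -(subKn lj); elim: (_ - j)%N (leq_subr j (2 * m + 1)%N) => [|i IH] li.
    by rewrite subn0 a1 z1.
  have := IH (ltnW li).
  have -> : (2 * m + 1 - i = (2 * m + 1 - i.+1).+1)%N by move: li; lia.
  by rewrite -aS -zS; have := daz (2 * m + 1 - i.+1).+1; lia.
have deq k : \dim (linfun (gr k) @: (I :&: low_space k)) = \dim (linfun (gr k) @: (Z :&: low_space k)).
  case: (ltP k (- m%:Z)) => h1.
    have F k' : k' < - m%:Z -> low_space k' = 0%VS.
      move=> lt; apply/eqP; rewrite -subv0; apply/subvP => A /low_spaceP lA; rewrite memv0; apply/eqP.
      by apply: (mP A).2; apply: low_le lA; lia.
    by rewrite F // !capv0 !limg0.
  case: (ltP m%:Z k) => h2.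
    have E (U : {vspace 'M[K]_n}) : (linfun (gr k) @: (U :&: low_space k))%VS = 0%VS.
      apply/eqP; rewrite -subv0; apply/subvP => _ /memv_imgP[A _ ->]; rewrite lfunE memv0 /=.
      by rewrite (gr_high (mP A).1).
    by rewrite !E.
  have [j kE lj] : exists2 j, k = kk j.+1 & (j.+1 <= 2 * m + 1)%N.
    by exists (absz (k + m%:Z)); rewrite /kk; lia.
  rewrite kE -/(da j.+1) -/(dz j.+1).
  have := ge j (ltnW lj); have := ge _ lj; have := le j; have := le j.+1; have := aS j; have := zS j.
  by move: (a j) (a j.+1) (z j) (z j.+1) (da j.+1) (dz j.+1) => *; lia.
move=> k B BZ lB.
have /eqP E : (linfun (gr k) @: (I :&: low_space k))%VS == (linfun (gr k) @: (Z :&: low_space k))%VS.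
  by rewrite eqEdim sub deq leqnn.
have : gr k B \in (linfun (gr k) @: (I :&: low_space k))%VS.
  by rewrite E; apply/memv_imgP; exists B; rewrite ?lfunE // memv_cap BZ; apply/low_spaceP.
case/memv_imgP=> A; rewrite memv_cap lfunE => /andP[AI /low_spaceP lA] /= gE.
by exists A.
Qed.

End Grading.

(** * The slice e + g^f *)

Section SliceDiag.
Variables (K : fieldType) (charK : [pchar K] =i pred0) (n : nat) (w : 'rV[int]_n).
Variables (e f : 'M[K]_n).
Let h := hw K w.
Hypotheses (sl2 : sl2_mx e h f) (nile : exists k, e ^+ k = 0).
Implicit Types (A B x y : 'M[K]_n).
Local Notation gr := (gr w).
Local Notation low := (low w).

Let nilf : exists k, f ^+ k = 0.
Proof. by case: sl2 => _ /(nilpotent_of_weight charK). Qed.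
Let sl2ad := sl2_mx_ad sl2.

Lemma gr2e : gr 2 e = e.
Proof.
apply: (weight_gr charK); case: sl2 => he _ _.
by rewrite /itw he -scaler_nat.
Qed.

Lemma grm2f : gr (-2) f = f.
Proof.
apply: (weight_gr charK); case: sl2 => _ hf _.
by rewrite /itw hf -scaler_nat -scaleNr.
Qed.

Lemma cent_gr_e (k : int) A : itw e e A = 0 -> itw e e (gr k A) = 0.
Proof. by move=> E; rewrite -(gr_itw k A gr2e) E linear0. Qed.

Lemma cent_gr_f (k : int) A : itw f f A = 0 -> itw f f (gr k A) = 0.
Proof. by move=> E; rewrite -(gr_itw k A grm2f) E linear0. Qed.

Lemma cent_e_weight (k : int) A : itw e e A = 0 -> k < 0 -> gr k A = 0.
Proof.
move=> eA lt; apply/eqP; apply: contraTT lt => nz; rewrite -leNgt.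
have E0 : linfun (itw e e) (gr k A) = 0 by rewrite lfunE /= cent_gr_e.
have Hw : (- linfun (itw h h)) (gr k A) = (- k%:~R) *: gr k A.
  by rewrite opp_lfunE lfunE /= gr_weight scaleNr.
have [m /oppr_inj mE] := kerF_weight charK (sl2_ops_flip sl2ad) (nil_op_ad nilf) E0 Hw nz.
by rewrite (intr_inj charK (mE : k%:~R = (m%:Z)%:~R)).
Qed.

Lemma cent_f_low A : itw f f A = 0 -> low 0 A.
Proof.
move=> fA i j lt; case: (eqVneq (gr (wt w i j) A) 0) => [/matrixP/(_ i j)|nz].
  by rewrite grE eqxx mxE.
have F0 : linfun (itw f f) (gr (wt w i j) A) = 0 by rewrite lfunE /= cent_gr_f.
have Hw : linfun (itw h h) (gr (wt w i j) A) = (wt w i j)%:~R *: gr (wt w i j) A.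
  by rewrite lfunE /= gr_weight.
have [m mE] := kerF_weight charK sl2ad (nil_op_ad nile) F0 Hw nz.
have : wt w i j = - (m%:Z) by apply: (intr_inj charK); rewrite mE rmorphN.
by move: lt => /[swap] ->; lia.
Qed.

Lemma slice_low x : itw f f (x - e) = 0 -> low 2 x.
Proof.
move=> /cent_f_low lx; rewrite -[x](subrK e); apply: lowD; first exact: low_le lx.
by rewrite -gr2e; apply: low_gr.
Qed.

Lemma slice_gr2 x : itw f f (x - e) = 0 -> gr 2 x = e.
Proof.
by move=> /cent_f_low lx; rewrite -[x](subrK e) linearD /= (gr_high lx) // add0r gr2e.
Qed.

(** The intertwiners from x1 to x2 have leading terms centralizing e; by
    dimension, one of them is 1 + lower terms, and comparing its top
    component with the slice condition forces it to be 1. *)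
Lemma slice_unique_diag x1 x2 :
  itw f f (x1 - e) = 0 -> itw f f (x2 - e) = 0 -> (idim e e <= idim x2 x1)%N -> x1 = x2.
Proof.
move=> s1 s2 dle.
have [g /itwP gE [lg gr0]] : exists2 g, g \in lker (linfun (itw x2 x1)) & low 0 g /\ gr 0 g = gr 0 1%:M.
  apply: (leading_terms (Z := lker (linfun (itw e e)))) => //; last first.
  - exact: low1.
  - by apply/itwP; rewrite mulmx1 mul1mx.
  move=> k A /itwP AE lA; exists (gr k A); last by split; [apply: low_gr | rewrite gr_idem].
  apply/itwP; have := congr1 (gr (2 + k)) AE.
  rewrite (grM (slice_low s2) lA) slice_gr2 // => ->.
  by rewrite addrC (grM lA (slice_low s1)) slice_gr2.
rewrite gr01 in gr0.
pose g' := g - 1%:M.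
have gg : itw f f (x2 - x1) = 0.
  have -> : x2 - x1 = (x2 - e) - (x1 - e) by rewrite opprB addrA subrK.
  by rewrite linearB /= s2 s1 subrr.
(* Descending induction on the weights of g - 1: its component of weight - j - 1
   is killed by (ad f)(ad e), hence by ad e. *)
have main (j : nat) : low (- (j.+1)%:Z) g'.
  elim: j => [|j IH].
    have l1 : low 0 (1%:M : 'M[K]_n) by apply: low1.
    have lg' : low 0 g' by apply: lowB.
    rewrite -[- 1%:Z]add0r; apply: low_pred => //.
    by rewrite linearB /= gr0 gr01 subrr.
  have E : (x2 - x1) + x2 *m g' - g' *m x1 = 0.
    by rewrite /g' mulmxBr mulmxBl mulmx1 mul1mx gE; apply/matrixP => a b; rewrite !mxE; ring.
  have Eg : gr (2 - (j.+1)%:Z) (x2 - x1) + itw e e (gr (- (j.+1)%:Z) g') = 0.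
    have := congr1 (gr (2 - (j.+1)%:Z)) E; rewrite linearB linearD linear0 /=.
    rewrite (grM (slice_low s2) IH) slice_gr2 // [2 - _]addrC (grM IH (slice_low s1)) slice_gr2 //.
    by rewrite -addrA.
  have ad0 : linfun (itw e e) (gr (- (j.+1)%:Z) g') = 0.
    apply: (imE_kerF charK sl2ad (nil_op_ad nile) (nil_op_ad nilf)).
    rewrite !lfunE /=.
    have -> : itw e e (gr (- (j.+1)%:Z) g') = - gr (2 - (j.+1)%:Z) (x2 - x1).
      by apply/eqP; rewrite -addr_eq0 addrC Eg.
    by rewrite linearN /= cent_gr_f // oppr0.
  have g0 : gr (- (j.+1)%:Z) g' = 0.
    rewrite -gr_idem; apply: cent_e_weight; last by lia.
    by rewrite lfunE in ad0.
  by have := low_pred IH g0; rewrite -opprD -[1]/(1%:Z) -PoszD addn1.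
have [m mP] := low_bound K w.
have g0 : g' = 0.
  by apply: (mP g').2; apply: low_le (main m); lia.
have g1 : g = 1%:M by apply/eqP; rewrite -subr_eq0 -/g' g0.
by move: gE; rewrite g1 mulmx1 mul1mx.
Qed.

(** Geometric series: z is nilpotent, as its powers have lower and lower weights. *)
Lemma unipotent_inverse (z : 'M[K]_n) : low (-1) z ->
  exists v : 'M[K]_n, [/\ v *m (1%:M + z) = 1%:M, (1%:M + z) *m v = 1%:M & low 0 v].
Proof.
move=> lz; have [m mP] := low_bound K w.
have lp j : low (- j%:Z) ((- z) ^+ j).
  elim: j => [|j IH]; first by rewrite expr0 oppr0; apply: low1.
  rewrite exprS (_ : - (j.+1)%:Z = -1 - j%:Z); last by lia.
  by apply: lowM => //; apply: lowN.
have z0 : (- z) ^+ m.+1 = 0 by apply: (mP _).2; apply: low_le (lp m.+1); lia.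
pose v := \sum_(j < m.+1) (- z) ^+ j.
have vz : (1 + z) * v = 1.
  have := subrX1 (- z) m.+1; rewrite z0 sub0r -/v -opprD mulNr => /oppr_inj E.
  by rewrite addrC -E.
exists v; split=> //; first by apply: mulmx1C.
rewrite /v; elim/big_ind: _ => [|a b|j _]; [|exact: lowD|].
  by move=> a b _; rewrite mxE.
by apply: low_le (lp j); lia.
Qed.

(** Weight by weight from the top, gl = im ad e + ker ad f lets a conjugation
    by 1 + z, z of negative weight, move C into the slice. *)
Lemma slice_exists_diag C : low 0 (C - e) ->
  exists x, simmx C x /\ itw f f (x - e) = 0.
Proof.
move=> lC.
have step (j : nat) : exists x, [/\ simmx C x, low 0 (x - e)
    & forall k : int, - j%:Z < k -> itw f f (gr k (x - e)) = 0].
  elim: j => [|j [x [sx lx fx]]].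
    exists C; split=> // [|k k0]; first exact: simmx_refl.
    by rewrite (gr_high lC) // linear0.
  have : gr (- j%:Z) (x - e) \in (limg (linfun (itw e e)) + lker (linfun (itw f f)))%VS.
    by rewrite (imE_add_kerF charK sl2ad (nil_op_ad nile) (nil_op_ad nilf)) memvf.
  case/memv_addP=> _ /memv_imgP[z0 _ ->] [r0]; rewrite memv_ker !lfunE => /eqP /= fr0 E0.
  pose z := gr (- j%:Z - 2) z0; pose r := gr (- j%:Z) r0.
  have E : gr (- j%:Z) (x - e) = itw e e z + r.
    rewrite -[LHS]gr_idem E0 linearD /= -/r /z -(gr_itw _ _ gr2e); congr (gr _ _ + _).
    by lia.
  have fr : itw f f r = 0 by apply: cent_gr_f.
  have lz : low (- j%:Z - 2) z by apply: low_gr.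
  have [v [vz zv lv]] : exists v, [/\ v *m (1%:M + z) = 1%:M, (1%:M + z) *m v = 1%:M & low 0 v].
    by apply: unipotent_inverse; apply: low_le lz; lia.
  pose x' := (1%:M + z) *m x *m v.
  have xz : x' *m (1%:M + z) = (1%:M + z) *m x by rewrite /x' -mulmxA vz mulmx1.
  have lx2 : low 2 x.
    rewrite -[x](subrK e); apply: lowD; first exact: low_le lx.
    by rewrite -gr2e; apply: low_gr.
  have g2x : gr 2 x = e by rewrite -[x](subrK e) linearD /= (gr_high lx) // add0r gr2e.
  have lc : low (- j%:Z) (z *m x - x *m z).
    apply: lowB; first by have := lowM lz lx2; rewrite subrK.
    by have := lowM lx2 lz; rewrite addrC subrK.
  have D : x' - x = (z *m x - x *m z) *m v.
    have -> : z *m x - x *m z = (1%:M + z) *m x - x *m (1%:M + z).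
      by rewrite mulmxDl mulmxDr mul1mx mulmx1 opprD addrACA subrr add0r.
    by rewrite mulmxBl -/x' -mulmxA zv mulmx1.
  have v1 : gr 0 v = 1%:M.
    have := congr1 (gr 0) vz; rewrite mulmxDr mulmx1 linearD gr01 /=.
    by rewrite (gr_high (lowM lv lz)) ?addr0 //; lia.
  have lD : low (- j%:Z) (x' - x) by rewrite D -[- j%:Z]addr0; apply: lowM.
  have gD : gr (- j%:Z) (x' - x) = - itw e e z.
    rewrite D -[- j%:Z]addr0 (grM lc lv) v1 mulmx1 linearB /=.
    have -> : gr (- j%:Z) (z *m x) = z *m e.
      by rewrite -[- j%:Z](subrK 2) (grM lz lx2) g2x /z gr_idem.
    have -> : gr (- j%:Z) (x *m z) = e *m z.
      by rewrite -[- j%:Z](subrK 2) addrC (grM lx2 lz) g2x /z gr_idem.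
    by rewrite /itw opprB.
  have xe : x' - e = (x' - x) + (x - e) by rewrite addrA subrK.
  exists x'; split.
  - apply: simmx_trans sx _; exists (1%:M + z), v; split=> //.
  - by rewrite xe; apply: lowD => //; apply: low_le lD; lia.
  move=> k kj; rewrite xe linearD linearD /=.
  case: (ltP (- j%:Z) k) => [lt|ge].
    by rewrite (gr_high lD) // linear0 add0r fx.
  have -> : k = - j%:Z by move: kj ge; lia.
  by rewrite gD E -linearD /= addKr.
have [m mP] := low_bound K w.
have [x [sx lx fx]] := step m.+1; exists x; split=> //.
apply: (@gr_eq _ _ w) => k; rewrite linear0 /=.
have := gr_itw (k + 2) (x - e) grm2f; rewrite [-2 + _]addrC addrK => ->.
case: (ltP (- (m.+1)%:Z) (k + 2)) => h1; first exact: fx.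
rewrite (_ : gr _ _ = 0) ?linear0 //; apply: (mP _).2.
apply: (@low_le _ _ w (k + 2)); last exact: low_gr.
by lia.
Qed.

End SliceDiag.

Section Slice.
Variables (K : fieldType) (charK : [pchar K] =i pred0) (n : nat).
Variables (e h f : 'M[K]_n).
Hypotheses (sl2 : sl2_mx e h f) (nile : exists k, e ^+ k = 0).

Lemma sl2_mx_conj m (x y z : 'M[K]_n) (P : 'M[K]_(m, n)) (Q : 'M[K]_(n, m)) :
  Q *m P = 1%:M -> sl2_mx x y z -> sl2_mx (P *m x *m Q) (P *m y *m Q) (P *m z *m Q).
Proof.
move=> QP [h1 h2 h3].
have cM a b : (P *m a *m Q) *m (P *m b *m Q) = P *m (a *m b) *m Q.
  by rewrite !mulmxA -(mulmxA _ Q P) QP mulmx1.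
split; rewrite !cM -mulmxBl -mulmxBr ?h1 ?h2 ?h3 //.
- by rewrite -!scaler_nat -scalemxAr -scalemxAl.
- by rewrite -!scaler_nat -!scaleNr -scalemxAr -scalemxAl.
Qed.

Lemma itw_conj m (a b z : 'M[K]_n) (P : 'M[K]_(m, n)) (Q : 'M[K]_(n, m)) :
  Q *m P = 1%:M -> itw (P *m a *m Q) (P *m b *m Q) (P *m z *m Q) = P *m itw a b z *m Q.
Proof.
move=> QP; have cM u v : (P *m u *m Q) *m (P *m v *m Q) = P *m (u *m v) *m Q.
  by rewrite !mulmxA -(mulmxA _ Q P) QP mulmx1.
by rewrite /itw !cM -mulmxBl -mulmxBr.
Qed.

Lemma conj_exp m (x : 'M[K]_n) (P : 'M[K]_(m, n)) (Q : 'M[K]_(n, m)) k :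
  Q *m P = 1%:M -> P *m Q = 1%:M -> (P *m x *m Q) ^+ k = P *m x ^+ k *m Q.
Proof.
move=> QP PQ; elim: k => [|k IH]; first by rewrite !expr0 mulmx1 PQ.
by rewrite exprS IH -[_ * _]/(_ *m _) exprS -[x * _]/(x *m _) !mulmxA -(mulmxA _ Q P) QP mulmx1.
Qed.

Lemma slice_unique x1 x2 : itw f f (x1 - e) = 0 -> itw f f (x2 - e) = 0 ->
  (idim e e <= idim x2 x1)%N -> x1 = x2.
Proof.
move=> s1 s2 dle.
have [P [w Pu Pw]] := sl2_int_diag charK sl2 nile.
have PQ : P *m invmx P = 1%:M by apply: mulmxV.
have QP : invmx P *m P = 1%:M by apply: mulVmx.
have hE : P *m h *m invmx P = hw K w by rewrite Pw -mulmxA PQ mulmx1.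
pose c x := P *m x *m invmx P.
have sc x : simmx x (c x) by exists P, (invmx P); split=> //; rewrite /c mulmxKV.
have cI x : invmx P *m c x *m P = x by rewrite /c -!mulmxA QP mulmx1 mulKmx.
have cs x : itw f f (x - e) = 0 -> itw (c f) (c f) (c x - c e) = 0.
  by move=> s; rewrite /c -mulmxBl -mulmxBr itw_conj // s mulmx0 mul0mx.
have := sl2_mx_conj QP sl2; rewrite hE => sl2'.
have nile' : exists k, c e ^+ k = 0.
  by have [k ek] := nile; exists k; rewrite conj_exp // ek mulmx0 mul0mx.
suff : c x1 = c x2 by move=> E; rewrite -[x1]cI E cI.
apply: (slice_unique_diag charK sl2' nile'); rewrite ?cs //.
by rewrite -(idim_siml _ (sc x2)) -(idim_simr _ (sc x1)) -(idim_siml _ (sc e)) -(idim_simr _ (sc e)).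
Qed.

Lemma slice_exists m (P : 'M[K]_(m, n)) (Q : 'M_(n, m)) (w : 'rV[int]_m) C :
  P *m Q = 1%:M -> Q *m P = 1%:M -> int_diag h P w -> low w 0 (C - P *m e *m Q) ->
  exists2 x : 'M_n, simmx C x & itw f f (x - e) = 0.
Proof.
move=> PQ QP Pw lC.
have hE : P *m h *m Q = hw K w by rewrite Pw -mulmxA PQ mulmx1.
have := sl2_mx_conj QP sl2; rewrite hE => sl2'.
have nile' : exists k, (P *m e *m Q) ^+ k = 0.
  by have [k ek] := nile; exists k; rewrite conj_exp // ek mulmx0 mul0mx.
have [x [sx fx]] := slice_exists_diag charK sl2' nile' lC.
exists (Q *m x *m P).
  by apply: simmx_trans sx _; exists Q, P; split=> //; rewrite -mulmxA PQ mulmx1.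
have -> : Q *m x *m P - e = Q *m (x - P *m e *m Q) *m P.
  by rewrite mulmxBr mulmxBl !mulmxA QP mul1mx -(mulmxA e) QP mulmx1.
set d := x - _ in fx *.
have cf : f = Q *m (P *m f *m Q) *m P by rewrite !mulmxA QP mul1mx -mulmxA QP mulmx1.
have cM u v : (Q *m u *m P) *m (Q *m v *m P) = Q *m (u *m v) *m P.
  by rewrite !mulmxA -(mulmxA _ P Q) PQ mulmx1.
have : Q *m itw (P *m f *m Q) (P *m f *m Q) d *m P = 0 by rewrite fx mulmx0 mul0mx.
by rewrite /itw mulmxBr mulmxBl -!cM -cf.
Qed.

End Slice.

(** * Conjugates in the slice *)

Section GradedJordan.
Variables (K : fieldType) (charK : [pchar K] =i pred0).

Lemma low_block a b (w1 : 'rV[int]_a) (w2 : 'rV[int]_b) k (A : 'M[K]_a) (B : 'M[K]_b) :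
  low w1 k A -> low w2 k B -> low (row_mx w1 w2) k (block_mx A 0 0 B).
Proof.
move=> lA lB i j; case: (split_ordP i) => i' ->; case: (split_ordP j) => j' ->; rewrite /wt.
- by rewrite !row_mxEl (@block_mxEul _ _ _ _ _ A 0 0 B); exact: (lA i' j').
- by move=> _; rewrite (@block_mxEur _ _ _ _ _ A 0 0 B) mxE.
- by move=> _; rewrite (@block_mxEdl _ _ _ _ _ A 0 0 B) mxE.
- by rewrite !row_mxEr (@block_mxEdr _ _ _ _ _ A 0 0 B); exact: (lB i' j').
Qed.

Lemma weight_exp n (e h : 'M[K]_n) j : h *m e - e *m h = e *+ 2 ->
  h *m e ^+ j = e ^+ j *m h + e ^+ j *+ (2 * j).
Proof.
move=> /eqP; rewrite subr_eq => /eqP he.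
elim: j => [|j IH]; first by rewrite expr0 mulmx1 mul1mx muln0 mulr0n addr0.
rewrite -![_ *m _]/(_ * _) in he IH *.
rewrite exprSr mulrA IH mulrDl -[e ^+ j * h * e]mulrA he mulrDr mulrnAr mulrnAl mulrA.
by rewrite mulnS [X in _ = _ + X]mulrnDr addrAC addrC.
Qed.

Definition eigen_span n (h : 'M[K]_n) := forall v : 'rV_n, exists s : seq (int * 'rV[K]_n),
  v = \sum_(x <- s) x.2 /\ forall x, x \in s -> x.2 *m h = x.1%:~R *: x.2.

Definition powers (ds : seq nat) : seq {poly K} := [seq 'X^d | d <- ds].

(** Splitting off a longest cyclic block generated by a weight vector, the
    dual functional being taken homogeneous as well, so that the complement
    is stable under h. *)
Theorem graded_jordan n (e h : 'M[K]_n) :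
  h *m e - e *m h = e *+ 2 -> (exists k, e ^+ k = 0) -> eigen_span h ->
  exists ds, exists P : 'M[K]_(sumn ds, n), exists Q : 'M[K]_(n, sumn ds), exists w : 'rV[int]_(sumn ds),
    [/\ [/\ P *m Q = 1%:M, Q *m P = 1%:M, P *m e = fmx ds (powers ds) *m P & int_diag h P w],
        all (ltn 0) ds /\ pairwise geq ds,
        forall k, e ^+ k = 0 -> all (geq k) ds
      & forall ps, low w 0 (fmx ds ps - fmx ds (powers ds))].
Proof.
have [m] := ubnP n; elim: m n e h => // m IH n e h lnm he ne sp.
case: n e h lnm he ne sp => [|n] e h lnm he ne sp.
  exists [::], 0, 0, 0; split=> //.
  - by split; apply/matrixP => [] [].
  - by move=> ps [].
have ne' : exists k, e ^+ k == 0 by have [k ek] := ne; exists k; apply/eqP.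
case: (ex_minnP ne') => d /eqP ed dmin.
case: d ed dmin => [|d] ed dmin; first by move/eqP: ed; rewrite expr0 oner_eq0.
have ed0 : e ^+ d != 0 by apply/negP => /dmin; rewrite ltnn.
have [P0 [w0 P0u P0w]] := int_diagonalizable charK sp.
(* A nonzero entry of e^d in an eigenbasis of h provides a weight vector v and
   a weight functional l with v e^d l = 1; by weights, v e^k l = 0 for k <> d. *)
have [i [j ij0]] : exists i j, (P0 *m e ^+ d *m invmx P0) i j != 0.
  have : P0 *m e ^+ d *m invmx P0 != 0.
    apply: contra_neq ed0 => E.
    have -> : e ^+ d = invmx P0 *m (P0 *m e ^+ d *m invmx P0) *m P0.
      by rewrite !mulmxA mulVmx // mul1mx mulmxKV.
    by rewrite E mulmx0 mul0mx.
  by case/matrix0Pn=> i [j ij]; exists i, j.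
set c := (P0 *m e ^+ d *m invmx P0) i j in ij0.
pose v := row i P0; pose l := c^-1 *: col j (invmx P0).
pose mu := w0 0 i; pose nu := w0 0 j.
have vh : v *m h = mu%:~R *: v.
  by rewrite -row_mul P0w row_mul row_diag_mx -scalemxAl -rowE !mxE.
have hl : h *m l = nu%:~R *: l.
  rewrite /l -scalemxAr scalerA mulrC -scalerA; congr (_ *: _).
  have E : h *m invmx P0 = invmx P0 *m diag_mx (map_mx intr w0).
    by rewrite -[LHS](mulKmx P0u) [P0 *m (h *m _)]mulmxA P0w mulmxK.
  rewrite colE mulmxA E -mulmxA.
  have -> : diag_mx (map_mx intr w0) *m delta_mx j 0 = nu%:~R *: delta_mx j 0 :> 'cV[K]_n.+1.
    apply/colP => k; rewrite mul_diag_mx !mxE eqxx andbT.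
    by case: eqP => [->|]; rewrite ?mulr1 ?mulr0.
  by rewrite -scalemxAr.
have vel k : v *m e ^+ k *m l = (c^-1 * (P0 *m e ^+ k *m invmx P0) i j)%:M.
  rewrite /l -scalemxAr /v -!row_mul colE mulmxA -colE.
  by apply/matrixP => a b; rewrite !ord1 !mxE eqxx mulr1n; congr (_ * _); apply: eq_bigr => *; rewrite !mxE.
have wk k : (mu - 2 * k%:Z - nu)%:~R *: (v *m e ^+ k *m l) = 0.
  have nuT : nu%:~R *: (v *m e ^+ k *m l) = mu%:~R *: (v *m e ^+ k *m l) - (2 * k%:Z)%:~R *: (v *m e ^+ k *m l).
    have -> : nu%:~R *: (v *m e ^+ k *m l) = v *m (e ^+ k *m h) *m l by rewrite -!mulmxA hl -!scalemxAr.
    have -> : e ^+ k *m h = h *m e ^+ k - e ^+ k *+ (2 * k) by rewrite (weight_exp k he) addrK.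
    rewrite mulmxBr mulmxBl mulmxA vh -!scalemxAl raddfMn /=; congr (_ - _).
    by rewrite -scaler_nat -scalemxAl rmorphM /= natrM.
  by rewrite rmorphB scalerBl nuT rmorphB scalerBl subrr.
have dd : mu - 2 * d%:Z - nu = 0.
  have /eqP := wk d; rewrite vel mulVf // scaler_eq0 (intr_eq0 charK).
  case/orP=> [/eqP //|/eqP/matrixP/(_ 0 0)]; rewrite !mxE eqxx mulr1n => /eqP.
  by rewrite oner_eq0.
have vl k : (k < d.+1)%N -> v *m e ^+ k *m l = ((k == d)%:R)%:M.
  move=> kd; case: eqP => [->|kd']; first by rewrite vel mulVf.
  have /eqP := wk k; rewrite scaler_eq0 (intr_eq0 charK) => /orP[/eqP h1|/eqP ->].
    by case: kd'; move: dd h1; lia.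
  by apply/matrixP => a b; rewrite !mxE mul0rn.
have pmon : ('X^(d.+1) : {poly K}) \is monic by rewrite monicXn.
have szp : size ('X^(d.+1) : {poly K}) = d.+2 by rewrite size_polyXn.
have vp : v *m pmx e 'X^(d.+1) = 0 by rewrite pmxXn ed mulmx0.
have pl : pmx e 'X^(d.+1) *m l = 0 by rewrite pmxXn ed mul0mx.
have [n' [W [Q1 [Q2 [dn PQ QP We st]]]]] := split_cyclic pmon szp vp pl vl.
have Wh : W *m h = W *m h *m Q2 *m W.
  apply: st; exists (diag_mx (\row_j (nu + 2 * (j : nat)%:Z)%:~R)).
  apply: trmx_inj; rewrite !trmx_mul !trmxK tr_diag_mx; apply/row_matrixP => k.
  rewrite !row_mul row_diag_mx -scalemxAl -rowE !rowK mxE.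
  have -> : e^T ^+ k = (e ^+ k)^T by rewrite -!pmxXn pmx_tr.
  rewrite -!trmx_mul mulmxA (weight_exp k he) mulmxDl -mulmxA hl -scalemxAr.
  rewrite raddfD /= linearZ /= rmorphD rmorphM /= scalerDl; congr (_ + _).
  by rewrite -scaler_nat natrM -scalemxAl linearZ.
set Kr := krylov d.+1 v e in PQ QP *.
have WQ2 : W *m Q2 = 1%:M.
  by move/(congr1 drsubmx): PQ; rewrite mul_col_row block_mxKdr scalar_mx_block block_mxKdr.
have KQ2 : Kr *m Q2 = 0.
  by move/(congr1 ursubmx): PQ; rewrite mul_col_row block_mxKur scalar_mx_block block_mxKur.
have Krh : Kr *m h = diag_mx (map_mx intr (\row_k (mu - 2 * (k : nat)%:Z))) *m Kr.
  apply/row_matrixP => k; rewrite !row_mul row_diag_mx -scalemxAl -rowE !rowK !mxE -mulmxA.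
  have -> : e ^+ k *m h = h *m e ^+ k - e ^+ k *+ (2 * k) by rewrite (weight_exp k he) addrK.
  rewrite mulmxBr mulmxA vh -scalemxAl raddfMn /= rmorphB rmorphM /= scalerBl; congr (_ - _).
  by rewrite -scaler_nat natrM.
pose e' := W *m e *m Q2; pose h' := W *m h *m Q2.
have epow k : e' ^+ k = W *m e ^+ k *m Q2.
  have We' : W *m e = e' *m W by [].
  have := pmx_intertwine 'X^k We'; rewrite !pmxXn => ->.
  by rewrite -mulmxA WQ2 mulmx1.
have hW : W *m h = h' *m W by [].
have eW : W *m e = e' *m W by [].
have he' : h' *m e' - e' *m h' = e' *+ 2.
  have E : (h' *m e' - e' *m h') *m W = (e' *+ 2) *m W.
    rewrite mulmxBl -(mulmxA h' e' W) -(mulmxA e' h' W) -eW -hW (mulmxA h') (mulmxA e') -eW -hW.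
    rewrite -(mulmxA W e h) -(mulmxA W h e) -mulmxBr he.
    by rewrite -!scaler_nat -scalemxAr -scalemxAl -eW.
  by rewrite -[LHS]mulmx1 -WQ2 mulmxA E -mulmxA WQ2 mulmx1.
have e'd : e' ^+ d.+1 = 0 by rewrite epow ed mulmx0 mul0mx.
have sp' : eigen_span h'.
  move=> u; have [s [uE sE]] := sp (u *m W).
  exists [seq (x.1, x.2 *m Q2) | x <- s]; rewrite big_map -mulmx_suml -uE -mulmxA WQ2 mulmx1.
  split=> // _ /mapP[x /sE xh ->] /=.
  have E : x.2 = x.2 *m Q1 *m Kr + x.2 *m Q2 *m W.
    by rewrite -!mulmxA -mulmxDr -mul_row_col QP mulmx1.
  have : x.2 *m h *m Q2 = x.1%:~R *: (x.2 *m Q2) by rewrite xh scalemxAl.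
  move=> <-; rewrite [in RHS]E !mulmxDl -(mulmxA _ Kr h) Krh -!mulmxA KQ2 !mulmx0 add0r.
  by rewrite /h' !mulmxA.
have [||ds [P [Q [w [[PQ' QP' Pe' Ph'] [ds0 chain] mins lows]]]]] := IH n' e' h' _ he' _ sp'.
- by move: lnm dn; lia.
- by exists d.+1.
pose B := block_mx (1%:M : 'M[K]_d.+1) 0 0 P.
pose B' := block_mx (1%:M : 'M[K]_d.+1) 0 0 Q.
have BB' : B *m B' = 1%:M.
  by rewrite mulmx_block !mulmx0 !mul0mx !addr0 !add0r mulmx1 PQ' -scalar_mx_block.
have B'B : B' *m B = 1%:M.
  by rewrite mulmx_block !mulmx0 !mul0mx !addr0 !add0r mulmx1 QP' -scalar_mx_block.
pose wK : 'rV[int]_d.+1 := \row_k (mu - 2 * (k : nat)%:Z).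
exists (d.+1 :: ds), (B *m col_mx Kr W), (row_mx Q1 Q2 *m B'), (row_mx wK w); split.
- split.
  + by rewrite mulmxA -(mulmxA B) PQ mulmx1.
  + by rewrite mulmxA -(mulmxA _ B') B'B mulmx1.
  + rewrite -mulmxA mul_col_mx (krylovM pmon szp vp) eW -/Kr.
    have -> : col_mx (cmx d.+1 'X^(d.+1) *m Kr) (e' *m W) = block_mx (cmx d.+1 'X^(d.+1)) 0 0 e' *m col_mx Kr W.
      by rewrite mul_block_col !mul0mx addr0 add0r.
    rewrite !mulmxA; congr (_ *m _); rewrite /B /=.
    by rewrite !mulmx_block !mulmx0 !mul0mx !addr0 !add0r mulmx1 mul1mx Pe'.
  + rewrite /int_diag -mulmxA mul_col_mx Krh hW.
    have -> : col_mx (diag_mx (map_mx intr wK) *m Kr) (h' *m W) = block_mx (diag_mx (map_mx intr wK)) 0 0 h' *m col_mx Kr W.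
      by rewrite mul_block_col !mul0mx addr0 add0r.
    rewrite !mulmxA; congr (_ *m _); rewrite /B /= map_row_mx diag_mx_row.
    by rewrite !mulmx_block !mulmx0 !mul0mx !addr0 !add0r mulmx1 mul1mx Ph'.
- split=> //=; rewrite chain andbT; exact: mins e'd.
- move=> k ek; rewrite /= mins ?andbT; last by rewrite epow ek mulmx0 mul0mx.
  by apply: dmin; apply/eqP.
- move=> ps /=; rewrite opp_block_mx add_block_mx !oppr0 !addr0.
  apply: low_block; last exact: lows.
  move=> a b; rewrite /wt !mxE => lt.
  case: eqP => [ad|_]; last by rewrite subrr.
  by move: lt; rewrite ad; have := ltn_ord b; lia.
Qed.

End GradedJordan.

Section SliceMeets.
Variables (K : closedFieldType) (charK : [pchar K] =i pred0).

Lemma degs_powers ds : degs (powers K ds) = ds.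
Proof. by rewrite /degs -map_comp -[RHS]map_id; apply: eq_map => d /=; rewrite size_polyXn. Qed.

Lemma powers_invariant ds : all (ltn 0) ds -> pairwise geq ds -> invariant_factors (powers K ds).
Proof.
move=> ds0 chain; apply/andP; split.
  by rewrite /block_polys all_map; apply: sub_all ds0 => d /= d0; rewrite monicXn size_polyXn.
rewrite pairwise_map; apply: sub_pairwise chain => a b /= ba.
exact: dvdp_exp2l.
Qed.

Lemma sl2_eigen_span n (e h f : 'M[K]_n) : sl2_mx e h f -> (exists k, e ^+ k = 0) -> eigen_span h.
Proof.
move=> sl2 nile v; have nilf := nilpotent_of_weight charK (let: And3 _ hf _ := sl2 in hf).
have [s [vE sE]] := weight_decomp charK v (sl2_mx_rows sl2) (nil_op_rows nilf) (nil_op_rows nile).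
by exists s; split=> // x /sE; rewrite lfunE.
Qed.

(** The bounds on the ranks and the centralizer dimension give y the degrees of e,
    so y is similar to the block companion matrix with the block sizes of e, which
    differs from e by weights at most 0. *)
Theorem slice_meets n (e h f y : 'M[K]_n) : sl2_mx e h f -> (exists k, e ^+ k = 0) ->
  (forall i k, (i < n)%N -> kappa_le e i k -> kappa_le y i k) -> idim y y = idim e e ->
  exists2 x : 'M_n, simmx y x & itw f f (x - e) = 0.
Proof.
move=> sl2 nile kap dimy.
have [he _ _] := sl2.
have [ds [P [Q [w [[PQ QP Pe Ph] [ds0 chain] _ lows]]]]] :=
  graded_jordan charK he nile (sl2_eigen_span sl2 nile).
have [ps [ips sps _]] := rational_canonical_form y.
have ie := powers_invariant ds0 chain.
have se : simmx e (fmx (degs (powers K ds)) (powers K ds)).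
  by rewrite degs_powers; exists P, Q.
have E : degs ps = ds.
  rewrite -[RHS]degs_powers; apply: (degs_eq ips sps ie se) => // i im.
  by apply/(rank_gen_space _ _ ips sps); apply: (kap _ _ im); apply/(rank_gen_space _ _ ie se).
have [|x Cx fx] := slice_exists charK sl2 nile PQ QP Ph (C := fmx ds ps).
  by have := lows ps; rewrite Pe -mulmxA PQ mulmx1.
exists x => //; apply: simmx_trans Cx; rewrite -E; exact: sps.
Qed.

End SliceMeets.

(** * Linear automorphisms normalizing the inner derivations *)

Section Idempotents.
Variables (K : closedFieldType) (charK : [pchar K] =i pred0).

Lemma mulmx_deltaE m n p q (A : 'M[K]_(m, n)) (B : 'M[K]_(p, q)) i j k l :
  (A *m delta_mx j k *m B) i l = A i j * B k l.
Proof.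
rewrite mxE (bigD1 k) //= big1 => [|u uk].
  rewrite addr0; congr (_ * _); rewrite mxE (bigD1 j) //= big1 => [|v vj].
    by rewrite mxE !eqxx mulr1 addr0.
  by rewrite mxE (negPf vj) mulr0.
rewrite mxE big1 ?mul0r // => v _; by rewrite mxE (negPf uk) andbF mulr0.
Qed.

Lemma mx_prime m n p q (A : 'M[K]_(m, n)) (B : 'M[K]_(p, q)) :
  (forall z, A *m z *m B = 0) -> A = 0 \/ B = 0.
Proof.
move=> h; have [->|/matrix0Pn[i [j Aij]]] := eqVneq A 0; first by left.
right; apply/matrixP => k l; have /matrixP/(_ i l) := h (delta_mx j k).
by rewrite mulmx_deltaE !mxE => /eqP; rewrite mulf_eq0 (negPf Aij) => /eqP.
Qed.

(** Up to a scalar, P kills a row vector u. Testing the equation on v u gives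
    P^3 = P; testing it on (P^2 + P) z (P^2 - P), on which ad P acts by 2, gives
    P^2 = - P or P^2 = P. *)
Lemma cube_idem n (P : 'M[K]_n) : (0 < n)%N ->
  (forall z, itw P P (itw P P (itw P P z)) = itw P P z) ->
  exists2 Q : 'M_n, Q *m Q = Q &
    (forall z, itw P P z = itw Q Q z) \/ (forall z, itw P P z = - itw Q Q z).
Proof.
case: n P => // n P _ cube.
have [lam /eigenvalueP[u uP u0]] : exists lam, eigenvalue P lam.
  have : size (char_poly P) != 1%N by rewrite size_char_poly.
  by case/closed_rootP => lam; rewrite -eigenvalue_root_char; exists lam.
pose R := P - lam%:M.
have itwR z : itw P P z = itw R R z.
  by rewrite /itw /R mulmxBl mulmxBr mul_scalar_mx mul_mx_scalar opprB addrA subrK.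
have uR : u *m R = 0 by rewrite mulmxBr uP mul_mx_scalar subrr.
clearbody R.
have R3 : R *m R *m R = R.
  have h v : itw R R (v *m u) = R *m v *m u.
    by rewrite /itw -(mulmxA v) uR mulmx0 subr0 mulmxA.
  have E v : (R *m R *m R - R) *m v *m u = 0.
    by have := cube (v *m u); rewrite !itwR !h !mulmxBl -!mulmxA => ->; rewrite subrr.
  have [/eqP|/eqP] := mx_prime (A := R *m R *m R - R) (B := u) E; last by rewrite (negPf u0).
  by rewrite subr_eq0 => /eqP.
have [A0|B0] : R *m R + R = 0 \/ R *m R - R = 0.
  apply: mx_prime => z; set A := R *m R + R; set B := R *m R - R.
  have RA : R *m A = A by rewrite mulmxDr mulmxA R3 addrC.
  have BR : B *m R = - B by rewrite mulmxBl R3 opprB.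
  have E w : itw R R (A *m w *m B) = 2%:R *: (A *m w *m B).
    by rewrite /itw !mulmxA RA -(mulmxA _ B) BR mulmxN opprK scaler_nat mulr2n.
  have := cube (A *m z *m B); rewrite !itwR E.
  have lin c w : itw R R (c *: w) = c *: itw R R w by rewrite linearZ.
  rewrite !lin E !lin E !scalerA => /eqP.
  rewrite -subr_eq0 -scalerBl scaler_eq0 -!natrM -natrB // (natr_eq0 charK) => /eqP //.
- exists (- R); first by rewrite mulmxN mulNmx opprK; move/eqP: A0; rewrite addr_eq0 => /eqP.
  by right => z; rewrite itwR /itw mulNmx mulmxN opprB opprK addrC.
- exists R; first by move/eqP: B0; rewrite subr_eq0 => /eqP.
  by left.
Qed.

Lemma itw_cube_idem n (Q : 'M[K]_n) : Q *m Q = Q ->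
  forall z, itw Q Q (itw Q Q (itw Q Q z)) = itw Q Q z.
Proof.
move=> QQ z; pose c := Q *m z *m Q.
have ha : itw Q Q (Q *m z) = Q *m z - c by rewrite /itw mulmxA QQ.
have hb : itw Q Q (z *m Q) = c - z *m Q by rewrite /itw -(mulmxA z) QQ mulmxA.
have hc : itw Q Q c = 0 by rewrite /itw /c !mulmxA QQ -(mulmxA _ Q Q) QQ subrr.
have h1 : itw Q Q z = Q *m z - z *m Q by [].
have h2 : itw Q Q (itw Q Q z) = Q *m z - c - (c - z *m Q) by rewrite h1 linearB /= ha hb.
have lB u v : itw Q Q (u - v) = itw Q Q u - itw Q Q v by rewrite linearB.
by rewrite h2 !lB ha hc hb h1 subr0 sub0r opprK addrA subrK.
Qed.

Lemma idem_factor n (Q : 'M[K]_n) : Q *m Q = Q ->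
  exists k, exists U : 'M_(n, k), exists V : 'M_(k, n), [/\ k = \rank Q, Q = U *m V & V *m U = 1%:M].
Proof.
move=> QQ; exists (\rank Q), (col_base Q), (row_base Q); split=> //; first by rewrite mulmx_base.
apply: (row_free_inj (row_base_free Q)); apply: (row_full_inj (col_base_full Q)).
have E := mulmx_base Q; move: (col_base Q) (row_base Q) E => U V E.
by rewrite /= mul1mx !mulmxA E -(mulmxA Q) E.
Qed.

Definition two_blocks n k l (U : 'M[K]_(n, k)) (V : 'M[K]_(k, n)) (U' : 'M[K]_(n, l)) (V' : 'M[K]_(l, n))
  (ab : 'M[K]_k * 'M[K]_l) : 'M[K]_n := U *m ab.1 *m V + U' *m ab.2 *m V'.

Lemma two_blocks_linear n k l (U : 'M_(n, k)) (V : 'M_(k, n)) (U' : 'M_(n, l)) (V' : 'M_(l, n)) :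
  linear (two_blocks U V U' V').
Proof.
move=> c [a b] [a' b']; rewrite /two_blocks /= !mulmxDr !mulmxDl -!scalemxAr -!scalemxAl scalerDr.
by rewrite addrACA.
Qed.
HB.instance Definition _ n k l U V U' V' :=
  GRing.isLinear.Build K ('M[K]_k * 'M[K]_l)%type 'M[K]_n *:%R (@two_blocks n k l U V U' V')
    (two_blocks_linear U V U' V').

(** The centralizer of Q is gl(im Q) + gl(ker Q). *)
Lemma idim_idem n (Q : 'M[K]_n) : Q *m Q = Q ->
  idim Q Q = (\rank Q * \rank Q + (n - \rank Q) * (n - \rank Q))%N.
Proof.
move=> QQ; pose R := 1%:M - Q.
have RR : R *m R = R by rewrite mulmxBl mul1mx mulmxBr mulmx1 QQ subrr subr0.
have QR : Q *m R = 0 by rewrite mulmxBr mulmx1 QQ subrr.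
have RQ : R *m Q = 0 by rewrite mulmxBl mul1mx QQ subrr.
have [k [U [V [kE QE VU]]]] := idem_factor QQ.
have [l [U' [V' [lE RE VU']]]] := idem_factor RR.
have rR : \rank R = (n - \rank Q)%N.
  have h1 : (n <= \rank Q + \rank R)%N.
    by rewrite -{1}(mxrank1 K n) -[1%:M](subrK Q) -/R addrC; exact: mxrank_add.
  have h2 : (\rank Q + \rank R <= n)%N by exact: mulmx0_rank_max.
  lia.
have VU0 : V *m U' = 0.
  have := QR; rewrite QE RE => /(congr1 (mulmx V))/(congr1 (mulmx^~ U')).
  by rewrite mulmx0 mul0mx !mulmxA VU mul1mx -mulmxA VU' mulmx1.
have VU0' : V' *m U = 0.
  have := RQ; rewrite QE RE => /(congr1 (mulmx V'))/(congr1 (mulmx^~ U)).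
  by rewrite mulmx0 mul0mx !mulmxA VU' mul1mx -mulmxA VU mulmx1.
pose T := two_blocks U V U' V'.
have TK a b : V *m T (a, b) *m U = a /\ V' *m T (a, b) *m U' = b.
  rewrite /T /two_blocks /= !mulmxDr !mulmxDl !mulmxA VU VU' VU0 VU0' !mul0mx !mul1mx add0r addr0.
  by rewrite -!mulmxA VU VU' !mulmx1.
have T_inj : injective T.
  move=> [a b] [a' b'] E; have [h1 h2] := TK a b; have [h3 h4] := TK a' b'.
  by congr (_, _); [rewrite -h1 -h3 E | rewrite -h2 -h4 E].
rewrite /idim (dim_param (T := T) T_inj).
  by rewrite dimvf /dim /= !dim_matrix -rR -kE -lE.
move=> z; split=> [/itwP Qz|[[a b] ->]].
  exists (V *m z *m U, V' *m z *m U').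
  have E1 : U *m (V *m z *m U) *m V = Q *m z *m Q by rewrite QE !mulmxA.
  have E2 : U' *m (V' *m z *m U') *m V' = R *m z *m R by rewrite RE !mulmxA.
  transitivity (Q *m z *m Q + R *m z *m R); last by rewrite -E1 -E2.
  have Rz : R *m z = z *m R by rewrite mulmxBl mulmxBr mul1mx mulmx1 Qz.
  by rewrite Qz Rz -!mulmxA QQ RR -mulmxDr /R addrC subrK mulmx1.
apply/itwP; rewrite /T /two_blocks /= mulmxDr mulmxDl.
have h1 : Q *m (U *m a *m V) = U *m a *m V by rewrite QE !mulmxA -(mulmxA U V U) VU mulmx1.
have h2 : U *m a *m V *m Q = U *m a *m V by rewrite QE !mulmxA -(mulmxA _ V U) VU mulmx1.
have h3 : Q *m (U' *m b *m V') = 0 by rewrite QE !mulmxA -(mulmxA U V U') VU0 mulmx0 !mul0mx.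
have h4 : U' *m b *m V' *m Q = 0 by rewrite QE !mulmxA -(mulmxA _ V' U) VU0' mulmx0 !mul0mx.
by rewrite h1 h2 h3 h4.
Qed.

End Idempotents.

Section Brackets.
Variables (K : closedFieldType) (charK : [pchar K] =i pred0) (n : nat).
Implicit Types (x y z v : 'M[K]_n) (i j k l : 'I_n).
Local Notation E i j := (delta_mx i j : 'M[K]_n).
Local Notation br x z := (itw x x z).

Lemma jacobi x y z : br (br x y) z = br x (br y z) - br y (br x z).
Proof.
rewrite /itw !mulmxBr !mulmxBl !mulmxA.
set a := x *m y *m z; set b := y *m x *m z; set c := z *m x *m y; set d := z *m y *m x.
set e := x *m z *m y; set f := y *m z *m x.
by clearbody a b c d e f; apply/matrixP => i j; rewrite !mxE; ring.
Qed.

Lemma brD x y z : br (x + y) z = br x z + br y z.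
Proof. by rewrite /itw mulmxDl mulmxDr opprD addrACA. Qed.
Lemma brN x z : br (- x) z = - br x z.
Proof. by rewrite /itw mulNmx mulmxN opprB opprK addrC. Qed.
Lemma brB x y z : br (x - y) z = br x z - br y z.
Proof. by rewrite brD brN. Qed.
Lemma brZ c x z : br (c *: x) z = c *: br x z.
Proof. by rewrite /itw -scalemxAl -scalemxAr scalerBr. Qed.
Lemma br_scalar c z : br c%:M z = 0.
Proof. by rewrite /itw scalar_mxC subrr. Qed.
Lemma brC x y : br x y = - br y x.
Proof. by rewrite /itw opprB. Qed.

Lemma central_scalar x : (forall z, br x z = 0) -> exists c, x = c%:M.
Proof.
case: n x => [|m] x h; first by exists 0; apply/matrixP => - [].
exists (x 0 0); apply/matrixP => i j; rewrite mxE.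
have /matrixP/(_ i 0) := h (delta_mx j 0); rewrite !mxE (bigD1 j) //= big1 => [|k kj]; last first.
  by rewrite mxE (negPf kj) mulr0.
rewrite !mxE !eqxx mulr1 addr0 (bigD1 0) //= big1 => [|k k0]; last first.
  by rewrite mxE (negPf k0) andbF mul0r.
rewrite mxE eqxx andbT addr0 => /eqP; rewrite subr_eq0 => /eqP ->.
by rewrite mulr_natl.
Qed.

Lemma br_deltaE i j v k l :
  br (E i j) v k l = (k == i)%:R * v j l - (l == j)%:R * v k i.
Proof.
rewrite !mxE (bigD1 j) //= big1 => [|u uj]; last by rewrite mxE (negPf uj) andbF mul0r.
rewrite (bigD1 i) //= big1 => [|u ui]; last by rewrite mxE (negPf ui) mulr0.
by rewrite !mxE !eqxx andbT !addr0 [v k i * _]mulrC.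
Qed.

Lemma br_diagE i v k l : br (E i i) v k l = ((k == i)%:R - (l == i)%:R) * v k l.
Proof.
rewrite br_deltaE mulrBl; congr (_ - _); by case: eqP => [->|]; rewrite ?mul0r.
Qed.

Lemma br_delta_delta i j k l : br (E i j) (E k l) = (j == k)%:R *: E i l - (l == i)%:R *: E k j.
Proof.
by rewrite /itw !mul_delta_mx_cond !scaler_nat.
Qed.

Lemma two_neq0 : (2%:R : K) != 0. Proof. by rewrite (natr_eq0 charK). Qed.

Lemma eqN_0 (V : lmodType K) (v : V) : v = - v -> v = 0.
Proof.
move=> h; have : 2%:R *: v = 0 by rewrite scaler_nat mulr2n {1}h addNr.
by move/eqP; rewrite scaler_eq0 (negPf two_neq0) => /eqP.
Qed.

(** Two diagonal matrices suffice to isolate the root space of E i j. *)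
Lemma weight_vector i j v : i != j -> br (E i i) v = v -> br (E j j) v = - v -> v = v i j *: E i j.
Proof.
move=> ij hi hj; apply/matrixP => k l; rewrite !mxE.
have /matrixP/(_ k l) := hi; have /matrixP/(_ k l) := hj; rewrite !br_diagE !mxE.
have K2 (t : K) : - t = t -> t = 0 by move=> h; apply: (@eqN_0 K^o).
have [->|ki] := eqVneq k i; have [->|li] := eqVneq l i => /=.
- by move=> _; rewrite subrr mul0r (negPf ij) mulr0 => <-.
- rewrite (negPf ij) sub0r; have [->|lj] := eqVneq l j; first by rewrite mulr1.
  by rewrite oppr0 mul0r mulr0 => /esym/eqP; rewrite oppr_eq0 => /eqP ->.
- by move=> _; rewrite sub0r mulN1r mulr0; exact: K2.
- by move=> _; rewrite subrr mul0r mulr0 => <-.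
Qed.

Lemma idem_weight1 (Q v : 'M[K]_n) : Q *m Q = Q -> br Q v = v -> Q *m v = v /\ v *m Q = 0.
Proof.
move=> QQ h.
have h1 : Q *m v *m Q = 0.
  by move: (congr1 (mulmx Q) h); rewrite /itw mulmxBr !mulmxA QQ => /eqP; rewrite subr_eq addrC -subr_eq subrr eq_sym => /eqP.
have h2 : v *m Q = 0.
  apply: eqN_0; move: (congr1 (mulmx^~ Q) h); rewrite /itw mulmxBl h1 -mulmxA QQ sub0r => H; exact: esym.
by split=> //; move: h; rewrite /itw h2 subr0.
Qed.

Lemma idem_weightN1 (Q v : 'M[K]_n) : Q *m Q = Q -> br Q v = - v -> Q *m v = 0 /\ v *m Q = v.
Proof.
move=> QQ h.
have h1 : Q *m v *m Q = 0.
  move: (congr1 (mulmx^~ Q) h); rewrite /itw mulmxBl -(mulmxA v) QQ mulNmx => /eqP.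
  by rewrite subr_eq addNr => /eqP.
have h2 : Q *m v = 0.
  by apply: eqN_0; move: (congr1 (mulmx Q) h); rewrite /itw mulmxBr !mulmxA QQ h1 subr0 mulmxN.
by split=> //; move: h; rewrite /itw h2 sub0r => /oppr_inj.
Qed.

(** Q R is both Q R Q and R Q R, hence a multiple of Q and a multiple of R; being
    idempotent it is equal to both or is 0. *)
Lemma rank1_idem_comm (Q R : 'M[K]_n) : Q *m Q = Q -> R *m R = R -> \rank Q = 1%N -> \rank R = 1%N ->
  Q *m R = R *m Q -> Q *m R = 0 \/ Q = R.
Proof.
have scal (S : 'M[K]_n) x : S *m S = S -> \rank S = 1%N -> exists c, S *m x *m S = c *: S.
  move=> SS r1; have [k [U [V [kE SE VU]]]] := idem_factor SS; rewrite r1 in kE; subst k.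
  exists ((V *m x *m U) 0 0); have -> : S *m x *m S = U *m (V *m x *m U) *m V by rewrite SE !mulmxA.
  by move: (V *m x *m U) => w; rewrite {1}[w]mx11_scalar mul_mx_scalar -scalemxAl -SE.
move=> QQ RR rQ rR QR.
have [c cE] := scal Q R QQ rQ; have [d dE] := scal R Q RR rR.
have c1 : Q *m R = c *: Q by rewrite -cE -mulmxA -QR mulmxA QQ.
have d1 : Q *m R = d *: R by rewrite -dE -QR -mulmxA RR.
have [->|QR0] := eqVneq (Q *m R) 0; first by left.
right.
have idem1 e (S : 'M[K]_n) : S *m S = S -> Q *m R = e *: S -> e = 1.
  move=> SS eE; have : (Q *m R) *m (Q *m R) = Q *m R.
    by rewrite mulmxA -(mulmxA Q R Q) -QR mulmxA QQ -mulmxA RR.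
  rewrite eE -scalemxAl -scalemxAr SS scalerA => /eqP; rewrite -subr_eq0 -scalerBl scaler_eq0.
  case/orP=> [|/eqP S0]; last by move: QR0; rewrite eE S0 scaler0 eqxx.
  rewrite -{3}[e]mulr1 -mulrBr mulf_eq0 => /orP[/eqP e0|]; last by rewrite subr_eq0 => /eqP.
  by move: QR0; rewrite eE e0 scale0r eqxx.
by rewrite -[Q]scale1r -(idem1 c Q QQ c1) -c1 d1 (idem1 d R RR d1) scale1r.
Qed.

End Brackets.

Section TorusForm.
Variables (K : closedFieldType) (charK : [pchar K] =i pred0) (n : nat) (o o' : 'I_n) (oo' : o' != o).
Local Notation gl := 'M[K]_n.
Implicit Types (x y z v : gl) (i j k l : 'I_n).
Local Notation E i j := (delta_mx i j : gl).
Local Notation br x z := (itw x x z).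

Definition normalizes (g : 'End(gl)) := forall x, exists y, forall z, g (br x z) = br y (g z).

Variable g : 'End(gl).
Hypotheses (ginj : injective g) (gsurj : forall z, exists w, z = g w) (gn : normalizes g).
Hypothesis gdiag : forall i z, g (br (E i i) z) = br (E i i) (g z).

Let c i j := g (E i j) i j.

Lemma mxZE (a : K) x i j : (a *: x) i j = a * x i j.
Proof. by rewrite mxE. Qed.

Let gZ a x : g (a *: x) = a *: g x. Proof. exact: linearZ. Qed.

Lemma br_kk_ij k i j : br (E k k) (E i j) = ((k == i)%:R - (k == j)%:R) *: E i j.
Proof.
by rewrite br_delta_delta scalerBl [j == k]eq_sym; congr (_ - _);
  case: eqP => [->|]; rewrite ?scale0r.
Qed.

Lemma br_ii_ij i j : i != j -> br (E i i) (E i j) = E i j.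
Proof. by move=> ij; rewrite br_kk_ij eqxx (negPf ij) subr0 scale1r. Qed.

Lemma br_jj_ij i j : i != j -> br (E j j) (E i j) = - E i j.
Proof. by move=> ij; rewrite br_kk_ij eqxx eq_sym (negPf ij) sub0r scaleN1r. Qed.

Lemma g_root i j : i != j -> g (E i j) = c i j *: E i j.
Proof.
move=> ij; apply: (weight_vector charK) => //.
  by rewrite -gdiag br_ii_ij.
by rewrite -gdiag br_jj_ij // linearN.
Qed.

Lemma c_neq0 i j : i != j -> c i j != 0.
Proof.
move=> ij; apply/eqP => c0; have := g_root ij; rewrite c0 scale0r -(linear0 g).
move=> /ginj/matrixP/(_ i j); rewrite !mxE !eqxx => /eqP.
by rewrite oner_eq0.
Qed.

Lemma g_ad_root i j : i != j -> exists d, forall z, g (br (E i j) z) = d *: br (E i j) (g z).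
Proof.
move=> ij; have [y yE] := gn (E i j).
have wt k : exists s, forall a b,
    ((a == k)%:R - (b == k)%:R) * y a b - ((k == i)%:R - (k == j)%:R) * y a b = s *+ (a == b).
  have [|s sE] := @central_scalar _ n (br (E k k) y - ((k == i)%:R - (k == j)%:R) *: y).
    move=> z; have [w ->] := gsurj z.
    by rewrite brB brZ jacobi -!yE -!gdiag -!yE -linearB -jacobi br_kk_ij brZ linearZ subrr.
  exists s => a b; have /matrixP/(_ a b) := sE; move: (br_diagE k y a b).
  by move: (br (E k k) y) => t tE; rewrite !mxE tE.
have [s sE] := wt i; have [s' s'E] := wt j.
exists (y i j) => z; rewrite yE.
suff yd : y = y i j *: E i j + (- s)%:M by rewrite [in LHS]yd brD br_scalar brZ addr0.
have K2 (t : K) : - t = t -> t = 0 by move=> h; apply: (@eqN_0 _ charK K^o).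
apply/matrixP => a b; rewrite !mxE; have := sE a b; have := s'E a b.
rewrite !eqxx [j == i]eq_sym (negPf ij) subr0 sub0r mul1r mulN1r opprK.
have [<-|ab] := eqVneq a b.
  rewrite !subrr !mul0r sub0r !mulr1n => _ <-; rewrite opprK.
  by have [->|] := eqVneq a i; rewrite ?(negPf ij) ?andbF /= mulr0 add0r.
rewrite !mulr0n addr0.
have [ai|ai] := eqVneq a i => /=.
  have [->|bj] := eqVneq b j; first by rewrite ai mulr1.
  by rewrite ai (negPf ij) subrr mul0r add0r mulr0.
move=> _; rewrite mulr0 sub0r; case: (b == i); last by rewrite oppr0 mul0r sub0r => /eqP; rewrite oppr_eq0 => /eqP.
by rewrite mulN1r => /eqP; rewrite subr_eq0 => /eqP; exact: K2.
Qed.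

Let H i j : gl := E i i - E j j.

Lemma br_ij_ji i j : br (E i j) (E j i) = H i j.
Proof. by rewrite br_delta_delta !eqxx !scale1r. Qed.

Lemma br_ij_jk i j k : i != k -> br (E i j) (E j k) = E i k.
Proof. by move=> ik; rewrite br_delta_delta eqxx eq_sym (negPf ik) scale1r scale0r subr0. Qed.

Lemma br_ij_H i j : i != j -> br (E i j) (H i j) = - 2%:R *: E i j.
Proof.
move=> ij; rewrite brC /H brB br_ii_ij // br_jj_ij // opprK scaleNr scaler_nat mulr2n //.
Qed.

(** The root scalars of g are a common factor times a coboundary t_i / t_j, which
    is seen on the brackets of root vectors; the diagonal part is then fixed by
    the bracket of E i j with E j i and by the image of 1. *)
Theorem torus_form : exists c' d (t : 'I_n -> K), (forall i, t i != 0) /\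
  forall x i j, g x i j = t i * (c' * x i j + d * \tr x *+ (i == j)) / t j.
Proof.
have /fin_all_exists2[d _ dE] : forall ij : 'I_n * 'I_n, exists2 d, True & ij.1 != ij.2 ->
    forall z, g (br (E ij.1 ij.2) z) = d *: br (E ij.1 ij.2) (g z).
  move=> [i j] /=; have [->|ij] := eqVneq i j; first by exists 0.
  by have [d dE] := g_ad_root ij; exists d.
pose D i j := d (i, j).
have DE i j : i != j -> forall z, g (br (E i j) z) = D i j *: br (E i j) (g z).
  by move=> ij; apply: (dE (i, j)).
have Eij0 i j : E i j != 0.
  by apply/eqP => /matrixP/(_ i j); rewrite !mxE !eqxx => /eqP; rewrite oner_eq0.
have scE (a b : K) i j : a *: E i j = b *: E i j -> a = b.
  by move/matrixP/(_ i j); rewrite !mxE !eqxx !mulr1.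
pose ga i j := D i j * c j i.
have gH i j : i != j -> g (H i j) = ga i j *: H i j.
  move=> ij; rewrite -br_ij_ji DE // g_root 1?eq_sym // /ga -scalerA; congr (_ *: _).
  by rewrite brC brZ -scalerN -brC.
have H_ij0 i j : i != j -> H i j i i = 1.
  by move=> ij; rewrite !mxE !eqxx (negPf ij) subr0.
have gaC i j : i != j -> ga i j = ga j i.
  move=> ij; have ji : j != i by rewrite eq_sym.
  have := gH j i ji; have -> : H j i = - H i j by rewrite opprB.
  rewrite (linearN g) /= gH // scalerN => /oppr_inj/matrixP/(_ i i).
  by rewrite !mxZE H_ij0 // !mulr1.
have cga i j : i != j -> c i j = D i j * ga i j.
  move=> ij; have := DE i j ij (H i j); rewrite gH // br_ij_H // brC brZ -scalerN -brC br_ij_H //.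
  rewrite gZ g_root // !scalerA => /scE h.
  have n2 : - (2%:R : K) != 0 by rewrite oppr_eq0 (two_neq0 charK).
  apply: (mulfI n2).
  by rewrite h; ring.
have gaP i j k : i != j -> j != k -> i != k -> ga i j = ga i k.
  move=> ij jk ik; have := gH i k ik; have -> : H i k = H i j + H j k by rewrite addrA subrK.
  rewrite (linearD g) /= !gH // => /matrixP/(_ i i); rewrite !mxE !eqxx (negPf ij) (negPf ik) /=.
  by rewrite !subr0 mulr0 !mulr1 !addr0 mulr1.
pose c' := ga o' o.
have gao i : i != o -> ga i o = c'.
  move=> io; have [->//|io'] := eqVneq i o'.
  rewrite gaC // (gaP o i o') 1?gaC // 1?eq_sym //.
have gaE i j : i != j -> ga i j = c'.
  move=> ij; have [io|io] := eqVneq i o; first by rewrite gaC // io gao // -io eq_sym.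
  have [jo|jo] := eqVneq j o; first by rewrite jo gao.
  by rewrite (gaP i j o) // gao.
have c'0 : c' != 0.
  apply/eqP => z; have := gH o' o oo'; rewrite -/c' z scale0r -(linear0 g) => /ginj/matrixP/(_ o' o').
  by rewrite H_ij0 // mxE => /eqP; rewrite oner_eq0.
have cD i j : i != j -> c i j = D i j * c' by move=> ij; rewrite cga // gaE.
have Dc i j : i != j -> D i j * c j i = c' by move=> ij; rewrite -/(ga i j) gaE.
clearbody c'.
have cc i j : i != j -> c i j * c j i = c' ^+ 2.
  by move=> ij; rewrite cD // mulrAC Dc.
(* The coordinates of the torus element are normalized to be 1 at o. *)
pose t i := if i == o then 1 else c i o / c'.
have t0 i : t i != 0.
  rewrite /t; have [_|io] := eqVneq i o; first exact: oner_neq0.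
  by apply: mulf_neq0; rewrite ?invr_eq0 //; exact: c_neq0.
have ct i j : i != j -> c i j = c' * t i / t j.
  move=> ij; rewrite /t; have [io|io] := eqVneq i o.
    have jo : j != o by rewrite -io eq_sym.
    rewrite (negPf jo) io; apply: (mulIf (c_neq0 jo)); rewrite cc 1?eq_sym //.
    by field; rewrite c'0 c_neq0.
  have [jo|jo] := eqVneq j o; first by rewrite jo divr1 mulrCA divff // mulr1.
  have oj : o != j by rewrite eq_sym.
  have := DE i o io (E o j); rewrite br_ij_jk // !g_root // brC brZ -scalerN -brC br_ij_jk //.
  rewrite scalerA => /scE ->.
  have h : D i o * c o j * c j o = D i o * c' ^+ 2 by rewrite -mulrA (cc o j).
  rewrite (cD i o io); apply: (mulIf (c_neq0 jo)); rewrite h.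
  by field; rewrite c'0 c_neq0.
have [s sE] : exists s, g 1%:M = s%:M.
  apply: central_scalar => z; rewrite (matrix_sum_delta z) linear_sum big1 // => k _.
  rewrite linear_sum big1 // => l _; rewrite linearZ /= brC.
  suff -> : br (E k l) (g 1%:M) = 0 by rewrite oppr0 scaler0.
  have z0 x : br x 1%:M = 0 by rewrite brC br_scalar oppr0.
  have [->|kl] := eqVneq k l; first by rewrite -gdiag z0 linear0.
  have /eqP := DE k l kl 1%:M; rewrite z0 linear0 eq_sym scaler_eq0 => /orP[/eqP d0|/eqP //].
  by move: c'0; rewrite -(Dc k l) // d0 mul0r eqxx.
have n0 : (n%:R : K) != 0 by rewrite (natr_eq0 charK) -lt0n; case: (n) o => // - [].
pose dd := (s - c') / n%:R.
have gkk k : g (E k k) = c' *: E k k + dd%:M.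
  have sumH : n%:R *: E k k = \sum_j H k j + 1%:M.
    rewrite /H sumrB sumr_const card_ord scaler_nat mx1_sum_delta subrK //.
  have gsH : g (\sum_j H k j) = c' *: \sum_j H k j.
    rewrite (linear_sum g) /= scaler_sumr; apply: eq_bigr => j _.
    by have [->|kj] := eqVneq k j; [rewrite /H subrr linear0 scaler0 | rewrite gH // gaE].
  apply: (scalerI n0); rewrite -[LHS]gZ sumH (linearD g) /= gsH sE scalerDr.
  rewrite scalerA [n%:R * c']mulrC -scalerA sumH scalerDr -addrA; congr (_ + _).
  by rewrite !scale_scalar_mx mulr1 -raddfD /=; congr (_%:M); rewrite /dd mulrC divfK // addrC subrK.
exists c', dd, t; split=> // x i j.
have gE k l : g (E k l) i j = t i * (c' * E k l i j + dd * (k == l)%:R *+ (i == j)) / t j.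
  have [<-|kl] := eqVneq k l.
    rewrite gkk !mxE mulr1; have [->|ij] := eqVneq i j; first by rewrite mulrAC divff // mul1r.
    have -> : (i == k) && (j == k) = false by apply/negP => /andP[/eqP h1 /eqP h2]; rewrite h1 h2 eqxx in ij.
    by rewrite !mulr0 mulr0n addr0 mulr0 mul0r.
  rewrite g_root // ct // !mxE mulr0 mul0rn addr0.
  by case: eqP => [->|_]; case: eqP => [->|_]; rewrite /= ?mulr0 ?mul0r ?mulr1 // [t k * _]mulrC.
have xs : x i j = \sum_(p : 'I_n * 'I_n) x p.1 p.2 * E p.1 p.2 i j.
  rewrite {1}(matrix_sum_delta x) pair_bigA summxE; apply: eq_bigr => p _; by rewrite mxZE.
have xt : \tr x = \sum_(p : 'I_n * 'I_n) x p.1 p.2 * (p.1 == p.2)%:R.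
  rewrite -(pair_bigA _ (fun k l => x k l * (k == l)%:R)) /=; apply: eq_bigr => k _.
  rewrite (bigD1 k) //= big1 => [|l lk]; first by rewrite eqxx mulr1 addr0.
  by rewrite eq_sym (negPf lk) mulr0.
transitivity (\sum_(p : 'I_n * 'I_n)
    x p.1 p.2 * (t i * (c' * E p.1 p.2 i j + dd * (p.1 == p.2)%:R *+ (i == j)) / t j)).
  rewrite {1}(matrix_sum_delta x) pair_bigA /= (linear_sum g) /= summxE.
  by apply: eq_bigr => p _; rewrite gZ mxZE gE.
have distr A B : t i * (c' * A + dd * B *+ (i == j)) / t j =
    (t i * c' / t j) * A + (t i * dd * (i == j)%:R / t j) * B by rewrite -mulr_natr; ring.
rewrite [x i j]xs xt distr !mulr_sumr -big_split /=; apply: eq_bigr => p _.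
by rewrite distr; ring.
Qed.

End TorusForm.

Section Classification.
Variables (K : closedFieldType) (charK : [pchar K] =i pred0) (n : nat) (o o' : 'I_n) (oo' : o' != o).
Local Notation gl := 'M[K]_n.
Implicit Types (x y z v Q R : gl) (i j k l : 'I_n) (g : 'End(gl)).
Local Notation E i j := (delta_mx i j : gl).
Local Notation br x z := (itw x x z).

Lemma n_gt1 : (1 < n)%N.
Proof.
case: n o o' oo' => [[] //|[|m]] // p q; by rewrite !ord1 eqxx.
Qed.

Lemma br_compl Q z : br (1%:M - Q) z = - br Q z.
Proof. by rewrite brB br_scalar sub0r. Qed.

Lemma idem_compl Q : Q *m Q = Q -> (1%:M - Q) *m (1%:M - Q) = 1%:M - Q.
Proof. by move=> QQ; rewrite mulmxBl mul1mx mulmxBr mulmx1 QQ subrr subr0. Qed.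

Lemma rank_idem_compl Q : Q *m Q = Q -> \rank (1%:M - Q)%R = (n - \rank Q)%N.
Proof.
move=> QQ.
have h1 : (n <= \rank Q + \rank (1%:M - Q)%R)%N.
  have := mxrank_add Q (1%:M - Q); by rewrite addrC subrK mxrank1.
have h2 : (\rank Q + \rank (1%:M - Q)%R <= n)%N.
  by apply: mulmx0_rank_max; rewrite mulmxBr mulmx1 QQ subrr.
lia.
Qed.

Lemma E_idem i : E i i *m E i i = E i i.
Proof. exact: mul_delta_mx. Qed.

Lemma idim_g g x y (s : K) : s != 0 -> injective g -> (forall z, exists w, z = g w) ->
  (forall z, g (br x z) = s *: br y (g z)) -> idim x x = idim y y.
Proof.
move=> s0 gi gs gxy; apply/eqP; rewrite eqn_leq; apply/andP; split.
  apply: (@dim_inj_le _ _ _ g _ _ gi) => z /itwP/eqP; rewrite -subr_eq0 => /eqP zx.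
  apply/itwP/eqP; rewrite -subr_eq0; have := gxy z; rewrite /itw zx linear0 => /esym/eqP.
  by rewrite scaler_eq0 (negPf s0).
have gk : lker g == 0%VS by apply/lker0P.
have gi' : injective (g^-1)%VF.
  by move=> u v; have [u' ->] := gs u; have [v' ->] := gs v; rewrite !(lker0_lfunK gk) => ->.
apply: (@dim_inj_le _ _ _ (g^-1)%VF _ _ gi') => z /itwP/eqP; rewrite -subr_eq0 => /eqP zy.
have [w zE] := gs z; suff hw : w \in lker (linfun (itw x x)).
  by have wE : w = (g^-1)%VF z by [rewrite zE; exact/esym/(lker0_lfunK gk)]; rewrite wE in hw.
apply/itwP/eqP; rewrite -subr_eq0; apply/eqP/gi.
by rewrite linear0 [LHS](gxy w) -zE [br _ _]zy scaler0.
Qed.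

(** The derivation ad y corresponding to ad E_ii is equal to its cube, so cube_idem
    provides an idempotent up to sign; the dimension of its centralizer leaves the
    ranks 1 and n - 1, which are exchanged by passing to the complement. *)
Lemma diag_image g i : injective g -> (forall z, exists w, z = g w) -> normalizes g ->
  exists Q (b : bool), [/\ Q *m Q = Q, \rank Q = 1%N & forall z, g (br (E i i) z) = (-1) ^+ b *: br Q (g z)].
Proof.
move=> gi gs gn; have [y yE] := gn (E i i).
have cube z : br y (br y (br y z)) = br y z.
  by have [w ->] := gs z; rewrite -!yE itw_cube_idem // E_idem.
have [Q QQ yQ] := cube_idem charK (ltnW n_gt1) cube.
have [b bE] : exists b : bool, forall z, g (br (E i i) z) = (-1) ^+ b *: br Q (g z).
  by case: yQ => yQ; [exists false|exists true] => z; rewrite yE yQ ?expr0 ?expr1 ?scale1r ?scaleN1r.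
have := idim_g (s := (-1) ^+ b) _ gi gs bE; rewrite signr_eq0 => /(_ isT).
rewrite (idim_idem (E_idem i)) (idim_idem QQ) mxrank_delta.
have := rank_leq_row Q; have := n_gt1 => n1 rn dimE.
have [r1|r1] : \rank Q = 1%N \/ \rank Q = (n - 1)%N by nia.
  by exists Q, b.
exists (1%:M - Q), (~~ b); split; [exact: idem_compl|rewrite rank_idem_compl // r1; lia|].
move=> z; rewrite bE br_compl; case: b {bE dimE}; by rewrite ?expr0 ?expr1 ?scale1r ?scaleN1r ?opprK.
Qed.

Lemma trace_scalar0 x y c : x *m y - y *m x = c%:M -> c = 0.
Proof.
move/(congr1 mxtrace); rewrite linearB /= mxtrace_mulC subrr mxtrace_scalar => /esym/eqP.
rewrite -mulr_natr mulf_eq0 (natr_eq0 charK) => /orP[/eqP //|/eqP n0]; by have := n_gt1; rewrite n0.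
Qed.

Section Positive.
Variable g : 'End(gl).
Hypotheses (gi : injective g) (gs : forall z, exists w, z = g w) (gn : normalizes g).

Lemma g_neq0 i j : g (E i j) != 0.
Proof.
apply/eqP; rewrite -(linear0 g) => /gi/matrixP/(_ i j); rewrite !mxE !eqxx => /eqP.
by rewrite oner_eq0.
Qed.

(** The bracket of Q and R is central, so it is a scalar matrix of trace 0. *)
Lemma images_commute i j Q R (b b' : bool) :
  (forall z, g (br (E i i) z) = (-1) ^+ b *: br Q (g z)) ->
  (forall z, g (br (E j j) z) = (-1) ^+ b' *: br R (g z)) -> Q *m R = R *m Q.
Proof.
move=> hQ hR; suff [c cE] : exists c, br Q R = c%:M.
  by move/eqP: (cE); rewrite (trace_scalar0 cE) /itw raddf0 subr_eq0 => /eqP.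
have lZ c x z : br x (c *: z) = c *: br x z by rewrite linearZ.
apply: central_scalar => z; have [w ->] := gs z; rewrite jacobi.
have s0 : (-1) ^+ b * (-1) ^+ b' != 0 :> K by rewrite mulf_neq0 // signr_eq0.
apply: (scalerI s0); rewrite scaler0 scalerBr -!scalerA.
have -> : (-1) ^+ b' *: br Q (br R (g w)) = br Q ((-1) ^+ b' *: br R (g w)) by rewrite lZ.
have -> : (-1) ^+ b' *: br R (br Q (g w)) = br R ((-1) ^+ b' *: br Q (g w)) by rewrite lZ.
rewrite -hR -hQ lZ !scalerA mulrC -scalerA -lZ -hQ -hR -linearB -jacobi.
by rewrite br_kk_ij subrr scale0r /itw mul0mx mulmx0 subr0 linear0.
Qed.

Hypothesis pos : exists2 Q, Q *m Q = Q & \rank Q = 1%N /\ forall z, g (br (E o o) z) = br Q (g z).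

(** If the sign were negative at i, the vector g(E o i) would make the idempotents
    at o and i equal, so that E o o + E i i would be central: this leaves n = 2,
    where complements change the sign. *)
Lemma positive_images i :
  exists2 Q, Q *m Q = Q & \rank Q = 1%N /\ forall z, g (br (E i i) z) = br Q (g z).
Proof.
have [->//|io] := eqVneq i o; have oi : o != i by rewrite eq_sym.
have [Q0 QQ0 [rQ0 gQ0]] := pos.
have [Q [b [QQ rQ gQ]]] := diag_image i gi gs gn.
case: b gQ => gQ; last by exists Q => //; split=> // z; rewrite gQ expr0 scale1r.
pose v := g (E o i); have v0 : v != 0 by exact: g_neq0.
have [h1 _] : Q0 *m v = v /\ v *m Q0 = 0.
  by apply: (idem_weight1 charK QQ0); rewrite -gQ0 br_ii_ij.
have [h2 _] : Q *m v = v /\ v *m Q = 0.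
  apply: (idem_weight1 charK QQ); have := gQ (E o i).
  by rewrite br_jj_ij // (linearN g) /= expr1 scaleN1r => /oppr_inj h; exact: esym.
have comm : Q0 *m Q = Q *m Q0.
  apply: (@images_commute o i _ _ false true) => // z; by rewrite expr0 scale1r.
have [Q00|QE] := rank1_idem_comm QQ0 QQ rQ0 rQ comm.
  by move: v0; rewrite -h1 -h2 mulmxA Q00 mul0mx eqxx.
have n2 : n = 2%N.
  have [c cE] : exists c, E o o + E i i = c%:M.
    apply: central_scalar => z; apply: gi; rewrite brD (linearD g) /= gQ0 gQ expr1 scaleN1r QE subrr linear0 //.
  apply/eqP; rewrite eqn_leq n_gt1 andbT leqNgt; apply/negP => n3.
  have [k /andP[ko ki]] : exists k, (k != o) && (k != i).
    apply/existsP; rewrite -[[exists _, _]]negbK; apply/negP => /existsPn h.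
    have : (#|'I_n| <= #|pred2 o i|)%N.
      apply: subset_leq_card; apply/fintype.subsetP => k _; rewrite inE.
      by have := h k; rewrite negb_and !negbK.
    by rewrite card_ord card2 oi; lia.
  have /matrixP c1 := cE; have := c1 k k; have := c1 o o.
  rewrite !mxE !eqxx (negPf oi) (negPf ko) (negPf ki) /= !addr0 !mulr1n => <- /eqP.
  by rewrite eq_sym oner_eq0.
exists (1%:M - Q); first exact: idem_compl.
split; first by rewrite rank_idem_compl // rQ n2.
by move=> z; rewrite gQ br_compl expr1 scaleN1r.
Qed.

End Positive.
End Classification.

Section Classification.
Variables (K : closedFieldType) (charK : [pchar K] =i pred0) (n : nat) (o o' : 'I_n) (oo' : o' != o).
Local Notation gl := 'M[K]_n.
Implicit Types (x y z v Q R : gl) (i j k l : 'I_n) (g : 'End(gl)).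
Local Notation E i j := (delta_mx i j : gl).
Local Notation br x z := (itw x x z).

Lemma invmx_eq x y : x *m y = 1%:M -> invmx x = y.
Proof.
move=> xy; have [ux _] := mulmx1_unit xy.
by rewrite -[RHS](mulKmx ux) xy mulmx1.
Qed.

(** The idempotents Q_i corresponding to the E i i are orthogonal, so their images
    form a frame; after conjugation to the standard frame g commutes with the
    ad E i i. *)
Lemma positive_classification g : injective g -> (forall z, exists w, z = g w) -> normalizes g ->
  (exists2 Q, Q *m Q = Q & \rank Q = 1%N /\ forall z, g (br (E o o) z) = br Q (g z)) ->
  exists2 a, a \in unitmx & exists c d, forall x, g x = a *m (c *: x + (d * \tr x)%:M) *m invmx a.
Proof.
move=> gi gs gn pos.
have /fin_all_exists[Q QP] i : exists Q, [/\ Q *m Q = Q, \rank Q = 1%N & forall z, g (br (E i i) z) = br Q (g z)].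
  by have [Q QQ [rQ gQ]] := positive_images charK oo' gi gs gn pos i; exists Q.
have orth i j : i != j -> Q i *m Q j = 0.
  move=> ij; have [QQi ri gQi] := QP i; have [QQj rj gQj] := QP j.
  have comm : Q i *m Q j = Q j *m Q i.
    apply: (images_commute charK oo' gs (i := i) (j := j) (b := false) (b' := false));
      by move=> z; rewrite expr0 scale1r.
  have [//|QE] := rank1_idem_comm QQi QQj ri rj comm.
  have v0 := g_neq0 gi i j; set v := g (E i j) in v0.
  have [h1 _] : Q i *m v = v /\ v *m Q i = 0.
    by apply: (idem_weight1 charK QQi); rewrite -gQi br_ii_ij.
  have [h2 _] : Q j *m v = 0 /\ v *m Q j = v.
    by apply: (idem_weightN1 charK QQj); rewrite -gQj br_jj_ij // linearN.
  by move: v0; rewrite -h1 QE h2 eqxx.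
have /fin_all_exists[UV UVP] i : exists UV : 'cV[K]_n * 'rV[K]_n, Q i = UV.1 *m UV.2 /\ UV.2 *m UV.1 = 1%:M.
  have [QQ rQ _] := QP i; have [k [U [V [kE QE VU]]]] := idem_factor QQ; rewrite rQ in kE; subst k.
  by exists (U, V).
pose U i := (UV i).1; pose V i := (UV i).2.
have QE i : Q i = U i *m V i by case: (UVP i).
have VU i : V i *m U i = 1%:M by case: (UVP i).
have VUo i j : i != j -> V i *m U j = 0.
  move=> ij; have := orth i j ij; rewrite !QE => /(congr1 (mulmx (V i)))/(congr1 (mulmx^~ (U j))).
  by rewrite mulmx0 mul0mx !mulmxA VU mul1mx -!mulmxA VU mulmx1.
pose A : gl := \matrix_(r, i) U i r 0; pose B : gl := \matrix_(i, r) V i 0 r.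
have BA : B *m A = 1%:M.
  apply/matrixP => i j; rewrite !mxE.
  have -> : \sum_k B i k * A k j = (V i *m U j) 0 0.
    by rewrite mxE; apply: eq_bigr => k _; rewrite !mxE.
  by have [->|ij] := eqVneq i j; rewrite ?VU ?VUo // mxE.
have AB : A *m B = 1%:M by exact: mulmx1C.
have AEB i : A *m E i i *m B = Q i.
  by apply/matrixP => r s; rewrite mulmx_deltaE !mxE QE mxE big_ord1.
pose g' : 'End(gl) := (linfun (mulmxr A \o mulmx B) \o g)%VF.
have g'E z : g' z = B *m g z *m A by rewrite /g' comp_lfunE lfunE.
have gE z : g z = A *m g' z *m B.
  by rewrite g'E !mulmxA AB mul1mx -mulmxA AB mulmx1.
have g'i : injective g' by move=> x y xy; apply: gi; rewrite !gE xy.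
have g's z : exists w, z = g' w.
  have [w wE] := gs (A *m z *m B); exists w; by rewrite g'E -wE !mulmxA BA mul1mx -mulmxA BA mulmx1.
have conj x z : B *m br x z *m A = br (B *m x *m A) (B *m z *m A) by rewrite itw_conj.
have g'n : normalizes g'.
  move=> x; have [y yE] := gn x; exists (B *m y *m A) => z; by rewrite !g'E yE conj.
have g'd i z : g' (br (E i i) z) = br (E i i) (g' z).
  have [_ _ gQ] := QP i; rewrite !g'E gQ conj -AEB; congr (itw _ _ _); by rewrite !mulmxA BA mul1mx -mulmxA BA mulmx1.
have [c [d [t [t0 tE]]]] := torus_form charK oo' g'i g's g'n g'd.
pose T : 'rV[K]_n := \row_i t i; pose T' : 'rV[K]_n := \row_i (t i)^-1.
have TT : diag_mx T *m diag_mx T' = 1%:M.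
  rewrite mulmx_diag -diag_const_mx; congr diag_mx; apply/rowP => i; rewrite !mxE divff //.
have aE : A *m diag_mx T *m (diag_mx T' *m B) = 1%:M.
  by rewrite !mulmxA -(mulmxA A) TT mulmx1.
exists (A *m diag_mx T); first by have [] := mulmx1_unit aE.
exists c, d => x; rewrite (invmx_eq aE) gE.
have -> : g' x = diag_mx T *m (c *: x + (d * \tr x)%:M) *m diag_mx T'.
  by apply/matrixP => i j; rewrite tE mul_mx_diag mul_diag_mx !mxE.
by rewrite !mulmxA.
Qed.

Definition transpose_lfun : 'End(gl) := linfun (fun x => x^T).

Lemma transposeE x : transpose_lfun x = x^T.
Proof. by rewrite lfunE. Qed.

Lemma br_tr x z : (br x z)^T = - br x^T z^T.
Proof. by rewrite /itw linearB /= !trmx_mul opprB. Qed.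

(** Transposition changes the sign in diag_image, so one may assume it positive. *)
Theorem normalizer_classification g : injective g -> (forall z, exists w, z = g w) -> normalizes g ->
  exists2 a, a \in unitmx & exists c d,
    (forall x, g x = a *m (c *: x + (d * \tr x)%:M) *m invmx a) \/
    (forall x, g x = a *m (c *: x^T + (d * \tr x)%:M) *m invmx a).
Proof.
move=> gi gs gn.
have [Q [b [QQ rQ gQ]]] := diag_image charK oo' o gi gs gn.
case: b gQ => gQ; last first.
  have [|a ua [c [d h]]] := positive_classification gi gs gn; last by exists a => //; exists c, d; left.
  by exists Q => //; split=> // z; rewrite gQ expr0 scale1r.
pose g' : 'End(gl) := (g \o transpose_lfun)%VF.
have g'E z : g' z = g z^T by rewrite comp_lfunE transposeE.
have [||||a ua [c [d h]]] := @positive_classification g'.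
- by move=> x y; rewrite !g'E => /gi/trmx_inj.
- by move=> z; have [w wE] := gs z; exists w^T; rewrite g'E trmxK.
- move=> x; have [y yE] := gn x^T; exists (- y) => z.
  by rewrite !g'E br_tr linearN /= yE brN.
- exists Q => //; split=> // z; rewrite !g'E br_tr trmx_delta linearN /= gQ expr1 scaleN1r opprK //.
exists a => //; exists c, d; right => x; have := h x^T; by rewrite g'E trmxK mxtrace_tr.
Qed.

End Classification.

(** * Rings of functions *)

Section FunctionRings.
Variables (K : fieldType) (T : Type).
Implicit Types (A : (T -> K) -> Prop) (F : T -> K).

(** A common interface for polynomials in one or several parameters, polynomial
    functions on a vector space and their localizations: determinants, adjugates
    and evaluations stay inside each of them. *)
Definition fring A := [/\ forall c, A (fun=> c), forall F F', A F -> A F' -> A (fun t => F t + F' t)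
  & forall F F', A F -> A F' -> A (fun t => F t * F' t)].

Variables (A : (T -> K) -> Prop) (rA : fring A).

Lemma frC c : A (fun=> c). Proof. by case: rA. Qed.
Lemma frD F F' : A F -> A F' -> A (fun t => F t + F' t). Proof. by case: rA => _ h _; exact: h. Qed.
Lemma frM F F' : A F -> A F' -> A (fun t => F t * F' t). Proof. by case: rA => _ _ h; exact: h. Qed.
Lemma frN F : A F -> A (fun t => - F t).
Proof.
move=> AF; have -> : (fun t => - F t) = (fun t => -1 * F t) by apply: funext => t; rewrite mulN1r.
by apply: frM => //; exact: frC.
Qed.
Lemma frB F F' : A F -> A F' -> A (fun t => F t - F' t).
Proof. by move=> AF /frN; exact: frD. Qed.

Lemma fr_sum I (r : seq I) (P : pred I) (F : I -> T -> K) :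
  (forall i, P i -> A (F i)) -> A (fun t => \sum_(i <- r | P i) F i t).
Proof.
move=> AF; elim: r => [|i r IH].
  by have -> : (fun t => \sum_(i <- [::] | P i) F i t) = fun=> 0;
    [apply: funext => t; rewrite big_nil | exact: frC].
case Pi: (P i); last first.
  by have -> : (fun t => \sum_(j <- i :: r | P j) F j t) = fun t => \sum_(j <- r | P j) F j t;
    [apply: funext => t; rewrite big_cons Pi|].
have -> : (fun t => \sum_(j <- i :: r | P j) F j t) = fun t => F i t + \sum_(j <- r | P j) F j t.
  by apply: funext => t; rewrite big_cons Pi.
by apply: frD => //; exact: AF.
Qed.

Lemma fr_prod I (r : seq I) (P : pred I) (F : I -> T -> K) :
  (forall i, P i -> A (F i)) -> A (fun t => \prod_(i <- r | P i) F i t).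
Proof.
move=> AF; elim: r => [|i r IH].
  by have -> : (fun t => \prod_(i <- [::] | P i) F i t) = fun=> 1;
    [apply: funext => t; rewrite big_nil | exact: frC].
case Pi: (P i); last first.
  by have -> : (fun t => \prod_(j <- i :: r | P j) F j t) = fun t => \prod_(j <- r | P j) F j t;
    [apply: funext => t; rewrite big_cons Pi|].
have -> : (fun t => \prod_(j <- i :: r | P j) F j t) = fun t => F i t * \prod_(j <- r | P j) F j t.
  by apply: funext => t; rewrite big_cons Pi.
by apply: frM => //; exact: AF.
Qed.

Lemma frX F k : A F -> A (fun t => F t ^+ k).
Proof.
move=> AF; have -> : (fun t => F t ^+ k) = fun t => \prod_(i < k) F t.
  by apply: funext => t; rewrite prodr_const card_ord.
exact: fr_prod.
Qed.

Lemma fr_mpoly n (p : {mpoly K[n]}) (F : 'I_n -> T -> K) :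
  (forall i, A (F i)) -> A (fun t => p.@[fun i => F i t]).
Proof.
move=> AF; have -> : (fun t => p.@[fun i => F i t]) =
   fun t => \sum_(m <- msupp p) p@_m * \prod_i F i t ^+ m i by apply: funext => t; rewrite mevalE.
apply: fr_sum => m _; apply: frM; first exact: frC.
by apply: fr_prod => i _; exact: frX.
Qed.

Definition mfun m n (M : T -> 'M[K]_(m, n)) := forall i j, A (fun t => M t i j).

Lemma mfunC m n (B : 'M[K]_(m, n)) : mfun (fun=> B). Proof. by move=> i j; exact: frC. Qed.

Lemma mfunD m n (M M' : T -> 'M[K]_(m, n)) : mfun M -> mfun M' -> mfun (fun t => M t + M' t).
Proof.
move=> hM hM' i j; have -> : (fun t => (M t + M' t) i j) = fun t => M t i j + M' t i j.
  by apply: funext => t; rewrite mxE.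
exact: frD.
Qed.

Lemma mfunM m n k (M : T -> 'M[K]_(m, n)) (M' : T -> 'M[K]_(n, k)) :
  mfun M -> mfun M' -> mfun (fun t => M t *m M' t).
Proof.
move=> hM hM' i j; have -> : (fun t => (M t *m M' t) i j) = fun t => \sum_l M t i l * M' t l j.
  by apply: funext => t; rewrite mxE.
by apply: fr_sum => l _; exact: frM.
Qed.

Lemma mfunZ m n (F : T -> K) (M : T -> 'M[K]_(m, n)) :
  A F -> mfun M -> mfun (fun t => F t *: M t).
Proof.
move=> hF hM i j; have -> : (fun t => (F t *: M t) i j) = fun t => F t * M t i j.
  by apply: funext => t; rewrite mxE.
exact: frM.
Qed.

Lemma mfunX n (M : T -> 'M[K]_n) k : mfun M -> mfun (fun t => M t ^+ k).
Proof.
move=> hM; elim: k => [|k IH]; first exact: mfunC.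
have -> : (fun t => M t ^+ k.+1) = fun t => M t *m M t ^+ k by apply: funext => t; rewrite exprS.
exact: mfunM.
Qed.

Lemma fr_det n (M : T -> 'M[K]_n) : mfun M -> A (fun t => \det (M t)).
Proof.
move=> hM; apply: fr_sum => s _; apply: frM; first exact: frC.
by apply: fr_prod => i _; exact: hM.
Qed.

Lemma mfun_adj n (M : T -> 'M[K]_n) : mfun M -> mfun (fun t => \adj (M t)).
Proof.
move=> hM i j; have -> : (fun t => (\adj (M t)) i j) = fun t => (-1) ^+ (j + i) * \det (row' j (col' i (M t))).
  by apply: funext => t; rewrite mxE.
apply: frM; first exact: frC.
apply: fr_det => a b; have -> : (fun t => row' j (col' i (M t)) a b) = fun t => M t (lift j a) (lift i b).
  by apply: funext => t; rewrite !mxE.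
exact: hM.
Qed.

Definition vfun (V : vectType K) (M : T -> V) := forall i, A (fun t => vcoord (M t) i).

Lemma vcoordD (V : vectType K) (x y : V) i : vcoord (x + y) i = vcoord x i + vcoord y i.
Proof. exact: linearD. Qed.

Lemma vcoordZ (V : vectType K) a (x : V) i : vcoord (a *: x) i = a * vcoord x i.
Proof. exact: linearZ. Qed.

Lemma vcoord_sum (V : vectType K) I (r : seq I) (F : I -> V) i :
  vcoord (\sum_(j <- r) F j) i = \sum_(j <- r) vcoord (F j) i.
Proof. exact: linear_sum. Qed.

Lemma vfun_sum (V : vectType K) I (r : seq I) (F : I -> T -> K) (v : I -> V) :
  (forall i, A (F i)) -> vfun (fun t => \sum_(i <- r) F i t *: v i).
Proof.
move=> AF i.
have -> : (fun t => vcoord (\sum_(j <- r) F j t *: v j) i) = fun t => \sum_(j <- r) F j t * vcoord (v j) i.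
  by apply: funext => t; rewrite vcoord_sum; apply: eq_bigr => j _; rewrite vcoordZ.
by apply: fr_sum => j _; apply: frM => //; exact: frC.
Qed.

Lemma vcoordK (V : vectType K) (x : V) : \sum_i vcoord x i *: (vbasis {:V})`_i = x.
Proof. by rewrite -coord_vbasis ?memvf. Qed.

Lemma vfun_lin (V W : vectType K) (L : {linear V -> W}) (M : T -> V) : vfun M -> vfun (fun t => L (M t)).
Proof.
move=> hM; have -> : (fun t => L (M t)) = fun t => \sum_i vcoord (M t) i *: L (vbasis {:V})`_i.
  by apply: funext => t; rewrite -{1}(vcoordK (M t)) linear_sum /=; apply: eq_bigr => i _; rewrite linearZ.
exact: vfun_sum.
Qed.

Lemma fr_peval (V : vectType K) (p : {mpoly K[\dim {:V}]}) (M : T -> V) : vfun M -> A (fun t => peval p (M t)).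
Proof. by move=> hM; exact: fr_mpoly. Qed.

Lemma mfun_vfun m n (M : T -> 'M[K]_(m, n)) : mfun M -> vfun M.
Proof.
move=> hM; have -> : M = fun t => \sum_(ij : 'I_m * 'I_n) M t ij.1 ij.2 *: delta_mx ij.1 ij.2.
  apply: funext => t; rewrite {1}(matrix_sum_delta (M t)) pair_bigA //.
by apply: vfun_sum => ij; exact: hM.
Qed.

Lemma vfun_mfun m n (M : T -> 'M[K]_(m, n)) : vfun M -> mfun M.
Proof.
move=> hM i j; have -> : (fun t => M t i j) = fun t => \sum_l vcoord (M t) l * (vbasis {:'M[K]_(m, n)})`_l i j.
  apply: funext => t; rewrite -{1}(vcoordK (M t)) summxE; apply: eq_bigr => l _; by rewrite mxE.
by apply: fr_sum => l _; apply: frM => //; exact: frC.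
Qed.

(** Localization at d, needed as conjugation by a is polynomial in a only up to a
    power of its determinant. *)
Definition floc (d : T -> K) (F : T -> K) := exists k, exists2 Q, A Q & forall t, d t != 0 -> Q t = d t ^+ k * F t.

Lemma floc_fring d : A d -> fring (floc d).
Proof.
move=> Ad; split.
- by move=> c; exists 0%N, (fun=> c); [exact: frC | move=> t _; rewrite mul1r].
- move=> F F' [k [Q AQ QE]] [k' [Q' AQ' QE']].
  exists (k + k')%N, (fun t => d t ^+ k' * Q t + d t ^+ k * Q' t).
    by apply: frD; apply: frM => //; exact: frX.
  by move=> t dt; rewrite QE // QE' // exprD; ring.
- move=> F F' [k [Q AQ QE]] [k' [Q' AQ' QE']].
  exists (k + k')%N, (fun t => Q t * Q' t); first exact: frM.
  by move=> t dt; rewrite QE // QE' // exprD; ring.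
Qed.

Lemma floc_sub d F : A F -> floc d F.
Proof. by move=> AF; exists 0%N, F => // t _; rewrite mul1r. Qed.

Lemma floc_inv d : A d -> floc d (fun t => (d t)^-1).
Proof. by move=> _; exists 1%N, (fun=> 1); [exact: frC | move=> t dt; rewrite expr1 divff]. Qed.

End FunctionRings.

Section Instances.
Variable K : fieldType.

Definition uni (F : K -> K) := exists q : {poly K}, forall t, F t = q.[t].
Lemma uni_fring : fring uni.
Proof.
split=> [c|F F' [q qE] [q' qE']|F F' [q qE] [q' qE']].
- by exists c%:P => t; rewrite hornerC.
- by exists (q + q') => t; rewrite hornerD qE qE'.
- by exists (q * q') => t; rewrite hornerM qE qE'.
Qed.
Lemma uniX : uni (fun t => t). Proof. by exists 'X => t; rewrite hornerX. Qed.

Definition multi r (F : ('I_r -> K) -> K) := exists q : {mpoly K[r]}, forall t, F t = q.@[t].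
Lemma multi_fring r : fring (@multi r).
Proof.
split=> [c|F F' [q qE] [q' qE']|F F' [q qE] [q' qE']].
- by exists c%:MP => t; rewrite mevalC.
- by exists (q + q') => t; rewrite mevalD qE qE'.
- by exists (q * q') => t; rewrite mevalM qE qE'.
Qed.
Lemma multiX r (i : 'I_r) : multi (fun t => t i).
Proof. by exists 'X_i => t; rewrite mevalXU. Qed.

Definition pfun (V : vectType K) (F : V -> K) := exists q : {mpoly K[\dim {:V}]}, forall x, F x = peval q x.
Lemma pfun_fring (V : vectType K) : fring (@pfun V).
Proof.
split=> [c|F F' [q qE] [q' qE']|F F' [q qE] [q' qE']].
- by exists c%:MP => t; rewrite /peval mevalC.
- by exists (q + q') => t; rewrite qE qE' /peval mevalD.
- by exists (q * q') => t; rewrite qE qE' /peval mevalM.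
Qed.
Lemma pfun_id (V : vectType K) : vfun (@pfun V) id.
Proof. by move=> i; exists 'X_i => x; rewrite /peval mevalXU. Qed.

Lemma zariski_closed_pfun (V : vectType K) (I : (V -> K) -> Prop) :
  (forall F, I F -> pfun F) -> zariski_closed [set x | forall F, I F -> F x = 0].
Proof.
move=> pI; exists [set p | I (peval p)]; apply/seteqP; split=> x /=.
  by move=> h p; exact: h.
by move=> h F IF; have [q qE] := pI _ IF; rewrite qE; apply: h; have <- : F = peval q by exact: funext.
Qed.

End Instances.

(** * First-order expansions *)

Section Jets.
Variable K : closedFieldType.
Implicit Types (F : K -> K) (p q : {poly K}).

Lemma poly_fun0 p : (forall t, p.[t] = 0) -> p = 0.
Proof. by move=> p0; apply/eqP/negPn/negP => /closed_nonrootP[x]; rewrite /root p0 eqxx. Qed.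

Lemma poly_fun0_off (d p : {poly K}) : d != 0 -> (forall t, d.[t] != 0 -> p.[t] = 0) -> p = 0.
Proof.
move=> d0 h; apply/eqP; rewrite -[_ == 0]orFb -(negPf d0) -mulf_eq0; apply/eqP/poly_fun0 => t.
by rewrite hornerM; have [->|/h->] := eqVneq d.[t] 0; rewrite ?mul0r ?mulr0.
Qed.

Lemma horner0_neq0 (d : {poly K}) : d.[0] != 0 -> d != 0.
Proof. by apply: contra_neq => ->; rewrite horner0. Qed.

(** First-order expansion at the origin of a rational function: derivatives along
    a curve in the group are found by comparing two expansions. *)
Definition jet F (c0 c1 : K) := exists a b : {poly K}, b.[0] != 0 /\
  forall s, b.[s] != 0 -> F s = c0 + s * c1 + s ^+ 2 * (a.[s] / b.[s]).

Lemma jetC c : jet (fun=> c) c 0.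
Proof.
by exists 0, 1; rewrite hornerC oner_neq0; split=> // s _; rewrite hornerC mul0r !mulr0 !addr0.
Qed.

Lemma jetX : jet (fun s => s) 0 1.
Proof.
by exists 0, 1; rewrite hornerC oner_neq0; split=> // s _; rewrite hornerC mul0r !mulr0 addr0 add0r mulr1.
Qed.

Lemma jetD F G c0 c1 d0 d1 : jet F c0 c1 -> jet G d0 d1 -> jet (fun s => F s + G s) (c0 + d0) (c1 + d1).
Proof.
move=> [a [b [b0 E]]] [a' [b' [b0' E']]]; exists (a * b' + a' * b), (b * b').
split; first by rewrite hornerM mulf_neq0.
move=> s; rewrite hornerM mulf_eq0 negb_or => /andP[bs bs'].
rewrite (E s) // (E' s) // !(hornerD, hornerM, hornerN, horner_exp, hornerC, hornerX); field; by rewrite bs bs'.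
Qed.

Lemma jetM F G c0 c1 d0 d1 : jet F c0 c1 -> jet G d0 d1 ->
  jet (fun s => F s * G s) (c0 * d0) (c1 * d0 + c0 * d1).
Proof.
move=> [a [b [b0 E]]] [a' [b' [b0' E']]].
exists (a * b' * d0%:P + a' * b * c0%:P + (c1 * d1)%:P * b * b' + 'X * (c1%:P * a' * b + d1%:P * a * b') + 'X ^+ 2 * a * a'), (b * b').
split; first by rewrite hornerM mulf_neq0.
move=> s; rewrite hornerM mulf_eq0 negb_or => /andP[bs bs'].
rewrite (E s) // (E' s) // !(hornerD, hornerM, hornerN, horner_exp, hornerC, hornerX); field; by rewrite bs bs'.
Qed.

Lemma jet_eqc F c0 c1 d0 d1 : jet F c0 c1 -> c0 = d0 -> c1 = d1 -> jet F d0 d1.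
Proof. by move=> ? <- <-. Qed.

Lemma jet_ext F G c0 c1 : F =1 G -> jet F c0 c1 -> jet G c0 c1.
Proof. by move=> /funext ->. Qed.

Lemma jet_conv F G c0 c1 d0 d1 : jet F c0 c1 -> F =1 G -> c0 = d0 -> c1 = d1 -> jet G d0 d1.
Proof. by move=> ? /funext <- <- <-. Qed.

Lemma jet_sum I (r : seq I) (F : I -> K -> K) (c d : I -> K) :
  (forall i, jet (F i) (c i) (d i)) ->
  jet (fun s => \sum_(i <- r) F i s) (\sum_(i <- r) c i) (\sum_(i <- r) d i).
Proof.
move=> h; elim: r => [|i r IH].
  by rewrite !big_nil; apply: jet_ext (jetC 0) => s; rewrite big_nil.
by rewrite !big_cons; apply: jet_ext (jetD (h i) IH) => s; rewrite big_cons.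
Qed.

(** Clearing denominators, two expansions agree as polynomials, K being infinite. *)
Lemma jet_uniq F c0 c1 d0 d1 : jet F c0 c1 -> jet F d0 d1 -> c0 = d0 /\ c1 = d1.
Proof.
move=> [a [b [b0 E]]] [a' [b' [b0' E']]].
have bb0 : b * b' != 0 by rewrite mulf_neq0 // horner0_neq0.
have : (c0 - d0)%:P * (b * b') + 'X * ((c1 - d1)%:P * (b * b') + 'X * (a * b' - a' * b)) = 0.
  apply: (poly_fun0_off bb0) => s; rewrite hornerM mulf_eq0 negb_or => /andP[bs bs'].
  have := E' s bs'; rewrite (E s bs) => /eqP; rewrite -subr_eq0 => /eqP H.
  rewrite !(hornerD, hornerM, hornerN, horner_exp, hornerC, hornerX); rewrite -(mulr0 (b.[s] * b'.[s])) -H; field; by rewrite bs bs'.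
move=> H; have /eqP := congr1 (horner^~ 0) H.
rewrite /= !(hornerD, hornerM, hornerN, horner_exp, hornerC, hornerX) mul0r addr0 mulf_eq0 mulf_eq0 (negPf b0) (negPf b0') !orbF subr_eq0 => /eqP cd.
split=> //; move: H; rewrite cd subrr mul0r add0r => /eqP; rewrite mulf_eq0 polyX_eq0 /= => /eqP.
move=> /(congr1 (horner^~ 0))/eqP; rewrite /= !(hornerD, hornerM, hornerN, horner_exp, hornerC, hornerX) mul0r addr0 mulf_eq0 mulf_eq0 (negPf b0) (negPf b0') !orbF.
by rewrite subr_eq0 => /eqP.
Qed.

Lemma jet_poly q t : jet (fun s => q.[t + s]) q.[t] q^`().[t].
Proof.
elim/poly_ind: q => [|q c IH].
  by rewrite deriv0 !horner0; apply: jet_ext (jetC 0) => s; rewrite horner0.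
have h : jet (fun s => t + s) t 1 by apply: jet_eqc (jetD (jetC t) jetX) _ _; rewrite ?addr0 ?add0r.
apply: (@jet_ext (fun s => q.[t + s] * (t + s) + c)) => [s|]; first by rewrite !(hornerD, hornerM, hornerN, horner_exp, hornerC, hornerX).
by apply: jet_eqc (jetD (jetM IH h) (jetC c)) _ _; rewrite ?derivE !(hornerD, hornerM, hornerN, horner_exp, hornerC, hornerX) //; ring.
Qed.

Lemma jet_mpoly n (p : {mpoly K[n]}) (F : 'I_n -> K -> K) (x v : 'I_n -> K) :
  (forall i, jet (F i) (x i) (v i)) ->
  jet (fun s => p.@[fun i => F i s]) p.@[x] (\sum_i (p^`M(i)).@[x] * v i).
Proof.
move=> h; pose J (q : {mpoly K[n]}) := jet (fun s => q.@[fun i => F i s]) q.@[x] (\sum_i (q^`M(i)).@[x] * v i).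
have JD (q q' : {mpoly K[n]}) : J q -> J q' -> J (q + q').
  move=> a b; apply: jet_conv (jetD a b) _ _ _ => [s||]; rewrite ?mevalD //.
  by rewrite -big_split /=; apply: eq_bigr => i _; rewrite mderivD mevalD mulrDl.
have JM (q q' : {mpoly K[n]}) : J q -> J q' -> J (q * q').
  move=> a b; apply: jet_conv (jetM a b) _ _ _ => [s||]; rewrite ?mevalM //.
  rewrite mulr_suml mulr_sumr -big_split /=; apply: eq_bigr => i _.
  by rewrite mderivM mevalD !mevalM; ring.
have JC c : J c%:MP.
  apply: jet_conv (jetC c) _ _ _ => [s||]; rewrite ?mevalC //.
  by rewrite big1 // => i _; rewrite mderivC meval0 mul0r.
have JX i : J 'X_i.
  apply: jet_conv (h i) _ _ _ => [s||]; rewrite ?mevalXU //.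
  rewrite (bigD1 i) //= big1 => [|j ji]; rewrite mderivX mnm1E ?eqxx.
    have -> : (U_(i) - U_(i))%MM = 0%MM by apply/mnmP => k; rewrite mnmBE mnm0E subnn.
    by rewrite mpolyX0 scale1r meval1 mul1r addr0.
  by rewrite eq_sym (negPf ji) scale0r meval0 mul0r.
rewrite -/(J p); elim/mpolyind: p => [|c m p _ _ IH]; first by rewrite -mpolyC0; exact: JC.
apply: JD => //; rewrite -mul_mpolyC; apply: (JM); first exact: (JC).
rewrite mpolyXE_id; apply: (big_ind J); first by rewrite -mpolyC1; exact: JC.
  exact: (JM).
move=> i _; elim: (m i) => [|k IHk]; first by rewrite expr0 -mpolyC1; exact: JC.
by rewrite exprS; apply: JM.
Qed.

Definition vjet (V : vectType K) (M : K -> V) (x v : V) := forall i, jet (fun s => vcoord (M s) i) (vcoord x i) (vcoord v i).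

Lemma vjet_peval (V : vectType K) (p : {mpoly K[\dim {:V}]}) (M : K -> V) x v :
  vjet M x v -> jet (fun s => peval p (M s)) (peval p x) (pdiff p x v).
Proof. exact: jet_mpoly. Qed.

Lemma vjet_sum (V : vectType K) I (r : seq I) (F : I -> K -> K) (c d : I -> K) (v : I -> V) :
  (forall i, jet (F i) (c i) (d i)) ->
  vjet (fun s => \sum_(i <- r) F i s *: v i) (\sum_(i <- r) c i *: v i) (\sum_(i <- r) d i *: v i).
Proof.
move=> h i; rewrite !vcoord_sum.
apply: jet_ext; last apply: (@jet_sum _ r (fun j s => F j s * vcoord (v j) i)
   (fun j => vcoord (c j *: v j) i) (fun j => vcoord (d j *: v j) i)).
  by move=> s /=; rewrite vcoord_sum; apply: eq_bigr => j _; rewrite vcoordZ.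
by move=> j; rewrite !vcoordZ; apply: jet_eqc (jetM (h j) (jetC _)) _ _; rewrite // mulr0 addr0.
Qed.

Lemma vjet_line (V : vectType K) (x v : V) : vjet (fun s => x + s *: v) x v.
Proof.
move=> i; apply: jet_ext; last first.
  apply: jet_eqc (jetD (jetC (vcoord x i)) (jetM jetX (jetC (vcoord v i)))) _ _.
    by rewrite mul0r addr0.
  by rewrite mul1r mulr0 addr0 add0r.
by move=> s /=; rewrite vcoordD vcoordZ.
Qed.

Definition mjet m n (M : K -> 'M[K]_(m, n)) (B C : 'M_(m, n)) :=
  forall i j, jet (fun s => M s i j) (B i j) (C i j).

Lemma linear_comb (U V : lmodType K) (f : U -> V) : linear f ->
  forall I (r : seq I) (c : I -> K) (v : I -> U),
  f (\sum_(i <- r) c i *: v i) = \sum_(i <- r) c i *: f (v i).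
Proof.
move=> lf I r c v; elim: r => [|i r IH]; last by rewrite !big_cons lf IH.
by rewrite !big_nil; have := lf (-1) 0 0; rewrite scaler0 addr0 scaleN1r addNr.
Qed.

Lemma bilinear_deltaE m n k l (V : vectType K) (b : 'M[K]_(m, n) -> 'M[K]_(k, l) -> V) :
  (forall y, linear (b^~ y)) -> (forall x, linear (b x)) -> forall x y,
  b x y = \sum_(i : ('I_m * 'I_n) * ('I_k * 'I_l))
     (x i.1.1 i.1.2 * y i.2.1 i.2.2) *: b (delta_mx i.1.1 i.1.2) (delta_mx i.2.1 i.2.2).
Proof.
move=> lx ly x y.
rewrite {1}(matrix_sum_delta x) pair_bigA /= (linear_comb (lx y)) /=.
rewrite -(pair_bigA _ (fun (i : 'I_m * 'I_n) (j : 'I_k * 'I_l) =>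
  (x i.1 i.2 * y j.1 j.2) *: b (delta_mx i.1 i.2) (delta_mx j.1 j.2))) /=.
apply: eq_bigr => i _.
rewrite {1}(matrix_sum_delta y) pair_bigA /= (linear_comb (ly _)) scaler_sumr.
by apply: eq_bigr => j _; rewrite scalerA.
Qed.

Lemma vjet_bilinear m n k l (V : vectType K) (b : 'M[K]_(m, n) -> 'M[K]_(k, l) -> V) :
  (forall y, linear (b^~ y)) -> (forall x, linear (b x)) ->
  forall M M' B C B' C', mjet M B C -> mjet M' B' C' ->
  vjet (fun s => b (M s) (M' s)) (b B B') (b C B' + b B C').
Proof.
move=> lx ly M M' B C B' C' h h'.
have E := bilinear_deltaE lx ly.
rewrite (E C B') (E B C') (E B B') -big_split /=.
have -> : (fun s => b (M s) (M' s)) = (fun s => \sum_(i : ('I_m * 'I_n) * ('I_k * 'I_l))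
     (M s i.1.1 i.1.2 * M' s i.2.1 i.2.2) *: b (delta_mx i.1.1 i.1.2) (delta_mx i.2.1 i.2.2)).
  by apply: funext => s; exact: E.
under [X in vjet _ _ X]eq_bigr do rewrite -scalerDl.
apply: (vjet_sum _ (F := fun (i : ('I_m * 'I_n) * ('I_k * 'I_l)) s => M s i.1.1 i.1.2 * M' s i.2.1 i.2.2)) => i.
exact: (jetM (h _ _) (h' _ _)).
Qed.

Lemma vfun_bilinear T (A : (T -> K) -> Prop) (rA : fring A)
  m n k l (V : vectType K) (b : 'M[K]_(m, n) -> 'M[K]_(k, l) -> V) :
  (forall y, linear (b^~ y)) -> (forall x, linear (b x)) ->
  forall M M', mfun A M -> mfun A M' -> vfun A (fun s => b (M s) (M' s)).
Proof.
move=> lx ly M M' h h'.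
have -> : (fun s => b (M s) (M' s)) = (fun s => \sum_(i : ('I_m * 'I_n) * ('I_k * 'I_l))
     (M s i.1.1 i.1.2 * M' s i.2.1 i.2.2) *: b (delta_mx i.1.1 i.1.2) (delta_mx i.2.1 i.2.2)).
  by apply: funext => s; exact: bilinear_deltaE.
apply: (@vfun_sum _ _ _ rA _ _ _ (fun (i : ('I_m * 'I_n) * ('I_k * 'I_l)) s => M s i.1.1 i.1.2 * M' s i.2.1 i.2.2)) => i.
by apply: (frM rA).
Qed.

End Jets.

(** * Conjugations belong to the adjoint group *)

Section Conjugation.
Variables (K : closedFieldType) (N : nat).
Local Notation gl := 'M[K]_N.
Implicit Types (a b x y : gl) (g : 'End(gl)).

Definition sandwich a b : 'End(gl) := linfun (mulmxr b \o mulmx a).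
Definition Ad a := sandwich a (invmx a).

Lemma sandwichE a b x : sandwich a b x = a *m x *m b.
Proof. by rewrite lfunE. Qed.

Lemma AdE a x : Ad a x = a *m x *m invmx a.
Proof. exact: sandwichE. Qed.

Lemma adE y x : ad y x = bracket y x.
Proof.
pose f := GRing.sub_fun (mulmx y) (mulmxr y).
by rewrite /ad (_ : bracket y = f) ?lfunE.
Qed.

Lemma invmx_prod a b : a \in unitmx -> b \in unitmx -> invmx (a *m b) = invmx b *m invmx a.
Proof.
move=> ua ub; have uab : a *m b \in unitmx by rewrite unitmx_mul ua.
by apply: (can_inj (mulmxK uab)); rewrite mulVmx // !mulmxA -(mulmxA _ _ a) mulVmx // mulmx1 mulVmx.
Qed.

Lemma Ad_mul a b : a \in unitmx -> b \in unitmx -> Ad (a *m b) = (Ad a \o Ad b)%VF.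
Proof. by move=> ua ub; apply/lfunP => x; rewrite comp_lfunE !AdE invmx_prod // !mulmxA. Qed.

Lemma Ad1 : Ad 1%:M = \1%VF.
Proof. by apply/lfunP => x; rewrite id_lfunE AdE invmx1 mul1mx mulmx1. Qed.

Lemma AdK a : a \in unitmx -> (Ad (invmx a) \o Ad a)%VF = \1%VF.
Proof. by move=> ua; rewrite -Ad_mul ?unitmx_inv // mulVmx // Ad1. Qed.

Lemma Ad_lker a : a \in unitmx -> lker (Ad a) == 0%VS.
Proof.
move=> ua; apply/lker0P => x y /(congr1 (Ad (invmx a))).
by rewrite -!comp_lfunE AdK // !id_lfunE.
Qed.

Lemma sandwich_comp_linl g b : linear (fun a => (sandwich a b \o g)%VF).
Proof.
by move=> c a a'; apply/lfunP => x; rewrite !(add_lfunE, scale_lfunE, comp_lfunE, sandwichE) !mulmxDl -!scalemxAl.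
Qed.
Lemma sandwich_comp_linr g a : linear (fun b => (sandwich a b \o g)%VF).
Proof.
by move=> c b b'; apply/lfunP => x; rewrite !(add_lfunE, scale_lfunE, comp_lfunE, sandwichE) mulmxDr -scalemxAr.
Qed.
Lemma sandwich_val_linl x b : linear (fun a => a *m x *m b).
Proof. by move=> c a a'; rewrite !mulmxDl -!scalemxAl. Qed.
Lemma sandwich_val_linr x a : linear (fun b => a *m x *m b).
Proof. by move=> c b b'; rewrite mulmxDr -scalemxAr. Qed.

Section Functions.
Variables (T : Type) (A : (T -> K) -> Prop) (rA : fring A) (M : T -> gl) (hM : mfun A M).
Let d t := \det (M t).

Lemma Adet : A d. Proof. exact: fr_det. Qed.

Lemma floc_ext (F F' : T -> K) : (forall t, d t != 0 -> F t = F' t) -> floc A d F -> floc A d F'.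
Proof. by move=> E [k [Q AQ QE]]; exists k, Q => // t dt; rewrite QE // E. Qed.

Lemma mfun_inv : mfun (floc A d) (fun t => invmx (M t)).
Proof.
move=> i j; have h : floc A d (fun t => (d t)^-1 * (\adj (M t)) i j).
  apply: (frM (floc_fring rA Adet)); first exact: (floc_inv rA Adet).
  by apply: floc_sub; apply: (mfun_adj rA).
by apply: floc_ext h => t dt; rewrite /invmx unitmxE unitfE dt [RHS]mxE.
Qed.

Lemma mfun_loc : mfun (floc A d) M.
Proof. by move=> i j; apply: floc_sub; exact: hM. Qed.

Lemma vfun_Ad g : vfun (floc A d) (fun t => (Ad (M t) \o g)%VF).
Proof.
exact: (vfun_bilinear (floc_fring rA Adet) (sandwich_comp_linl g) (sandwich_comp_linr g) mfun_loc mfun_inv).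
Qed.

Lemma vfun_Adx x : vfun (floc A d) (fun t => M t *m x *m invmx (M t)).
Proof.
exact: (vfun_bilinear (floc_fring rA Adet) (sandwich_val_linl x) (sandwich_val_linr x) mfun_loc mfun_inv).
Qed.
End Functions.

Lemma jet_eq_off (F G : K -> K) c0 c1 (d : {poly K}) : jet F c0 c1 -> d.[0] != 0 ->
  (forall s, d.[s] != 0 -> F s = G s) -> jet G c0 c1.
Proof.
move=> [p [b [b0 E]]] d0 FG; exists (p * d), (b * d); split; first by rewrite hornerM mulf_neq0.
move=> s; rewrite hornerM mulf_eq0 negb_or => /andP[bs ds].
by rewrite -FG // (E s bs) hornerM -mulf_div divff // mulr1.
Qed.

Lemma mfun_line a b : mfun (@uni K) (fun t => a + t *: b).
Proof.
apply: (mfunD (uni_fring K)); first exact: (mfunC (uni_fring K)).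
by apply: (mfunZ (uni_fring K)); [exact: uniX | exact: (mfunC (uni_fring K))].
Qed.

Lemma line_det a b : exists d : {poly K}, forall t, \det (a + t *: b) = d.[t].
Proof. exact: (fr_det (uni_fring K) (mfun_line a b)). Qed.

Lemma mjet_line y : mjet (fun s => 1%:M + s *: y) 1%:M y.
Proof.
move=> i j; apply: jet_conv (jetD (jetC ((1%:M : gl) i j)) (jetM (@jetX K) (jetC (y i j)))) _ _ _.
- by move=> s; rewrite !mxE.
- by rewrite mul0r addr0.
- by rewrite mulr0 addr0 mul1r add0r.
Qed.

Lemma mjet_inv y : mjet (fun s => invmx (1%:M + s *: y)) 1%:M (- y).
Proof.
move=> i j; have [d dE] := line_det 1%:M y.
have [q qE] : uni (fun s => (y *m y *m \adj (1%:M + s *: y)) i j).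
  apply: (mfunM (uni_fring K)); first exact: (mfunC (uni_fring K)).
  by apply: (mfun_adj (uni_fring K)); exact: mfun_line.
exists q, d; split; first by rewrite -dE scale0r addr0 det1 oner_neq0.
move=> s ds; set a := 1%:M + s *: y.
have ua : a \in unitmx by rewrite unitmxE unitfE dE.
have E : invmx a = 1%:M - s *: y + s ^+ 2 *: (y *m y *m invmx a).
  apply: (can_inj (mulmxK ua)); rewrite mulVmx // mulmxDl -(scalemxAl (s ^+ 2)) -(mulmxA (y *m y) _ a) mulVmx // mulmx1.
  rewrite /a mulmxDr mulmx1 mulmxBl mul1mx -scalemxAl -scalemxAr scalerA expr2.
  by move: (y *m y) => yy; apply/matrixP => u v; rewrite !mxE; ring.
have E2 : (y *m y *m invmx a) i j = q.[s] / d.[s].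
  by rewrite -qE -dE /invmx ua -scalemxAr mxE mulrC.
by rewrite -E2 {1}E !mxE mulrN.
Qed.

Lemma vjet_Ad y g : vjet (fun s => (Ad (1%:M + s *: y) \o g)%VF) g (ad y \o g)%VF.
Proof.
have := vjet_bilinear (sandwich_comp_linl g) (sandwich_comp_linr g) (mjet_line y) (mjet_inv y).
suff [-> ->] : (sandwich 1%:M 1%:M \o g)%VF = g /\
   ((sandwich y 1%:M \o g) + (sandwich 1%:M (- y) \o g))%VF = (ad y \o g)%VF by [].
split; apply/lfunP => x.
  by rewrite comp_lfunE sandwichE mul1mx mulmx1.
by rewrite add_lfunE !comp_lfunE !sandwichE adE mul1mx mulmx1 mulmxN.
Qed.

Lemma vjet_Adx y x : vjet (fun s => (1%:M + s *: y) *m x *m invmx (1%:M + s *: y)) x (bracket y x).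
Proof.
have := vjet_bilinear (sandwich_val_linl x) (sandwich_val_linr x) (mjet_line y) (mjet_inv y).
by rewrite mul1mx !mulmx1 mulmxN.
Qed.

Lemma pdiff_linear (V : vectType K) (p : {mpoly K[\dim {:V}]}) (x : V) : linear_for *%R (pdiff p x).
Proof.
move=> c u v; rewrite /pdiff mulr_sumr -big_split /=; apply: eq_bigr => i _.
by rewrite vcoordD vcoordZ; ring.
Qed.

Lemma pdiff_sum (V : vectType K) (p : {mpoly K[\dim {:V}]}) (x : V) I (r : seq I) (c : I -> K) (v : I -> V) :
  pdiff p x (\sum_(i <- r) c i *: v i) = \sum_(i <- r) c i * pdiff p x (v i).
Proof.
rewrite /pdiff; under [RHS]eq_bigr do rewrite mulr_sumr.
rewrite [RHS]exchange_big /=; apply: eq_bigr => i _.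
by rewrite vcoord_sum mulr_sumr; apply: eq_bigr => j _; rewrite vcoordZ; ring.
Qed.

Lemma ad_delta y : ad y = \sum_(i : 'I_N * 'I_N) y i.1 i.2 *: ad (delta_mx i.1 i.2).
Proof.
apply/lfunP => x; rewrite sum_lfunE adE /bracket {1 2}(matrix_sum_delta y) !pair_bigA /= mulmx_suml mulmx_sumr -sumrB.
by apply: eq_bigr => i _; rewrite scale_lfunE adE -scalemxAl -scalemxAr scalerBr.
Qed.

End Conjugation.

Section Order.
Variables (K : closedFieldType) (charK : [pchar K] =i pred0).
Implicit Types (p q d : {poly K}).

(** Divisibility by X^m, coefficientwise. *)
Definition vanord m p := forall i, (i < m)%N -> p`_i = 0.

Lemma vanordD m p q : vanord m p -> vanord m q -> vanord m (p + q).
Proof. by move=> hp hq i im; rewrite coefD hp // hq // addr0. Qed.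

Lemma vanordM m p q : vanord m q -> vanord m (p * q).
Proof.
move=> hq i im; rewrite coefM big1 // => j _; rewrite hq ?mulr0 //.
exact: leq_ltn_trans (leq_subr _ _) im.
Qed.

Lemma vanord_sum m I (r : seq I) (F : I -> {poly K}) :
  (forall i, vanord m (F i)) -> vanord m (\sum_(i <- r) F i).
Proof.
move=> h; apply: big_ind => //; last by move=> *; apply: vanordD.
by move=> i _; rewrite coef0.
Qed.

Lemma vanord_cancel m d q : d.[0] != 0 -> vanord m (d * q) -> vanord m q.
Proof.
rewrite horner_coef0 => d0 h i; have [k] := ubnP i; elim: k i => // k IH i ik im.
have := h i im; rewrite coefM big_ord_recl /= subn0 big1 => [|j _].
  by move/eqP; rewrite addr0 mulf_eq0 (negPf d0) => /eqP.
by rewrite (IH (i - bump 0 j)%N) ?mulr0 // /bump /=; have := ltn_ord j; lia.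
Qed.

Lemma vanord_deriv m q : q.[0] = 0 -> vanord m q^`() -> vanord m.+1 q.
Proof.
rewrite horner_coef0 => q0 h [|i] im //; have := h i im; rewrite coef_deriv -mulr_natl => /eqP.
by rewrite mulf_eq0 (natr_eq0 charK) => /eqP.
Qed.

Lemma vanord_all q : (forall m, vanord m q) -> q = 0.
Proof. by move=> h; apply/polyP => i; rewrite (h i.+1) ?coef0. Qed.

End Order.

Section VfunLinear.
Variables (K : closedFieldType) (T : Type) (A : (T -> K) -> Prop) (rA : fring A).

Lemma vfun_linear (V W : vectType K) (L : V -> W) (M : T -> V) : linear L -> vfun A M -> vfun A (fun t => L (M t)).
Proof.
move=> lL hM; have -> : (fun t => L (M t)) = fun t => \sum_i vcoord (M t) i *: L (vbasis {:V})`_i.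
  by apply: funext => t; rewrite -{1}(vcoordK (M t)) (linear_comb lL).
by apply: (vfun_sum rA).
Qed.

End VfunLinear.

Section AdjointGroup.
Variables (K : closedFieldType) (charK : [pchar K] =i pred0) (N : nat).
Local Notation gl := 'M[K]_N.
Variables (G : set 'End(gl)) (hG : adjoint_group G).
Implicit Types (g : 'End(gl)) (f : {mpoly K[\dim {:'End(gl)}]}).

Definition vanish f := forall g, G g -> peval f g = 0.

Lemma G1 : G \1%VF. Proof. by case: hG => [[]]. Qed.
Lemma Gmul g g' : G g -> G g' -> G (g \o g')%VF. Proof. by case: hG => [[_ h _ _] _ _]; exact: h. Qed.
Lemma Ginv g : G g -> G (g^-1)%VF. Proof. by case: hG => [[_ _ h _] _ _]; exact: h. Qed.
Lemma G_lker g : G g -> lker g == 0%VS. Proof. by case: hG => [[_ _ _ [Z _ ->]] _ _] []. Qed.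

Lemma in_G g : lker g == 0%VS -> (forall f, vanish f -> peval f g = 0) -> G g.
Proof.
move=> kg h; case: (hG) => [[_ _ _ [Z [I ZE] GE]] _ _]; rewrite GE; split=> //.
rewrite ZE => f If /=; apply: h => g'; rewrite GE => -[]; rewrite ZE => h' _; exact: h'.
Qed.

Lemma tangent f y : vanish f -> pdiff f \1%VF (ad y) = 0.
Proof.
case: hG => _ _ lieE vf.
have : lie_algebra G (ad y) by rewrite lieE; exists y.
by apply.
Qed.

Lemma comp_linr (h : 'End(gl)) : linear (fun g => (g \o h)%VF).
Proof. by move=> c g g'; rewrite comp_lfunDl comp_lfunZl. Qed.
Lemma comp_linl (h : 'End(gl)) : linear (fun g => (h \o g)%VF).
Proof. by move=> c g g'; rewrite comp_lfunDr comp_lfunZr. Qed.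

(** Right translation by g carries the tangent space at 1 to the one at g. *)
Lemma tangent_at f y g : vanish f -> G g -> pdiff f g (ad y \o g)%VF = 0.
Proof.
move=> vf Gg.
have [p pE] : pfun (fun x : 'End(gl) => peval f (x \o g)%VF).
  apply: (fr_peval (pfun_fring _)); apply: (vfun_linear (pfun_fring _) (comp_linr g)); exact: pfun_id.
have vp : vanish p by move=> x Gx; rewrite -pE; apply: vf; apply: Gmul.
have j1 := vjet_peval p (vjet_line \1%VF (ad y)).
have j2 := vjet_peval f (vjet_line g (ad y \o g)%VF).
have j3 : jet (fun s => peval p (\1%VF + s *: ad y)) (peval f g) (pdiff f g (ad y \o g)%VF).
  apply: jet_ext j2 => s; rewrite -pE; congr (peval f _).
  by rewrite comp_lfunDl comp_lfunZl comp_lfun1l.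
by have [_ <-] := jet_uniq j1 j3; exact: tangent.
Qed.

(** The right-invariant vector field of y preserves the ideal of G. *)
Lemma derivation f y : vanish f ->
  exists2 f', vanish f' & forall g, peval f' g = pdiff f g (ad y \o g)%VF.
Proof.
move=> vf.
have [f' f'E] : pfun (fun g : 'End(gl) => pdiff f g (ad y \o g)%VF).
  apply: (fr_sum (pfun_fring _)) => i _; apply: (frM (pfun_fring _)).
    by apply: (fr_mpoly (pfun_fring _)); exact: pfun_id.
  exact: (vfun_linear (pfun_fring _) (comp_linl (ad y)) (@pfun_id _ _) i).
by exists f' => [g Gg|g]; rewrite -f'E // tangent_at.
Qed.

(** Along the line 1 + t n every equation of G pulls back to a rational function
    of t; its derivative is a combination of functions of the same kind, and all
    of them vanish at the origin, so they vanish identically. *)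
Theorem Ad_in_G a : a \in unitmx -> G (Ad a).
Proof.
move=> ua; pose n := a - 1%:M; pose A t := 1%:M + t *: n.
have A1 : A 1 = a by rewrite /A scale1r addrC subrK.
have [d dE] := line_det 1%:M n.
have d0 : d.[0] = 1 by rewrite -dE scale0r addr0 det1.
(* The polynomial Q represents the equation f along the line, up to a power of
   the determinant. *)
pose rep f k Q := forall t, d.[t] != 0 -> Q.[t] = d.[t] ^+ k * peval f (Ad (A t)).
have repE f : exists k Q, rep f k Q.
  have [k [Q' [Q QE] h]] : floc (@uni K) (fun t => \det (A t)) (fun t => peval f (Ad (A t) \o \1%VF)%VF).
    apply: (fr_peval (floc_fring (uni_fring K) _)); last apply: (vfun_Ad (uni_fring K)).
      by apply: (fr_det (uni_fring K)); exact: mfun_line.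
    exact: mfun_line.
  exists k, Q => t dt; have := h t; rewrite comp_lfun1r [\det _]dE -QE; exact.
have der f k Q (w : 'I_N * 'I_N -> {poly K}) t : rep f k Q ->
    (forall i t, (w i).[t] = (n *m \adj (A t)) i.1 i.2) -> d.[t] != 0 ->
    d.[t] * Q^`().[t] = k%:R * d^`().[t] * Q.[t] +
      d.[t] ^+ k * \sum_i (w i).[t] * pdiff f (Ad (A t)) (ad (delta_mx i.1 i.2) \o Ad (A t))%VF.
  move=> fQ wE dt; pose at_ := A t; pose y := n *m invmx at_.
  have uat : at_ \in unitmx by rewrite unitmxE unitfE [\det _]dE.
  have AdE s : d.[t + s] != 0 -> Ad (A (t + s)) = (Ad (1%:M + s *: y) \o Ad at_)%VF.
    move=> ds; have E : A (t + s) = (1%:M + s *: y) *m at_.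
      by rewrite mulmxDl mul1mx -scalemxAl mulmxKV // /at_ /A scalerDl addrA.
    rewrite E Ad_mul //; have : A (t + s) \in unitmx by rewrite unitmxE unitfE [\det _]dE.
    by rewrite E unitmx_mul => /andP[].
  have j1 := jet_poly Q t.
  have j2 := jetM (jet_poly (d ^+ k) t) (vjet_peval f (vjet_Ad y (Ad at_))).
  pose dt' := d \Po ('X + t%:P).
  have dt'E s : dt'.[s] = d.[t + s] by rewrite horner_comp hornerD hornerX hornerC addrC.
  have [|s|_ ->] := jet_uniq j1 (jet_eq_off j2 (d := dt') _ _).
  - by rewrite dt'E addr0.
  - by rewrite dt'E => ds; rewrite horner_exp (fQ _ ds) AdE.
  have Dy : d.[t] * pdiff f (Ad at_) (ad y \o Ad at_)%VF =
      \sum_i (w i).[t] * pdiff f (Ad at_) (ad (delta_mx i.1 i.2) \o Ad at_)%VF.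
    have -> : (ad y \o Ad at_)%VF = \sum_(i : 'I_N * 'I_N) y i.1 i.2 *: (ad (delta_mx i.1 i.2) \o Ad at_)%VF.
      by rewrite {1}(ad_delta y) (linear_comb (comp_linr (Ad at_))).
    rewrite pdiff_sum mulr_sumr; apply: eq_bigr => i _; rewrite mulrA; congr (_ * _).
    rewrite wE -[RHS](mulVKf dt) -/at_; congr (_ * _).
    have -> : d.[t]^-1 * (n *m \adj at_) i.1 i.2 = (d.[t]^-1 *: (n *m \adj at_)) i.1 i.2 by rewrite [RHS]mxE.
    by rewrite scalemxAr /y /invmx uat -dE.
  rewrite mulrDr -Dy (fQ t dt) !horner_exp deriv_exp hornerMn hornerM horner_exp -mulr_natl.
  have dk : k%:R * d.[t] ^+ k = k%:R * (d.[t] * d.[t] ^+ k.-1) by case: (k) => [|k']; rewrite ?mul0r // exprS.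
  rewrite -/at_.
  have -> : k%:R * d^`().[t] * (d.[t] ^+ k * peval f (Ad at_)) = k%:R * d.[t] ^+ k * d^`().[t] * peval f (Ad at_) by ring.
  by rewrite dk; ring.
(* Induction on the order of vanishing at t = 0, for all equations at once. *)
have main m : forall f, vanish f -> forall k Q, rep f k Q -> vanord m Q.
  elim: m => // m IH f vf k Q fQ.
  have /choice[w wE] (i : 'I_N * 'I_N) : exists w : {poly K}, forall t, w.[t] = (n *m \adj (A t)) i.1 i.2.
    have [q qE] : uni (fun t => (n *m \adj (A t)) i.1 i.2).
      apply: (mfunM (uni_fring K)); first exact: (mfunC (uni_fring K)).
      by apply: (mfun_adj (uni_fring K)); exact: mfun_line.
    by exists q => t; rewrite qE.
  have /choice[D DE] (i : 'I_N * 'I_N) : exists D : nat * {poly K}, vanord m D.2 /\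
      forall t, d.[t] != 0 -> D.2.[t] = d.[t] ^+ D.1 * pdiff f (Ad (A t)) (ad (delta_mx i.1 i.2) \o Ad (A t))%VF.
    have [f' vf' f'E] := derivation (delta_mx i.1 i.2) vf.
    have [k' [Q' f'Q]] := repE f'; exists (k', Q'); split; first exact: IH f'Q.
    by move=> t dt; rewrite /= f'Q // f'E.
  pose kk := (\sum_i (D i).1)%N.
  have E : d ^+ kk * (d * Q^`()) = d ^+ kk * (k%:R * d^`() * Q) +
      \sum_i d ^+ k * w i * d ^+ (kk - (D i).1) * (D i).2.
    apply/eqP; rewrite -subr_eq0; apply/eqP; apply: (@poly_fun0_off _ d); first by rewrite horner0_neq0 // d0 oner_neq0.
    move=> t dt; apply/eqP; rewrite hornerD hornerN subr_eq0; apply/eqP.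
    rewrite !hornerM (der f k Q w t fQ wE dt) hornerD horner_sum mulrDr; congr (_ + _).
      by rewrite !hornerM -polyC_natr hornerC.
    rewrite !mulr_sumr; apply: eq_bigr => i _; rewrite !hornerM !horner_exp (DE i).2 //.
    have -> : d.[t] ^+ kk = d.[t] ^+ (kk - (D i).1) * d.[t] ^+ (D i).1.
      by rewrite -exprD subnK // /kk (bigD1 i) //= leq_addr.
    by ring.
  apply: (vanord_deriv charK).
    by rewrite fQ ?d0 ?oner_neq0 // expr1n mul1r /A scale0r addr0 Ad1; apply: vf; exact: G1.
  apply: (@vanord_cancel _ m (d ^+ kk * d)); first by rewrite hornerM horner_exp d0 expr1n mulr1 oner_neq0.
  rewrite -mulrA E; apply: vanordD; first by do 2!apply: vanordM; exact: (IH f vf k).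
  by apply: vanord_sum => i; apply: vanordM; case: (DE i).
apply: in_G => [|f vf]; first exact: Ad_lker.
have [k [Q fQ]] := repE f.
have Q0 : Q = 0 by apply: vanord_all => m; exact: (main m f vf k).
have d1 : d.[1] != 0 by rewrite -dE -/(A 1) A1 -unitfE -unitmxE.
have := fQ 1 d1; rewrite Q0 horner0 A1 => /esym/eqP.
by rewrite mulf_eq0 expf_eq0 (negPf d1) andbF => /eqP.
Qed.

End AdjointGroup.

(** * The dimension of a conjugacy class *)

Section Orbits.
Variables (K : closedFieldType) (charK : [pchar K] =i pred0) (N : nat).
Local Notation gl := 'M[K]_N.
Implicit Types (f : {mpoly K[\dim {:gl}]}) (x y z a : gl).

Lemma line_rational f x a b : exists k, exists Q : {poly K}, forall t,
  \det (a + t *: b) != 0 -> Q.[t] = \det (a + t *: b) ^+ k * peval f (Ad (a + t *: b) x).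
Proof.
have [k [Q' [Q QE] h]] : floc (@uni K) (fun t => \det (a + t *: b))
    (fun t => peval f ((a + t *: b) *m x *m invmx (a + t *: b))).
  apply: (fr_peval (floc_fring (uni_fring K) _)); last by apply: (vfun_Adx (uni_fring K)); exact: mfun_line.
  by apply: (fr_det (uni_fring K)); exact: mfun_line.
by exists k, Q => t dt; rewrite AdE -h // QE.
Qed.

(** Two invertible matrices are joined by a line, on which all but finitely
    many matrices are invertible. *)
Lemma orbit_irreducible f1 f2 x :
  (forall a, a \in unitmx -> peval f1 (Ad a x) * peval f2 (Ad a x) = 0) ->
  (forall a, a \in unitmx -> peval f1 (Ad a x) = 0) \/ (forall a, a \in unitmx -> peval f2 (Ad a x) = 0).
Proof.
move=> f12.
have [|/existsNP[a1 /not_implyP[u1 /eqP v1]]] := pselect (forall a, a \in unitmx -> peval f1 (Ad a x) = 0).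
  by left.
have [|/existsNP[a2 /not_implyP[u2 /eqP v2]]] := pselect (forall a, a \in unitmx -> peval f2 (Ad a x) = 0).
  by right.
exfalso.
have [d dE] := line_det a1 (a2 - a1).
have [k1 [Q1 Q1E]] := line_rational f1 x a1 (a2 - a1).
have [k2 [Q2 Q2E]] := line_rational f2 x a1 (a2 - a1).
have E0 : a1 + 0 *: (a2 - a1) = a1 by rewrite scale0r addr0.
have E1 : a1 + 1 *: (a2 - a1) = a2 by rewrite scale1r addrC subrK.
move: (u1) (u2); rewrite !unitmxE !unitfE => d1 d2.
have Q10 : Q1 != 0.
  apply: contra_neq v1 => Q0; have := Q1E 0; rewrite E0 d1 Q0 horner0 => /(_ isT)/esym/eqP.
  by rewrite mulf_eq0 expf_eq0 (negPf d1) andbF => /eqP.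
have Q20 : Q2 != 0.
  apply: contra_neq v2 => Q0; have := Q2E 1; rewrite E1 d2 Q0 horner0 => /(_ isT)/esym/eqP.
  by rewrite mulf_eq0 expf_eq0 (negPf d2) andbF => /eqP.
have d0 : d != 0 by apply: contra_neq d1 => D; rewrite -E0 dE D horner0.
have : d * (Q1 * Q2) != 0 by rewrite !mulf_neq0.
case/closed_nonrootP => t; rewrite /root !hornerM !mulf_eq0 !negb_or => /and3P[dt q1 q2].
have dt' : \det (a1 + t *: (a2 - a1)) != 0 by rewrite dE.
have := f12 (a1 + t *: (a2 - a1)); rewrite unitmxE unitfE dt' => /(_ isT)/eqP.
rewrite mulf_eq0 => /orP[]/eqP h.
  by move: q1; rewrite Q1E // h mulr0 eqxx.
by move: q2; rewrite Q2E // h mulr0 eqxx.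
Qed.

Lemma pfun_linear (V : vectType K) (l : V -> K) : linear_for *%R l -> pfun l.
Proof.
move=> ll; have -> : l = fun x : V => \sum_i vcoord x i * l (vbasis {:V})`_i.
  by apply: funext => x; rewrite -{1}(vcoordK x) (linear_comb (V := K^o) ll).
apply: (fr_sum (pfun_fring V)) => i _; apply: (frM (pfun_fring V)); first exact: pfun_id.
exact: (frC (pfun_fring V)).
Qed.

(** The coordinates along im ad z have invertible differential on the orbit at z.
    The partial derivatives of a relation of least degree are then relations of
    smaller degree, by irreducibility of the orbit, so they are 0 and the relation
    is constant. *)
Lemma orbit_independent z d : (d <= \dim (limg (ad z)))%N ->
  exists f : 'I_d -> {mpoly K[\dim {:gl}]}, forall P : {mpoly K[d]},
    (forall a, a \in unitmx -> P.@[fun i => peval (f i) (Ad a z)] = 0) -> P = 0.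
Proof.
set U := limg (ad z) => dU; pose b := vbasis U.
pose w := widen_ord dU.
have /choice[y yE] (j : 'I_d) : exists y, bracket y z = b`_(w j).
  have /memv_imgP[y _ yE] : b`_(w j) \in U.
    by apply: vbasis_mem; apply: mem_nth; rewrite size_tuple.
  exists (- y); rewrite yE adE /bracket mulNmx mulmxN opprK addrC //.
pose l i x : K := coord b (w i) x.
have ll i : linear_for *%R (l i) by move=> c u v; rewrite /l linearP.
have /choice[f fE] (i : 'I_d) := pfun_linear (ll i).
exists f; pose ev x i := peval (f i) x.
have lE i j : l i (bracket (y j) z) = (i == j)%:R.
  by rewrite yE /l coord_free ?(basis_free (vbasisP U)) // eq_sym -(inj_eq val_inj).
(* Induction on the degree of the relation. *)
suff main n : forall P : {mpoly K[d]}, (forall m, (n <= mdeg m)%N -> P@_m = 0) ->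
    (forall a, a \in unitmx -> P.@[ev (Ad a z)] = 0) -> P = 0.
  move=> P; apply: (main (msize P)) => m /msize_mdeg_ge; exact: memN_msupp_eq0.
elim: n => [|n IH] P Pn PE; first by apply/mpolyP => m; rewrite Pn // mcoeff0.
have der x v : (exists2 a, a \in unitmx & x = Ad a z) -> \sum_i (P^`M(i)).@[ev x] * l i (bracket v x) = 0.
  case=> a ua xE.
  have j1 : jet (fun s => P.@[ev (Ad (1%:M + s *: v) x)]) P.@[ev x] (\sum_i (P^`M(i)).@[ev x] * l i (bracket v x)).
    apply: jet_mpoly => i; have := vjet_peval (f i) (vjet_Adx v x).
    have -> : pdiff (f i) x (bracket v x) = l i (bracket v x).
      have j := vjet_peval (f i) (vjet_line x (bracket v x)).
      have j' : jet (fun s => peval (f i) (x + s *: bracket v x)) (l i x) (l i (bracket v x)).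
        apply: jet_conv (jetD (jetC (l i x)) (jetM (@jetX K) (jetC (l i (bracket v x))))) _ _ _.
        - by move=> s; rewrite -fE [x + _]addrC [RHS]ll addrC.
        - by rewrite mul0r addr0.
        - by rewrite mulr0 addr0 mul1r add0r.
      by have [_ ->] := jet_uniq j j'.
    by apply: jet_ext => s; rewrite /ev AdE.
  have [dd ddE] := line_det 1%:M v.
  have j2 : jet (fun s => P.@[ev (Ad (1%:M + s *: v) x)]) 0 0.
    apply: (jet_eq_off (jetC 0) (d := dd)); first by rewrite -ddE scale0r addr0 det1 oner_neq0.
    move=> s ds; have us : 1%:M + s *: v \in unitmx by rewrite unitmxE unitfE ddE.
    by rewrite xE -comp_lfunE -Ad_mul // PE // unitmx_mul us.
  by have [] := jet_uniq j1 j2.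
(* The differentials of the chosen functions along the orbit; M z = 1. *)
pose M x : 'M[K]_d := \matrix_(i, j) l i (bracket (y j) x).
have dM i x : (exists2 a, a \in unitmx & x = Ad a z) -> (P^`M(i)).@[ev x] * \det (M x) = 0.
  move=> ax; pose r : 'rV[K]_d := \row_k (P^`M(k)).@[ev x].
  have rM : r *m M x = 0.
    apply/rowP => j; rewrite !mxE -[RHS](der x (y j) ax); apply: eq_bigr => k _; by rewrite !mxE.
  have : r *m M x *m \adj (M x) = 0 by rewrite rM mul0mx.
  rewrite -mulmxA mul_mx_adj mul_mx_scalar => /rowP/(_ i); rewrite !mxE mulrC; exact.
have [D DE] : pfun (fun x => \det (M x)).
  apply: (fr_det (pfun_fring _)) => i j.
  have [|q qE] := @pfun_linear _ (fun x => l i (bracket (y j) x)).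
    move=> c u v; rewrite -ll; congr (l i _).
    by rewrite /bracket mulmxDr mulmxDl -scalemxAr -scalemxAl scalerBr opprD addrACA.
  by exists q => x; rewrite mxE qE.
have [d0|d0] := pselect (forall i, P^`M(i) = 0); last first.
  case/existsNP: d0 => i; case; apply: IH => [m mn|].
    by rewrite mcoeff_mderiv Pn ?mul0rn // mdegD mdeg1 addn1.
  have [q qE] : pfun (fun x => (P^`M(i)).@[ev x]).
    by apply: (fr_mpoly (pfun_fring _)) => k; exists (f k).
  have [a ua|h a ua|h] := @orbit_irreducible q D z.
  - by rewrite -qE -DE; apply: dM; exists a.
  - by rewrite qE h.
  - have := h 1%:M (unitmx1 _ _); rewrite Ad1 id_lfunE -DE.
    have -> : M z = 1%:M by apply/matrixP => k j; rewrite !mxE lE.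
    by rewrite det1 => /eqP; rewrite oner_eq0.
have Pc : P = (P@_0)%:MP.
  apply/mpolyP => m; rewrite mcoeffC; have [->|m0] := eqVneq 0%MM m; first by rewrite mulr1.
  have [i mi] : exists i, (0 < m i)%N.
    apply/existsP; apply: contraNT m0 => /existsPn h; apply/eqP/mnmP => i.
    by rewrite mnm0E; have := h i; rewrite -eqn0Ngt => /eqP.
  have E : (m - U_(i) + U_(i))%MM = m by apply: submK; apply/mnm_lepP => j; rewrite mnm1E; case: eqP => [<-|].
  have := congr1 (mcoeff (m - U_(i))%MM) (d0 i); rewrite mcoeff_mderiv E mcoeff0 mulr0 -mulr_natr => /eqP.
  by rewrite mulf_eq0 (natr_eq0 charK) orbF => /eqP.
have := PE 1%:M (unitmx1 _ _); rewrite Pc mevalC => ->; by rewrite mpolyC0.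
Qed.

End Orbits.

Section Counting.
Variables (K : fieldType) (r : nat).
Implicit Types (p q : {mpoly K[r]}).

Definition degle k p := (msize p <= k.+1)%N.

Lemma degleM k l p q : degle k p -> degle l q -> degle (k + l) (p * q).
Proof.
rewrite /degle => hp hq; have [->|p0] := eqVneq p 0; first by rewrite mul0r msize0.
have [->|q0] := eqVneq q 0; first by rewrite mulr0 msize0.
have aux a b : (a <= k.+1 -> b <= l.+1 -> (a + b).-1 <= (k + l).+1)%N by lia.
by rewrite msizeM //; exact: aux.
Qed.

Lemma degleX k p n : degle k p -> degle (k * n) (p ^+ n).
Proof.
move=> hp; elim: n => [|n IH]; first by rewrite expr0 muln0 /degle msize1.
by rewrite exprS mulnS; apply: degleM.
Qed.

Lemma degle_prod I (s : seq I) (F : I -> {mpoly K[r]}) (k : I -> nat) :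
  (forall i, degle (k i) (F i)) -> degle (\sum_(i <- s) k i) (\prod_(i <- s) F i).
Proof.
move=> h; elim: s => [|i s IH]; first by rewrite !big_nil /degle msize1.
by rewrite !big_cons; apply: degleM.
Qed.

(** Among the n^(r+1) monomials with exponents below n in r + 1 rational
    functions of r variables with a common denominator there is a linear
    relation, because their numerators lie in a space whose dimension grows
    like n^r. *)
Lemma rational_dependence l (rl : (r < l)%N) (Q : 'I_l -> {mpoly K[r]}) (D : {mpoly K[r]}) :
  exists2 P : {mpoly K[l]}, P != 0 & forall (F : 'I_l -> K) (u : 'I_r -> K),
    D.@[u] != 0 -> (forall i, (Q i).@[u] = D.@[u] * F i) -> P.@[F] = 0.
Proof.
pose c := (msize D + \sum_i msize (Q i))%N.
have cD : degle c D by rewrite /degle /c; lia.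
have cQ i : degle c (Q i) by rewrite /degle /c (bigD1 i) //=; lia.
pose c' := (l * c)%N.
(* This choice of n gives n^(r+1) > (c' n + 1)^r. *)
pose n := ((c'.+1) ^ r).+1.
pose I := {ffun 'I_l -> 'I_n}; pose J := {ffun 'I_r -> 'I_(c' * n).+1}.
pose T (a : I) : {mpoly K[r]} := \prod_i (Q i ^+ a i * D ^+ (n - a i)).
have cT a : degle (c' * n) (T a).
  have : degle (\sum_(i < l) c * n) (T a).
    apply: degle_prod => i; have -> : (c * n = c * a i + c * (n - a i))%N.
      by rewrite -mulnDr subnKC // ltnW.
    by apply: degleM; apply: degleX.
  by rewrite sum_nat_const card_ord mulnA.
pose mn (b : J) : 'X_{1..r} := [multinom b i : nat | i < r].
pose A : 'M[K]_(#|I|, #|J|) := \matrix_(i, j) (T (enum_val i))@_(mn (enum_val j)).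
have lt : (#|J| < #|I|)%N.
  rewrite !card_ffun !card_ord; apply: leq_trans (leq_pexp2l (ltn0Sn _) rl); rewrite expnS.
  have le : ((c' * n).+1 ^ r <= (c'.+1 * n) ^ r)%N by case: (r) => // r'; rewrite leq_exp2r //; lia.
  apply: leq_ltn_trans le _; rewrite expnMn ltn_pmul2r ?expn_gt0 //=.
have [v v0 vA] : exists2 v : 'rV[K]_#|I|, v != 0 & v *m A = 0.
  have : kermx A != 0.
    by rewrite -mxrank_eq0 mxrank_ker subn_eq0 -ltnNge; apply: leq_ltn_trans (rank_leq_col _) lt.
  by case/rowV0Pn => v /sub_kermxP vA v0; exists v.
pose X (a : I) : 'X_{1..l} := [multinom a i : nat | i < l].
have X_inj : injective X.
  move=> a b /mnmP ab; apply/ffunP => i; apply: val_inj; have := ab i; by rewrite !mnmE.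
pose P : {mpoly K[l]} := \sum_(k < #|I|) v 0 k *: 'X_[X (enum_val k)].
have rel : \sum_(k < #|I|) v 0 k *: T (enum_val k) = 0.
  apply/mpolyP => m; rewrite mcoeff0 raddf_sum /=.
  have [mle|mlt] := leqP (mdeg m) (c' * n); last first.
    apply: big1 => k _; rewrite mcoeffZ memN_msupp_eq0 ?mulr0 //; apply: msize_mdeg_ge.
    exact: leq_trans (cT _) mlt.
  have mi i : (m i < (c' * n).+1)%N.
    rewrite ltnS; apply: leq_trans mle; rewrite mdegE (bigD1 i) //=; exact: leq_addr.
  pose b : J := [ffun i => Ordinal (mi i)].
  have E : m = mn b by apply/mnmP => i; rewrite mnmE ffunE.
  have /rowP/(_ (enum_rank b)) := vA; rewrite !mxE => H; rewrite -[RHS]H; apply: eq_bigr => k _.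
  by rewrite mcoeffZ !mxE enum_rankK E.
exists P.
  have [k vk] : exists k, v 0 k != 0.
    by have /matrix0Pn[i [k]] := v0; rewrite ord1 => h; exists k.
  apply: contra_neq vk => P0; have := congr1 (mcoeff (X (enum_val k))) P0.
  rewrite mcoeff0 raddf_sum /= (bigD1 k) //= big1 => [|j jk].
    by rewrite mcoeffZ mcoeffX eqxx mulr1 addr0.
  rewrite mcoeffZ mcoeffX (inj_eq X_inj) (inj_eq enum_val_inj) (negPf jk) mulr0 //.
move=> F u du QF.
have Tu a : (T a).@[u] = D.@[u] ^+ (l * n) * \prod_i F i ^+ a i.
  rewrite rmorph_prod /=; under eq_bigr => i _.
    rewrite rmorphM !rmorphXn /= QF exprMn mulrAC -exprD subnKC; last exact: ltnW.
    over.
  rewrite big_split /= prodr_const card_ord -exprM mulnC //.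
have : (\sum_(k < #|I|) v 0 k *: T (enum_val k)).@[u] = D.@[u] ^+ (l * n) * P.@[F].
  rewrite /P !raddf_sum /= mulr_sumr; apply: eq_bigr => k _; rewrite !mevalZ Tu mevalX.
  rewrite mulrCA; congr (_ * (_ * _)); apply: eq_bigr => i _; by rewrite mnmE.
rewrite rel meval0 => /esym/eqP; rewrite mulf_eq0 expf_eq0 (negPf du) andbF => /eqP //.
Qed.

End Counting.

Section OrbitDependent.
Variables (K : closedFieldType) (N : nat).
Local Notation gl := 'M[K]_N.
Implicit Types (f : {mpoly K[\dim {:gl}]}) (x y z a w : gl).

Lemma mem_cent w x : (x \in lker (ad w)) = (x *m w == w *m x).
Proof. by rewrite memv_ker adE /bracket subr_eq0 eq_sym. Qed.

Lemma Ad_cent w c : c \in unitmx -> c \in lker (ad w) -> Ad c w = w.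
Proof. by move=> uc; rewrite mem_cent AdE => /eqP ->; rewrite mulmxK. Qed.

(** Near the identity every matrix is the product of some 1 + u, with u in a
    fixed complement of the centralizer of w, and an element of the
    centralizer. *)
Lemma slice_line w a : exists2 e : {poly K}, e != 0 & forall t, e.[t] != 0 ->
  1%:M + t *: a \in unitmx /\ exists2 u, u \in ((lker (ad w))^C)%VS &
    1%:M + u \in unitmx /\ Ad (1%:M + t *: a) w = Ad (1%:M + u) w.
Proof.
set C := lker (ad w); pose q := \dim C; pose c := vbasis C.
pose M t := 1%:M + t *: a.
pose lam x : 'cV[K]_q := \col_i coord c i (projv C x).
have lam_lin : linear lam by move=> s x y; apply/colP => i; rewrite !mxE !linearP.
have lam_mem x : x \in C -> \sum_i lam x i 0 *: c`_i = x.
  move=> xC; rewrite [RHS](coord_vbasis xC); apply: eq_bigr => i _; by rewrite mxE projv_id.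
have lam_ker x : lam x = 0 -> x \in (C^C)%VS.
  move=> l0; rewrite -lker_proj memv_ker; apply/eqP.
  rewrite (coord_vbasis (memv_proj C x)) big1 // => i _.
  by have /colP/(_ i) := l0; rewrite !mxE => ->; rewrite scale0r.
have c1 : 1%:M \in C by rewrite mem_cent mul1mx mulmx1.
have cC i : c`_i \in C.
  have [lt|ge] := ltnP i q; last by rewrite nth_default ?mem0v // size_tuple.
  by apply: vbasis_mem; apply: mem_nth; rewrite size_tuple.
pose B t : 'M[K]_q := \matrix_(i, j) lam (M t *m c`_j) i 0.
have uB : mfun (@uni K) B.
  have h j : mfun (@uni K) (fun t => lam (M t *m c`_j)).
    apply: (vfun_mfun (uni_fring K)); apply: (vfun_linear (uni_fring K) lam_lin).
    apply: (mfun_vfun (uni_fring K)); apply: (mfunM (uni_fring K)); last exact: (mfunC (uni_fring K)).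
    exact: mfun_line.
  by move=> i j; have [p pE] := h j i 0; exists p => t; rewrite mxE pE.
(* Cramer's rule, for the element h of C such that M t h - 1 has no component in C. *)
pose s t : 'cV[K]_q := \adj (B t) *m lam 1%:M.
have us : mfun (@uni K) s.
  apply: (mfunM (uni_fring K)); last exact: (mfunC (uni_fring K)).
  exact: (mfun_adj (uni_fring K)).
pose g t : gl := \sum_i s t i 0 *: c`_i.
have ug : mfun (@uni K) g.
  apply: (vfun_mfun (uni_fring K)); apply: (vfun_sum (uni_fring K)) => i; exact: us.
have [e1 e1E] := fr_det (uni_fring K) uB.
have [e2 e2E] := fr_det (uni_fring K) ug.
have [e3 e3E] := line_det 1%:M a.
have M0 : M 0 = 1%:M by rewrite /M scale0r addr0.
have B0 : B 0 = 1%:M.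
  apply/matrixP => i j; rewrite !mxE M0 mul1mx projv_id //.
  by rewrite coord_free ?(basis_free (vbasisP C)) // eq_sym.
have g0 : g 0 = 1%:M.
  have [_ _] := (mul_mx_adj (B 0), B0, B0).
  have aB : \adj (B 0) = 1%:M.
    by have := mul_mx_adj (B 0); rewrite B0 det1 mul1mx.
  by rewrite /g /s aB mul1mx lam_mem.
exists (e1 * e2 * e3).
  apply/negP => /eqP/(congr1 (horner^~ 0))/eqP; rewrite /= !hornerM horner0 -e1E -e2E -e3E.
  by rewrite -/(M 0) M0 B0 g0 !det1 !mulr1 oner_eq0.
move=> t; rewrite !hornerM !mulf_eq0 !negb_or -e1E -e2E -e3E => /andP[/andP[dB dg] dM].
have uM : M t \in unitmx by rewrite unitmxE unitfE.
split=> //; pose h := (\det (B t))^-1 *: g t.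
have gC : g t \in C by apply: rpred_sum => i _; apply: rpredZ; exact: cC.
have hC : h \in C by apply: rpredZ.
have uh : h \in unitmx by rewrite unitmxE detZ unitfE mulf_neq0 // expf_neq0 // invr_eq0.
have E : lam (M t *m h - 1%:M) = 0.
  have lb : lam (M t *m h) = (\det (B t))^-1 *: (B t *m s t).
    rewrite /h -scalemxAr -[RHS]/(_ *: _).
    have -> : M t *m g t = \sum_i s t i 0 *: (M t *m c`_i).
      by rewrite mulmx_sumr; apply: eq_bigr => i _; rewrite scalemxAr.
    have lz k x : lam (k *: x) = k *: lam x.
      have l0 : lam 0 = 0 by have := lam_lin (-1) 0 0; rewrite scaler0 addr0 scaleN1r addNr.
      by have := lam_lin k x 0; rewrite l0 !addr0.
    rewrite lz (linear_comb lam_lin); congr (_ *: _); apply/colP => i.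
    rewrite summxE mxE; apply: eq_bigr => j _; by rewrite !mxE mulrC.
  rewrite addrC -scaleN1r lam_lin lb mulmxA mul_mx_adj mul_scalar_mx scalerA mulVf // scale1r.
  by rewrite scaleN1r addNr.
exists (M t *m h - 1%:M); first exact: lam_ker.
have -> : 1%:M + (M t *m h - 1%:M) = M t *m h by rewrite addrC subrK.
split; first by rewrite unitmx_mul uM.
by rewrite Ad_mul // comp_lfunE (Ad_cent uh hC).
Qed.

Lemma dim_cent_compl w : \dim ((lker (ad w))^C)%VS = \dim (limg (ad w)).
Proof.
rewrite dimv_compl -(limg_ker_dim (ad w) fullv) capfv addKn //.
Qed.

(** By slice_line a dense part of the orbit is parametrized rationally by a
    complement of the centralizer, of dimension rank(ad w). *)
Theorem orbit_dependent w l (f : 'I_l -> {mpoly K[\dim {:gl}]}) : (\dim (limg (ad w)) < l)%N ->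
  exists2 P : {mpoly K[_]}, P != 0 & forall a, a \in unitmx -> P.@[fun i => peval (f i) (Ad a w)] = 0.
Proof.
set r := \dim _ => rl; set U := ((lker (ad w))^C)%VS.
have dU : \dim U = r by exact: dim_cent_compl.
pose M (v : 'I_r -> K) : gl := 1%:M + \sum_i v i *: (vbasis U)`_i.
have uM : mfun (@multi K r) M.
  apply: (mfunD (multi_fring K r)); first exact: (mfunC (multi_fring K r)).
  apply: (vfun_mfun (multi_fring K r)); apply: (vfun_sum (multi_fring K r)) => i; exact: multiX.
have [d dE] := fr_det (multi_fring K r) uM.
have /choice[kQ kQE] (i : 'I_l) : exists kQ : nat * {mpoly K[r]}, forall v, d.@[v] != 0 ->
    kQ.2.@[v] = d.@[v] ^+ kQ.1 * peval (f i) (Ad (M v) w).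
  have [k [Q' [Q QE] h]] : floc (@multi K r) (fun v => \det (M v))
     (fun v => peval (f i) (M v *m w *m invmx (M v))).
    apply: (fr_peval (floc_fring (multi_fring K r) _)); first by exists d.
    by apply: (vfun_Adx (multi_fring K r)).
  by exists (k, Q) => v dv; rewrite /= AdE -QE -dE h // dE.
pose k := (\sum_i (kQ i).1)%N.
have [P P0 PE] := rational_dependence rl (fun i => d ^+ (k - (kQ i).1) * (kQ i).2) (d ^+ k).
have Pv v : M v \in unitmx -> P.@[fun i => peval (f i) (Ad (M v) w)] = 0.
  rewrite unitmxE unitfE dE => dv; apply: (PE _ v) => [|i].
    by rewrite rmorphXn expf_neq0.
  rewrite rmorphM !rmorphXn /= kQE // mulrA -exprD subnK // /k (bigD1 i) //=; exact: leq_addr.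
exists P => // a ua.
have [p pE] : pfun (fun x => P.@[fun i => peval (f i) x]).
  by apply: (fr_mpoly (pfun_fring _)) => i; exists (f i).
have [e e0 eE] := slice_line w (a - 1%:M).
have [n [Q QE]] := line_rational p w 1%:M (a - 1%:M).
have Q0 : Q = 0.
  apply: (poly_fun0_off e0) => t et; have [ut [u uU [uu AdE]]] := eE t et.
  rewrite QE ?AdE; last by rewrite -unitfE -unitmxE.
  have uE : 1%:M + u = M (fun i => coord (vbasis U) (cast_ord (esym dU) i) u).
    congr (_ + _); rewrite {1}(coord_vbasis uU) (reindex (cast_ord (esym dU))) //=.
    by apply: onW_bij; exists (cast_ord dU) => i; apply: val_inj.
  by rewrite -pE uE Pv ?mulr0 // -uE.
have E1 : 1%:M + 1 *: (a - 1%:M) = a by rewrite scale1r addrC subrK.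
have := QE 1; rewrite E1 Q0 horner0 -unitfE -unitmxE ua => /(_ isT)/esym/eqP.
rewrite mulf_eq0 expf_eq0; move: ua; rewrite unitmxE unitfE => /negPf ->.
by rewrite andbF pE => /eqP.
Qed.

End OrbitDependent.

(** * The dimension of an orbit of the adjoint group *)

Section Bivariate.
Variable K : closedFieldType.
Implicit Types (F : K * K -> K).

(** Polynomial functions of two variables as lists of terms: along the powers of a
    point they become exponential sums. *)
Definition biv F := exists s : seq (K * (nat * nat)),
  forall u, F u = \sum_(m <- s) m.1 * (u.1 ^+ m.2.1 * u.2 ^+ m.2.2).

Lemma biv_fring : fring biv.
Proof.
split=> [c|F F' [s sE] [s' s'E]|F F' [s sE] [s' s'E]].
- by exists [:: (c, (0, 0)%N)] => u; rewrite big_seq1 /= !expr0 !mulr1.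
- by exists (s ++ s') => u; rewrite big_cat sE s'E.
- exists [seq (m.1 * m'.1, (m.2.1 + m'.2.1, m.2.2 + m'.2.2)%N) | m <- s, m' <- s'] => u.
  rewrite sE s'E big_allpairs_dep mulr_suml; apply: eq_bigr => m _; rewrite mulr_sumr.
  by apply: eq_bigr => m' _ /=; rewrite !exprD; ring.
Qed.

Lemma biv1 : biv (fun u => u.1).
Proof. by exists [:: (1, (1, 0)%N)] => u; rewrite big_seq1 /= expr0 expr1 mul1r mulr1. Qed.
Lemma biv2 : biv (fun u => u.2).
Proof. by exists [:: (1, (0, 1)%N)] => u; rewrite big_seq1 /= expr0 expr1 !mul1r. Qed.

Lemma biv_uni F (p q : {poly K}) : biv F -> uni (fun t => F (p.[t], q.[t])).
Proof.
case=> s sE; exists (\sum_(m <- s) m.1%:P * (p ^+ m.2.1 * q ^+ m.2.2)) => t.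
by rewrite sE horner_sum; apply: eq_bigr => m _; rewrite !hornerM !horner_exp hornerC.
Qed.

(** Division with remainder by the ideal of the point (1, 1). *)
Definition division F := exists A B, [/\ biv A, biv B & forall u,
  F u = F (1, 1) + A u * (u.1 - 1) + B u * (u.2 - 1)].

Lemma division_fring : fring (fun F => biv F /\ division F).
Proof.
have bf := biv_fring.
split=> [c|F F' [bF [A [B [bA bB E]]]] [bF' [A' [B' [bA' bB' E']]]]|F F' [bF [A [B [bA bB E]]]] [bF' [A' [B' [bA' bB' E']]]]].
- split; first exact: (frC bf).
  by exists (fun=> 0), (fun=> 0); split; [exact: (frC bf)|exact: (frC bf)|move=> u; ring].
- split; first exact: (frD bf).
  exists (fun u => A u + A' u), (fun u => B u + B' u); split; try exact: (frD bf).
  by move=> u; rewrite E E'; ring.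
- split; first exact: (frM bf).
  exists (fun u => A u * F' u + F (1, 1) * A' u), (fun u => B u * F' u + F (1, 1) * B' u).
  split; try by apply: (frD bf); apply: (frM bf) => //; exact: (frC bf).
  by move=> u; rewrite E [F' u]E'; ring.
Qed.

Lemma division1 : biv (fun u => u.1) /\ division (fun u => u.1).
Proof.
split; first exact: biv1; exists (fun=> 1), (fun=> 0); split; try exact: (frC biv_fring).
by move=> u /=; ring.
Qed.
Lemma division2 : biv (fun u => u.2) /\ division (fun u => u.2).
Proof.
split; first exact: biv2; exists (fun=> 0), (fun=> 1); split; try exact: (frC biv_fring).
by move=> u /=; ring.
Qed.

(** The sequence satisfies a linear recurrence of order the number of terms,
    whose constant coefficient is nonzero. *)
Lemma exponential_sum (s : seq (K * K)) : (forall m, m \in s -> m.2 != 0) ->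
  (forall k, (0 < k <= size s)%N -> \sum_(m <- s) m.1 * m.2 ^+ k = 0) -> \sum_(m <- s) m.1 = 0.
Proof.
move=> s0 h; pose R : {poly K} := \prod_(m <- s) ('X - m.2%:P).
have szR : size R = (size s).+1 by rewrite /R -(big_map snd xpredT (fun z => 'X - z%:P)) size_prod_XsubC size_map.
have R0 : R`_0 != 0.
  rewrite -horner_coef0 horner_prod prodf_seq_neq0; apply/allP => m ms /=.
  by rewrite hornerXsubC sub0r oppr_eq0 s0.
have : \sum_(k < size R) R`_k * \sum_(m <- s) m.1 * m.2 ^+ k = 0.
  under eq_bigr do rewrite mulr_sumr.
  rewrite exchange_big /= big1_seq // => m /andP[_ ms].
  transitivity (m.1 * R.[m.2]).
    by rewrite horner_coef mulr_sumr; apply: eq_bigr => k _; ring.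
  by rewrite horner_prod (big_rem m ms) /= hornerXsubC subrr mul0r mulr0.
rewrite szR big_ord_recl [X in _ + X]big1 => [|k _]; last by rewrite h ?mulr0 //= ltn_ord.
rewrite addr0 => /eqP; rewrite mulf_eq0 (negPf R0) /= => /eqP E; rewrite -[RHS]E.
by apply: eq_bigr => m _; rewrite expr0 mulr1.
Qed.

Lemma exists_root_list L : (0 < L)%N -> exists s : seq K, forall x, x ^+ L = 1 -> x \in s.
Proof.
move=> L0; have [s sE] := closed_field_poly_normal ('X^L - 1%:P : {poly K}).
exists s => x xL.
have : root ('X^L - 1%:P) x by rewrite /root hornerD hornerN hornerXn hornerC xL subrr.
by rewrite sE (monicP (monicXnsubC 1 L0)) scale1r root_prod_XsubC.
Qed.

End Bivariate.

Section CentralTorus.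
Variables (K : closedFieldType) (charK : [pchar K] =i pred0) (N : nat).
Local Notation gl := 'M[K]_N.
Implicit Types (x y z : gl).

Definition center_proj x : gl := (\tr x / N%:R)%:M.
Lemma center_proj_linear : linear center_proj.
Proof. by move=> c x y; rewrite /center_proj linearP mulrDl -mulrA raddfD /= scale_scalar_mx. Qed.
HB.instance Definition _ := GRing.isLinear.Build K gl gl *:%R center_proj center_proj_linear.

Lemma scalar0 : 0%:M = 0 :> gl.
Proof. by apply/matrixP => i j; rewrite !mxE mul0rn. Qed.

Definition center_part : 'End(gl) := linfun center_proj.
Definition traceless_part : 'End(gl) := \1%VF - center_part.
(** The torus that scales sl_N by u.1 and the scalar matrices by u.2: these are
    the maps c x + d tr(x) of the classification. *)
Definition torus (u : K * K) : 'End(gl) := u.1 *: traceless_part + u.2 *: center_part.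

Lemma center_partE x : center_part x = (\tr x / N%:R)%:M. Proof. by rewrite lfunE. Qed.

Lemma traceless_partE x : traceless_part x = x - center_part x.
Proof. by rewrite add_lfunE opp_lfunE id_lfunE. Qed.

Lemma torusE u x : torus u x = u.1 *: x + (u.2 - u.1) *: center_part x.
Proof.
by rewrite add_lfunE !scale_lfunE traceless_partE scalerBr scalerBl addrA addrAC.
Qed.

Variables (o o' : 'I_N) (oo' : o' != o).

Lemma N_neq0 : (N%:R : K) != 0.
Proof. by rewrite (natr_eq0 charK); case: (N) o => // - []. Qed.

Lemma center_part_scalar (c : K) : center_part c%:M = c%:M.
Proof. by rewrite center_partE mxtrace_scalar -[c *+ N]mulr_natr mulfK // N_neq0. Qed.

Lemma center_part_torus u x : center_part (torus u x) = u.2 *: center_part x.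
Proof.
have E00 : center_part (center_part x) = center_part x by rewrite [center_part x]center_partE center_part_scalar.
by rewrite torusE linearD !linearZ /= E00 -scalerDl addrC subrK.
Qed.

Lemma torus_comp u v : (torus u \o torus v)%VF = torus (u.1 * v.1, u.2 * v.2).
Proof.
apply/lfunP => x; rewrite comp_lfunE torusE center_part_torus !torusE /=.
rewrite scalerDr !scalerA -addrA -scalerDl; congr (_ + _ *: _); ring.
Qed.

Lemma torus1 : torus (1, 1) = \1%VF.
Proof. by apply/lfunP => x; rewrite torusE /= subrr scale0r addr0 scale1r id_lfunE. Qed.

Lemma torus_neq0 u : lker (torus u) == 0%VS -> u.1 != 0 /\ u.2 != 0.
Proof.
move=> /lker0P inj; split; apply/eqP => u0.
  have : torus u (delta_mx o o') = torus u 0.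
    rewrite linear0 torusE u0 scale0r add0r center_partE.
    have -> : \tr (delta_mx o o' : gl) = 0.
      rewrite /mxtrace big1 // => i _; rewrite mxE; case: (i =P o) => //= ->.
      by rewrite eq_sym (negPf oo').
    by rewrite mul0r scalar0 scaler0.
  by move/inj/matrixP/(_ o o'); rewrite !mxE !eqxx => /eqP; rewrite oner_eq0.
have : torus u 1%:M = torus u 0.
  by rewrite linear0 torusE u0 center_part_scalar sub0r scaleNr subrr.
by move/inj/matrixP/(_ o o); rewrite !mxE eqxx => /eqP; rewrite oner_eq0.
Qed.

Lemma br_torus u x z : itw (torus u x) (torus u x) z = u.1 *: itw x x z.
Proof. by rewrite torusE center_partE scale_scalar_mx brD brZ br_scalar addr0. Qed.

(** An inner derivation ad y kills 1, and it kills y; if it is in the span of the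
    two projections, y is scalar. *)
Lemma torus_range_ad (u : K * K) : range (@ad K N) (torus u) -> u = (0, 0).
Proof.
case=> y _ yE.
have u2 : u.2 = 0.
  have : torus u 1%:M = 0 by rewrite -yE adE /bracket mulmx1 mul1mx subrr.
  rewrite torusE center_part_scalar -scalerDl addrC subrK => /matrixP/(_ o o); by rewrite !mxE eqxx mulr1.
have h x : torus u x = bracket y x by rewrite -yE adE.
have [u1|u1] := eqVneq u.1 0; first by case: u u1 u2 {yE h} => ? ? /= -> ->.
have yc : y = center_part y.
  have := h y; rewrite /bracket subrr torusE u2 sub0r scaleNr -scalerBr => /eqP.
  by rewrite scaler_eq0 (negPf u1) subr_eq0 => /eqP.
have := h (delta_mx o o'); rewrite yc center_partE /bracket scalar_mxC subrr torusE center_partE.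
have -> : \tr (delta_mx o o' : gl) = 0.
  rewrite /mxtrace big1 // => i _; rewrite mxE; case: (i =P o) => //= ->.
  by rewrite eq_sym (negPf oo').
rewrite mul0r scalar0 scaler0 addr0 => /matrixP/(_ o o'); rewrite !mxE !eqxx mulr1 => u0.
by rewrite u0 eqxx in u1.
Qed.

Variables (G : set 'End(gl)) (hG : adjoint_group G).

Lemma G_inj g : G g -> injective g.
Proof. by move=> Gg; apply/lker0P; exact: (G_lker hG). Qed.

Lemma G_invK g : G g -> (g \o g^-1)%VF = \1%VF.
Proof. by move=> Gg; rewrite lker0_compfV // (G_lker hG). Qed.

Lemma G_surj g : G g -> forall z, exists w, z = g w.
Proof. by move=> Gg z; exists ((g^-1)%VF z); rewrite -comp_lfunE G_invK // id_lfunE. Qed.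

(** Chain rule for the conjugation by g. *)
Lemma pdiff_conj f g D : G g ->
  (exists2 p, (forall x : 'End(gl), peval p x = peval f (g \o x \o g^-1)%VF) &
    pdiff p \1%VF D = pdiff f \1%VF (g \o D \o g^-1)%VF).
Proof.
move=> Gg.
have lin : linear (fun x : 'End(gl) => (g \o x \o g^-1)%VF).
  by move=> c x y; apply/lfunP => z; rewrite !(comp_lfunE, add_lfunE, scale_lfunE) linearP.
have [p pE] : pfun (fun x : 'End(gl) => peval f (g \o x \o g^-1)%VF).
  by apply: (fr_peval (pfun_fring _)); apply: (vfun_linear (pfun_fring _) lin); exact: pfun_id.
exists p => [x|]; first by rewrite pE.
have j1 := vjet_peval p (vjet_line \1%VF D).
have j2 := vjet_peval f (vjet_line \1%VF (g \o D \o g^-1)%VF).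
have j3 : jet (fun s => peval p (\1%VF + s *: D)) (peval f \1%VF) (pdiff f \1%VF (g \o D \o g^-1)%VF).
  apply: jet_ext j2 => s; rewrite -pE; congr (peval f _).
  by rewrite [in RHS]addrC lin comp_lfun1r G_invK // addrC.
by have [_ ->] := jet_uniq j1 j3.
Qed.

(** A group acts on its Lie algebra by conjugation. *)
Lemma G_normalizes g : G g -> normalizes g.
Proof.
move=> Gg x; have [_ _ lieE] := hG.
have : lie_algebra G (g \o ad x \o g^-1)%VF.
  move=> f vf; have [p pE <-] := pdiff_conj f (ad x) Gg; apply: (tangent hG) => y Gy.
  by rewrite pE; apply: vf; apply: (Gmul hG); [apply: (Gmul hG)|apply: (Ginv hG)].
rewrite lieE => -[y _ yE]; exists y => z.
have := congr1 (fun D : 'End(gl) => D (g z)) yE; rewrite /= !comp_lfunE lker0_lfunK ?(G_lker hG) //.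
by rewrite !adE => <-.
Qed.

(** G has no tangent direction along the torus, so two equations of G cut out the
    point 1 transversally: a polynomial D with D(1) <> 0 vanishes at the other
    torus points of G. If the powers u, ..., u^M, with M the number of terms of D,
    were all different from 1, the exponential sum D(u^k) would vanish for
    k = 1, ..., M, hence for k = 0. *)
Lemma torus_exponent : exists2 L, (0 < L)%N & forall u, G (torus u) -> u.1 ^+ L = 1 /\ u.2 ^+ L = 1.
Proof.
have [_ _ lieE] := hG.
have sep (u : K * K) : u != (0, 0) -> exists2 f, vanish G f & pdiff f \1%VF (torus u) != 0.
  move=> u0; have : ~ lie_algebra G (torus u).
    by rewrite lieE => /torus_range_ad ue; rewrite ue eqxx in u0.
  by move=> /existsNP[f /not_implyP[vf /eqP df]]; exists f.
pose dif f u := pdiff f \1%VF (torus u).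
have difE f u : dif f u = u.1 * dif f (1, 0) + u.2 * dif f (0, 1).
  have -> : dif f (1, 0) = pdiff f \1%VF traceless_part by rewrite /dif /torus scale1r scale0r addr0.
  have -> : dif f (0, 1) = pdiff f \1%VF center_part by rewrite /dif /torus scale1r scale0r add0r.
  rewrite /dif /torus (pdiff_linear f) -[u.2 *: center_part]addr0 (pdiff_linear f).
  have -> : pdiff f \1%VF 0 = 0 by have := pdiff_linear f \1%VF (-1) 0 0; rewrite scaler0 addr0 mulN1r addNr.
  by rewrite addr0.
(* Two equations of G whose differentials are independent on the torus. *)
have [|f1 v1 a10] := sep (1, 0); first by rewrite xpair_eqE oner_eq0.
set a1 := pdiff _ _ _ in a10; pose b1 := dif f1 (0, 1).
have [|f2 v2 w0] := sep (- b1, a1); first by rewrite xpair_eqE negb_and a10 orbT.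
rewrite -/(dif f2 _) difE /= in w0; set a2 := dif f2 (1, 0) in w0; set b2 := dif f2 (0, 1) in w0.
have torus_line (x y t : K) : torus (1 + t * x, 1 + t * y) = \1%VF + t *: torus (x, y).
  by rewrite -torus1 /torus /= !scalerDl !scalerDr !scalerA !scale1r addrACA.
have divf f : exists A B, [/\ biv A, biv B, A (1, 1) = dif f (1, 0), B (1, 1) = dif f (0, 1) &
    forall u, peval f (torus u) = peval f \1%VF + A u * (u.1 - 1) + B u * (u.2 - 1)].
  have [_ [A [B [bA bB AB]]]] : biv (fun u => peval f (torus u)) /\ division (fun u => peval f (torus u)).
    apply: (fr_peval (@division_fring K)) => i.
    have -> : (fun u => vcoord (torus u) i) = (fun u => u.1 * vcoord traceless_part i + u.2 * vcoord center_part i).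
      by apply: funext => u; rewrite vcoordD !vcoordZ.
    have df := @division_fring K.
    by apply: (frD df); apply: (frM df); [exact: division1|exact: (frC df)|exact: division2|exact: (frC df)].
  have bj F (x y : K) : biv F -> exists c1, jet (fun s => F (1 + s * x, 1 + s * y)) (F (1, 1)) c1.
    move=> bF; have [q qE] := biv_uni (1%:P + 'X * x%:P) (1%:P + 'X * y%:P) bF.
    exists q^`().[0]; apply: jet_conv (jet_poly q 0) _ _ _ => // [s|].
      by rewrite add0r -qE !(hornerD, hornerM, hornerC, hornerX).
    by rewrite -qE !(hornerD, hornerM, hornerC, hornerX) !mul0r !addr0.
  have key (x y : K) : dif f (x, y) = A (1, 1) * x + B (1, 1) * y.
    have [c1 jA] := bj A x y bA; have [c2 jB] := bj B x y bB.
    have j1 := vjet_peval f (vjet_line \1%VF (torus (x, y))).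
    have j2 := jetD (jetD (jetC (peval f \1%VF)) (jetM jA (jetM (@jetX K) (jetC x)))) (jetM jB (jetM (@jetX K) (jetC y))).
    have j3 : jet (fun s => peval f (\1%VF + s *: torus (x, y))) _ _ := jet_ext _ j2.
    rewrite /dif; have [|_ ->] := jet_uniq j1 (j3 _).
      by move=> s; rewrite -torus_line AB torus1 /= ![1 + _ - 1]addrAC subrr !add0r.
    by rewrite !mul0r !mulr0 !mul1r !add0r !addr0.
  exists A, B; split=> //; first by rewrite key mulr1 mulr0 addr0.
    by rewrite key mulr1 mulr0 add0r.
  by move=> u; rewrite AB torus1.
have [A1 [B1 [bA1 bB1 A11 B11 E1E']]] := divf f1.
have [A2 [B2 [bA2 bB2 A21 B21 E2E']]] := divf f2.
have bf := @biv_fring K.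
have [s sE] : biv (fun u => A1 u * B2 u - A2 u * B1 u).
  by apply: (frB bf); apply: (frM bf).
have torus_pow u k : G (torus u) -> G (torus (u.1 ^+ k, u.2 ^+ k)).
  move=> Gu; elim: k => [|k IH]; first by rewrite !expr0 torus1; exact: (G1 hG).
  by rewrite !exprS -(torus_comp u (_, _)); apply: (Gmul hG).
(* Both equations vanish at u, so they form a singular linear system in u - 1. *)
have q0 u : G (torus u) -> u != (1, 1) -> A1 u * B2 u - A2 u * B1 u = 0.
  move=> Gu u1; have := E1E' u; have := E2E' u.
  rewrite (v1 _ Gu) (v2 _ Gu) (v1 _ (G1 hG)) (v2 _ (G1 hG)) !add0r.
  set x := u.1 - 1; set y := u.2 - 1 => h2 h1.
  have hx : (A1 u * B2 u - A2 u * B1 u) * x = 0.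
    have -> : (A1 u * B2 u - A2 u * B1 u) * x = (A1 u * x + B1 u * y) * B2 u - (A2 u * x + B2 u * y) * B1 u by ring.
    by rewrite -h1 -h2 !mul0r subrr.
  have hy : (A1 u * B2 u - A2 u * B1 u) * y = 0.
    have -> : (A1 u * B2 u - A2 u * B1 u) * y = (A2 u * x + B2 u * y) * A1 u - (A1 u * x + B1 u * y) * A2 u by ring.
    by rewrite -h1 -h2 !mul0r subrr.
  apply/eqP; move/eqP: hx; move/eqP: hy; rewrite !mulf_eq0; case: (_ == 0) => //=.
  move=> /eqP y0 /eqP x0; have ux : u.1 = 1 by apply/eqP; rewrite -subr_eq0 -/x x0.
  have uy : u.2 = 1 by apply/eqP; rewrite -subr_eq0 -/y y0.
  by move: u1; rewrite [u]surjective_pairing ux uy eqxx.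
exists (size s)`!; first exact: fact_gt0.
move=> u Gu; have [u10 u20] := torus_neq0 (G_lker hG Gu).
have [k /andP[k0 ks] uk] : exists2 k, (0 < k <= size s)%N & (u.1 ^+ k, u.2 ^+ k) = (1, 1).
  apply: contrapT => nk.
  have := @exponential_sum K [seq (m.1, u.1 ^+ m.2.1 * u.2 ^+ m.2.2) | m <- s].
  rewrite !size_map !big_map => /(_ _ _)/= S0.
  have E1' : \sum_(j <- s) j.1 = 0.
    apply: S0 => [m /mapP[m' _ ->]|k ks] /=; first by rewrite mulf_neq0 // expf_neq0.
    rewrite big_map -[RHS](q0 (u.1 ^+ k, u.2 ^+ k)); first last.
    - by apply/eqP => uk; apply: nk; exists k.
    - exact: torus_pow.
    by rewrite sE; apply: eq_bigr => m _ /=; rewrite exprMn -!exprM ![(k * _)%N]mulnC.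
  have := sE (1, 1); rewrite A11 B11 A21 B21.
  under eq_bigr do rewrite !expr1n !mulr1.
  rewrite E1' => /eqP; apply/negP; apply: contra_neq w0 => w0.
  by rewrite mulNr addrC [b1 * _]mulrC -[RHS]w0 /a1 -/(dif f1 _).
case: uk => uk1 uk2; have /dvdnP[m ->] : (k %| (size s)`!)%N by rewrite dvdn_fact ?k0.
by rewrite mulnC !exprM uk1 uk2 !expr1n.
Qed.

End CentralTorus.

Section OrbitDimension.
Variables (K : closedFieldType) (charK : [pchar K] =i pred0) (N : nat).
Local Notation gl := 'M[K]_N.
Implicit Types (x y z w a : gl).
Local Notation torus := (@torus K N).
Variables (o o' : 'I_N) (oo' : o' != o).
Variables (G : set 'End(gl)) (hG : adjoint_group G).

Lemma dim_limg_ad z : (\dim (limg (ad z)) + idim z z = N * N)%N.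
Proof. by rewrite addnC; have := limg_ker_dim (ad z) fullv; rewrite capfv dimvf /dim /=. Qed.

Lemma idim_torus u z : u.1 != 0 -> idim (torus u z) (torus u z) = idim z z.
Proof.
move=> u0; congr (\dim _); apply/vspaceP => x.
have lE w : linfun (itw w w) x = itw w w x by rewrite lfunE.
rewrite !memv_ker !lE br_torus.
by rewrite scaler_eq0 (negPf u0).
Qed.

Lemma idim_tr z : idim z^T z^T = idim z z.
Proof.
suff le x : (idim x x <= idim x^T x^T)%N.
  apply/eqP; rewrite eqn_leq (le z) andbT.
  by have := le z^T; rewrite trmxK.
apply: (@dim_inj_le _ _ _ (@trmx K N N) _ _ trmx_inj) => y /itwP xy; apply/itwP.
by rewrite -!trmx_mul xy.
Qed.

(** By the classification g is a conjugation after a torus element, possibly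
    after the transposition; the torus element takes finitely many values by
    torus_exponent, applied to a square in the transposed case. *)
Lemma orbit_cover z : exists ws : seq gl, (forall w, w \in ws -> \dim (limg (ad w)) = \dim (limg (ad z))) /\
  forall g, G g -> exists2 w, w \in ws & exists2 a, a \in unitmx & g z = Ad a w.
Proof.
have [L L0 LE] := torus_exponent charK oo' hG.
have [|s0 s0E] := @exists_root_list K (2 * L); first by rewrite muln_gt0.
pose s := [seq c <- s0 | c != 0].
have sE c : c ^+ L = 1 \/ c ^+ (2 * L) = 1 -> c \in s.
  move=> cL; have c2 : c ^+ (2 * L) = 1 by case: cL => // cL; rewrite mulnC exprM cL expr1n.
  rewrite mem_filter s0E // andbT; apply/eqP => c0; move: c2; rewrite c0 expr0n muln_eq0 /=.
  by rewrite eqn0Ngt L0 /= => /esym/eqP; rewrite oner_eq0.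
exists ([seq torus u z | u <- [seq (c, d) | c <- s, d <- s]] ++ [seq torus u z^T | u <- [seq (c, d) | c <- s, d <- s]]).
split=> [w|g Gg].
  have nz u : u \in [seq (c, d) | c <- s, d <- s] -> u.1 != 0.
    by case/allpairsP => -[c d] /= [cs _ ->] /=; move: cs; rewrite mem_filter => /andP[].
  rewrite mem_cat => h; suff E : idim w w = idim z z.
    by have := dim_limg_ad w; have := dim_limg_ad z; rewrite E => <- /addIn.
  by case/orP: h => /mapP[u /nz u0 ->]; rewrite idim_torus // idim_tr.
have [a ua [c [d gE]]] := normalizer_classification charK oo' (G_inj hG Gg) (G_surj hG Gg) (G_normalizes hG Gg).
pose u := (c, c + d * N%:R).
have uE x : c *: x + (d * \tr x)%:M = torus u x.
  rewrite torusE /= [c + _]addrC addrK center_partE scale_scalar_mx; congr (_ + _%:M).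
  by rewrite -mulrA; congr (_ * _); rewrite mulrC divfK // (N_neq0 charK o).
have ua' : invmx a \in unitmx by rewrite unitmx_inv.
have Gh : G (Ad (invmx a) \o g)%VF by apply: (Gmul hG) => //; exact: (Ad_in_G charK hG).
have hK x : Ad (invmx a) (a *m x *m invmx a) = x.
  by rewrite AdE invmxK -!mulmxA mulVmx // mulmx1 mulmxA mulVmx // mul1mx.
have us (v : K * K) : v.1 \in s -> v.2 \in s -> v \in [seq (c, d) | c <- s, d <- s].
  by case: v => v1 v2 h1 h2; apply/allpairsP; exists (v1, v2).
case: gE => gE.
  have Gu : G (torus u).
    suff -> : torus u = (Ad (invmx a) \o g)%VF by [].
    by apply/lfunP => x; rewrite comp_lfunE gE hK uE.
  exists (torus u z); last by exists a => //; rewrite gE AdE uE.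
  have [u1 u2] := LE u Gu; rewrite mem_cat; apply/orP; left; apply: (map_f (fun u => torus u z)).
  by apply: us; apply: sE; left.
(* The transposition disappears in the square. *)
have Gu : G (torus (u.1 * u.1, u.2 * u.2)).
  suff -> : torus (u.1 * u.1, u.2 * u.2) = ((Ad (invmx a) \o g) \o (Ad (invmx a) \o g))%VF by apply: (Gmul hG).
  rewrite -(torus_comp charK o u u); apply/lfunP => x; rewrite !comp_lfunE !gE !hK.
  have -> : c *: x^T + (d * \tr x)%:M = (torus u x)^T by rewrite -uE linearD linearZ /= tr_scalar_mx.
  by rewrite trmxK mxtrace_tr uE.
exists (torus u z^T); last by exists a => //; rewrite gE AdE -uE mxtrace_tr.
have [u1 u2] := LE _ Gu; rewrite mem_cat; apply/orP; right; apply: (map_f (fun u => torus u z^T)); apply: us; apply: sE; right.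
  by rewrite exprM expr2.
by rewrite exprM expr2.
Qed.

(** A product of relations, one for each of the finitely many conjugacy classes
    in the orbit, is a relation on the orbit. *)
Theorem orbit_dim z m : zariski_dim (adjoint_orbit G z) m -> m = \dim (limg (ad z)).
Proof.
case=> [[f find] nf]; apply/eqP; rewrite eqn_leq; apply/andP; split; rewrite leqNgt; apply/negP => lt.
  have [ws [wd wE]] := orbit_cover z.
  have [P P0 PE] : exists2 P : {mpoly K[m]}, P != 0 & forall w, w \in ws -> forall a, a \in unitmx ->
      P.@[fun i => peval (f i) (Ad a w)] = 0.
    elim: ws wd {wE} => [|w ws IH] wd; first by exists 1; rewrite ?oner_neq0.
    have [|P P0 PE] := IH; first by move=> v vs; apply: wd; rewrite inE vs orbT.
    have [|Q Q0 QE] := @orbit_dependent K N w m f; first by rewrite wd ?inE ?eqxx.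
    exists (P * Q); first by rewrite mulf_neq0.
    move=> v; rewrite inE => /orP[/eqP ->|vs] a ua; rewrite mevalM; first by rewrite QE ?mulr0.
    by rewrite PE ?mul0r.
  move/eqP: P0; apply; apply: find => x [g Gg <-].
  by have [w wws [a ua ->]] := wE g Gg; exact: PE.
apply: nf; have [f' f'E] := orbit_independent charK lt.
exists f' => P PE; apply: f'E => a ua; apply: PE; exists (Ad a) => //.
exact: (Ad_in_G charK hG).
Qed.

End OrbitDimension.

(** * Constancy of the invariant-factor degrees on a sheet *)

Section Closed.
Variables (K : closedFieldType) (N : nat).
Local Notation gl := 'M[K]_N.
Implicit Types (x y z w a : gl).

(** The compressions P A Q replace the minors of A. *)
Lemma rank_leP m n (A : 'M[K]_(m, n)) k :
  (\rank A <= k)%N <-> forall (P : 'M_(k.+1, m)) (Q : 'M_(n, k.+1)), \det (P *m A *m Q) = 0.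
Proof.
split=> [rA P Q|h].
  apply/eqP; rewrite -[_ == 0]negbK -unitfE -unitmxE -row_free_unit /row_free eqn_leq rank_leq_row /= -ltnNge ltnS.
  apply: leq_trans (mxrankM_maxl _ _) _; apply: leq_trans (mxrankM_maxr _ _) rA.
rewrite leqNgt; apply/negP => kA.
pose Y : 'M_(k.+1, n) := pid_mx k.+1 *m row_base A.
have /row_freeP[Q YQ] : row_free Y.
  by rewrite /row_free mxrankMfree ?row_base_free // rank_pid_mx.
have /submxP[P YP] : (Y <= A)%MS by apply: submx_trans (submxMl _ _) _; rewrite eq_row_base.
by have /eqP := h P Q; rewrite -YP YQ det1 oner_eq0.
Qed.

Lemma kappa_closed i k : zariski_closed [set x : gl | kappa_le x i k].
Proof.
pose I (F : gl -> K) := exists (B : 'M[K]_(i, N)) (P : 'I_N -> 'M[K]_(k.+1, i)) (Q : 'M[K]_(N, k.+1)),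
  F = fun x => \det ((\sum_j P j *m (B *m x ^+ j)) *m Q).
have -> : [set x : gl | kappa_le x i k] = [set x | forall F, I F -> F x = 0].
  apply/seteqP; split=> x /= h.
    move=> F [B [P [Q ->]]]; have /rank_leP := h B.
    have /submxP[R ->] : ((\sum_j P j *m (B *m x ^+ j))%R <= gen_space N B x)%MS.
      apply: summx_sub => j _; apply: submx_trans (submxMl _ _) _; exact: gen_space_sub.
    exact.
  move=> B; apply/rank_leP => P Q.
  have /sub_sumsmxP[R RE] : (P *m gen_space N B x <= \sum_(j < N) <<B *m x ^+ j>>)%MS by exact: submxMl.
  have /fin_all_exists[R' R'E] j : exists R', R j *m <<B *m x ^+ j>>%MS = R' *m (B *m x ^+ j).
    have /submxP[R' ->] : (R j *m <<B *m x ^+ j>> <= B *m x ^+ j)%MS.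
      by apply: submx_trans (submxMl _ _) _; rewrite genmxE.
    by exists R'.
  rewrite RE; under eq_bigr do rewrite R'E.
  by apply: (h (fun x => \det ((\sum_j R' j *m (B *m x ^+ j)) *m Q))); exists B, R', Q.
apply: zariski_closed_pfun => F [B [P [Q ->]]].
have pf := @pfun_fring K gl; apply: (fr_det pf); apply: (mfunM pf); last exact: (mfunC pf).
move=> a b; have -> : (fun x : gl => (\sum_j P j *m (B *m x ^+ j)) a b) = fun x => \sum_j (P j *m (B *m x ^+ j)) a b.
  by apply: funext => x; rewrite summxE.
apply: (fr_sum pf) => j _; apply: (mfunM pf); first exact: (mfunC pf).
apply: (mfunM pf); first exact: (mfunC pf).
apply: (mfunX pf); apply: (vfun_mfun pf); exact: pfun_id.
Qed.

Lemma zariski_closedU (V : vectType K) (C1 C2 : set V) :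
  zariski_closed C1 -> zariski_closed C2 -> zariski_closed (C1 `|` C2).
Proof.
move=> [I1 ->] [I2 ->]; exists [set p | exists p1 p2, [/\ I1 p1, I2 p2 & p = p1 * p2]].
apply/seteqP; split=> x /=.
  move=> h p [p1 [p2 [i1 i2 ->]]]; rewrite /peval mevalM.
  by case: h => h; [rewrite [p1.@[_]](h p1 i1) mul0r|rewrite [p2.@[_]](h p2 i2) mulr0].
move=> h; have [h1|/existsNP[p1 /not_implyP[i1 /eqP v1]]] := pselect (forall p, I1 p -> peval p x = 0).
  by left.
right=> p2 i2; have := h (p1 * p2); rewrite /peval mevalM => /(_ _)/eqP.
by rewrite mulf_eq0 (negPf v1) /= => H; apply/eqP/H; exists p1, p2.
Qed.

Lemma zariski_closed0 (V : vectType K) : zariski_closed (set0 : set V).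
Proof.
exists [set 1]; apply/seteqP; split=> x //= /(_ 1 erefl)/eqP.
by rewrite /peval meval1 oner_eq0.
Qed.

Lemma irreducible_avoid (V : vectType K) (S : set V) (T : eqType) (s : seq T) (C : T -> set V) :
  irreducible_set S -> (forall t, t \in s -> zariski_closed (C t)) ->
  (forall t, t \in s -> ~ S `<=` C t) -> exists2 z, S z & forall t, t \in s -> ~ C t z.
Proof.
move=> [S0 irr] cl nS.
suff [D [cD nD DC]] : exists D, [/\ zariski_closed D, ~ S `<=` D & forall t, t \in s -> C t `<=` D].
  move/existsNP: nD => [z /not_implyP[Sz nDz]]; exists z => // t ts /(DC t ts) //.
elim: s cl nS => [|t s IH] cl nS.
  exists set0; split=> //; first exact: zariski_closed0.
  by case: S0 => z Sz /(_ z Sz).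
have [u us|u us|D [cD nD DC]] := IH; [by apply: cl; rewrite inE us orbT|by apply: nS; rewrite inE us orbT|].
exists (C t `|` D); split.
- by apply: zariski_closedU => //; apply: cl; rewrite inE eqxx.
- move=> /irr[] //; first by apply: cl; rewrite inE eqxx.
  by apply: nS; rewrite inE eqxx.
- move=> u; rewrite inE => /orP[/eqP ->|us] x Cx; first by left.
  by right; apply: DC Cx.
Qed.

End Closed.

Section Sheets.
Variables (K : closedFieldType) (charK : [pchar K] =i pred0) (N : nat).
Local Notation gl := 'M[K]_N.
Implicit Types (x y z w a : gl).
Variables (G : set 'End(gl)) (hG : adjoint_group G) (S : set gl) (hS : sheet G S).

(** The union of the conjugates of S is still irreducible: a cover of it by two
    closed sets covers each conjugacy class by two closed sets, one of which
    contains the class. By maximality this union is S. *)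
Lemma sheet_Ad a x : a \in unitmx -> S x -> S (Ad a x).
Proof.
move=> ua Sx; have [m [SL [S0 irr] max]] := hS.
pose B : set gl := [set y | exists2 b, b \in unitmx & exists2 z, S z & y = Ad b z].
suff <- : B = S by exists a => //; exists x.
have SB : S `<=` B by move=> z Sz; exists 1%:M; [exact: unitmx1|exists z; rewrite ?Ad1 ?id_lfunE].
apply: max => //; last first.
  move=> _ [b ub [z Sz ->]] /=; have := SL z Sz; rewrite /orbit_dim_locus /=.
  suff -> : adjoint_orbit G (Ad b z) = adjoint_orbit G z by [].
  apply/seteqP; split=> y [g Gg <-].
    exists (g \o Ad b)%VF; last by rewrite comp_lfunE.
    by apply: (Gmul hG) => //; exact: (Ad_in_G charK hG).
  exists (g \o Ad (invmx b))%VF; last by rewrite comp_lfunE -[Ad _ (Ad _ _)]comp_lfunE AdK // id_lfunE.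
  by apply: (Gmul hG) => //; apply: (Ad_in_G charK hG); rewrite unitmx_inv.
split; first by exists (Ad a x), a => //; exists x.
move=> C1 C2 [I1 C1E] [I2 C2E] BC.
pose I' (I : set {mpoly K[\dim {:gl}]}) (F : gl -> K) := exists p b, [/\ I p, b \in unitmx & F = fun z => peval p (Ad b z)].
have cl I : zariski_closed [set z | forall F, I' I F -> F z = 0].
  apply: zariski_closed_pfun => F [p [b [Ip ub ->]]].
  apply: (fr_peval (pfun_fring _)); apply: (vfun_lin (pfun_fring _) (Ad b)); exact: pfun_id.
have key : S `<=` [set z | forall F, I' I1 F -> F z = 0] `|` [set z | forall F, I' I2 F -> F z = 0].
  move=> z Sz.
  have [h1|/existsNP[F /not_implyP[[p1 [b1 [i1 u1 ->]]] /eqP v1]]] := pselect (forall F, I' I1 F -> F z = 0).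
    by left.
  have [h2|/existsNP[F' /not_implyP[[p2 [b2 [i2 u2 ->]]] /eqP v2]]] := pselect (forall F, I' I2 F -> F z = 0).
    by right.
  have [b ub|h|h] := @orbit_irreducible K N p1 p2 z.
  - have : B (Ad b z) by exists b => //; exists z.
    by case/BC; rewrite ?C1E ?C2E => /= h; [rewrite (h p1 i1) mul0r|rewrite (h p2 i2) mulr0].
  - by rewrite h ?eqxx in v1.
  - by rewrite h ?eqxx in v2.
case: (irr _ _ (cl I1) (cl I2) key) => h; [left|right] => _ [b ub [z Sz ->]].
  by rewrite C1E => p Ip; apply: (h z Sz (fun z => peval p (Ad b z))); exists p, b.
by rewrite C2E => p Ip; apply: (h z Sz (fun z => peval p (Ad b z))); exists p, b.
Qed.

Lemma small_commute : (N <= 1)%N -> forall x y, x *m y = y *m x.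
Proof.
case: (N) => [_ x y|[_ x y|//]]; first by apply/matrixP => [[]].
by rewrite (mx11_scalar x) scalar_mxC.
Qed.

(** For N > 1 the dimension of the orbit determines that of the centralizer; for
    smaller N all matrices commute. *)
Lemma sheet_idim x y : S x -> S y -> idim x x = idim y y.
Proof.
move=> Sx Sy; have [N1|N2] := leqP N 1.
  have full z : idim z z = \dim {:gl}.
    congr (\dim _); apply/vspaceP => u; rewrite memvf; apply/itwP; exact: small_commute.
  by rewrite !full.
pose o := Ordinal (ltnW N2); pose o' := Ordinal N2; have oo' : o' != o by [].
have [m [SL _ _]] := hS.
have hx := orbit_dim charK oo' hG (SL x Sx); have hy := orbit_dim charK oo' hG (SL y Sy).
have := dim_limg_ad x; have := dim_limg_ad y; rewrite -hx -hy => <- /addnI //.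
Qed.

(** The generic values of the functions kappa_i on a sheet are attained
    simultaneously at some point, and are upper bounds for the values at e; as the
    sum of the values depends only on the dimension of the centralizer, which is
    constant, the values at e are the generic ones. *)
Lemma sheet_kappa e x i k : S e -> S x -> (i < N)%N -> kappa_le e i k -> kappa_le x i k.
Proof.
move=> Se Sx iN; have [m [_ irr _]] := hS.
have ex j : exists k, `[< forall z, S z -> kappa_le z j k >].
  by exists N; apply/asboolP => z Sz B; exact: rank_leq_row.
(* The generic value of kappa_j on S. *)
pose kk j := ex_minn (ex j).
have kkS j : forall z, S z -> kappa_le z j (kk j).
  by rewrite /kk; case: ex_minnP => q /asboolP.
have kkmin j l : (forall z, S z -> kappa_le z j l) -> (kk j <= l)%N.
  by rewrite /kk; case: ex_minnP => q _ qmin h; apply: qmin; apply/asboolP.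
pose C j := if kk j is l.+1 then [set z : gl | kappa_le z j l] else set0.
(* A point z of S where all the generic values are attained. *)
have [t tN|t tN|z Sz zC] := @irreducible_avoid K _ S _ (iota 0 N) C irr.
- rewrite /C; case: (kk t) => [|l]; [exact: zariski_closed0|exact: kappa_closed].
- rewrite /C => SC; have := kkmin t; case E: (kk t) SC => [|l] SC; first by have := SC e Se.
  by move=> /(_ l SC); rewrite ltnn.
have zmax j l : (j < N)%N -> kappa_le z j l -> (kk j <= l)%N.
  move=> jN zl; rewrite leqNgt; apply/negP => lk.
  have := zC j; rewrite mem_iota add0n => /(_ jN); apply; rewrite /C.
  by case: (kk j) lk => // q; rewrite ltnS => lq B; apply: leq_trans (zl B) lq.
have [ps [ips sps _]] := rational_canonical_form e.
have [qs [iqs sqs _]] := rational_canonical_form z.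
have E : degs ps = degs qs.
  apply: (degs_eq ips sps iqs sqs) => [j jN|]; last exact: sheet_idim.
  apply/(rank_gen_space _ _ ips sps) => B.
  apply: leq_trans (kkS j e Se B) _; apply: zmax => //; exact/(rank_gen_space _ _ iqs sqs).
move=> /(rank_gen_space _ _ ips sps); rewrite E => /(rank_gen_space _ _ iqs sqs) h B.
apply: leq_trans (kkS i x Sx B) _; exact: zmax.
Qed.

End Sheets.

(** * The symmetric part *)

Section Stars.
Variables (K : closedFieldType) (charK : [pchar K] =i pred0) (N : nat).
Local Notation gl := 'M[K]_N.
Implicit Types (x y z w a B s : gl).

(** Intertwiners with a canonical form of x are counted by the ranks of p(x), which
    transposition does not change. *)
Lemma idim_self_tr x : idim x x^T = idim x x.
Proof.
have [ps [/andP[bps _] sps _]] := rational_canonical_form x.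
rewrite !(idim_siml _ sps) !idim_fmx //; apply: eq_bigr => p _.
by rewrite pmx_tr mxrank_tr.
Qed.

Lemma idim_tr_self x : idim x^T x = idim x x.
Proof. by rewrite -{2}[x]trmxK idim_self_tr idim_tr. Qed.

Lemma simmx_conj a x : a \in unitmx -> simmx x (a *m x *m invmx a).
Proof.
move=> ua; exists a, (invmx a); split; [exact: mulmxV|exact: mulVmx|by rewrite mulmxKV].
Qed.

Lemma simmxN x y : simmx x y -> simmx (- x) (- y).
Proof. by case=> P [Q [PQ QP E]]; exists P, Q; split=> //; rewrite mulmxN mulNmx E. Qed.

Lemma simmx_Ad x y : simmx x y -> exists2 a, a \in unitmx & y = Ad a x.
Proof.
case=> P [Q [PQ QP E]]; have [uP _] := mulmx1_unit PQ; exists P => //.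
by rewrite AdE E mulmxK.
Qed.

(** The condition says that x is equal to its adjoint B^-1 x^T B. *)
Lemma bilinear_form_mx (chi : {biscalar 'cV[K]_N}) : nondegenerate_form chi ->
  exists2 B, B \in unitmx & forall x,
    (forall u v, chi (x *m u) v = chi u (x *m v)) <-> x^T *m B = B *m x.
Proof.
move=> [nd _]; pose B : gl := \matrix_(i, j) chi (delta_mx i 0) (delta_mx j 0).
have chiE u v : chi u v = (u^T *m B *m v) 0 0.
  have ll v' : linear ((fun u v : 'cV[K]_N => chi u v : K^o)^~ v') by move=> c w w'; rewrite linearPl.
  have lr u' : linear ((fun u v : 'cV[K]_N => chi u v : K^o) u') by move=> c w w'; rewrite linearPr.
  rewrite [chi u v](bilinear_deltaE ll lr) mxE.
  under [RHS]eq_bigr do rewrite mxE mulr_suml.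
  rewrite exchange_big pair_bigA /= (reindex (fun p : 'I_N * 'I_N => ((p.1, 0 : 'I_1), (p.2, 0 : 'I_1)))) /=; last first.
    exists (fun q : ('I_N * 'I_1) * ('I_N * 'I_1) => (q.1.1, q.2.1)) => [[a b] //|[[a b] [c d]] _] /=.
    by rewrite !ord1.
  by apply: eq_bigr => p _; rewrite !mxE /GRing.scale /=; ring.
exists B.
  rewrite -row_free_unit -kermx_eq0; apply/eqP/row_matrixP => i; rewrite row0.
  set w := row i (kermx B); have wB : w *m B = 0 by apply/sub_kermxP; exact: row_sub.
  apply: trmx_inj; rewrite trmx0; apply: nd => v; by rewrite chiE trmxK wB mul0mx mxE.
move=> x; split=> [h|h u v]; last by rewrite !chiE trmx_mul -(mulmxA u^T) h !mulmxA.
apply/matrixP => i j; have := h (delta_mx i 0) (delta_mx j 0).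
have E (M : gl) : ((delta_mx i 0 : 'cV[K]_N)^T *m M *m (delta_mx j 0 : 'cV[K]_N)) 0 0 = M i j.
  by rewrite trmx_delta -rowE -colE !mxE.
by rewrite !chiE trmx_mul -(mulmxA _ x^T B) E mulmxA -(mulmxA _ B x) E.
Qed.

(** Membership in p becomes an equation between two points x and star x, to which
    the uniqueness of the point of the slice applies; the compatibility with the
    bracket keeps star x in the slice. *)
Definition p_symmetry (theta : 'End(gl)) (star : gl -> gl) :=
  [/\ forall x y, star (x - y) = star x - star y,
      forall x, p_space theta x <-> star x = x
    & forall f z, star f = f -> itw f f (star z) = - star (itw f f z)].

(** Take for star the adjoint with respect to the form. *)
Lemma form_symmetry theta : type_AI theta \/ type_AII theta ->
  exists2 star, p_symmetry theta star & forall x, idim (star x) x = idim x x.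
Proof.
move=> h; have [chi nd [_ pE]] : exists2 chi : {biscalar 'cV[K]_N}, nondegenerate_form chi & given_by_form chi theta.
  by case: h => -[chi [nd _ gb]]; exists chi.
have [B uB chiB] := bilinear_form_mx nd.
pose star x := invmx B *m x^T *m B.
have starE x : star x = x <-> x^T *m B = B *m x.
  split=> E; last by rewrite /star -mulmxA E mulKmx.
  by rewrite -{2}E /star -mulmxA mulKVmx.
have starM x y : star (x *m y) = star y *m star x.
  by rewrite /star trmx_mul !mulmxA (mulmxK uB).
have starB x y : star (x - y) = star x - star y.
  by rewrite /star linearB /= mulmxBr mulmxBl.
exists star; last first.
  move=> x; rewrite -(idim_tr_self x); apply: idim_siml; apply: simmx_sym.
  by have := @simmx_conj (invmx B) x^T; rewrite unitmx_inv invmxK => /(_ uB).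
split=> // [x|f z sf]; last by rewrite /itw starB !starM sf opprB.
by rewrite starE -chiB pE.
Qed.

(** Take star x = - s x s with s = 1 on V_a and s = - 1 on V_b; if y = star y is
    similar to x, then star x, which is similar to - x, is similar to
    - y and so to y. *)
Lemma summand_symmetry theta : type_AIII theta ->
  exists2 star, p_symmetry theta star & forall x y, star y = y -> simmx y x -> idim (star x) x = idim x x.
Proof.
case=> Va [Vb [Vab cap _ pE]].
pose pa := daddv_pi Va Vb; pose pb := daddv_pi Vb Va.
have cap' : (Vb :&: Va = 0)%VS by rewrite capvC.
have dec u : pa u + pb u = u by apply: daddv_pi_add => //; rewrite Vab memvf.
have paV u : pa u \in Va by exact: memv_pi.
have pbV u : pb u \in Vb by exact: memv_pi.
pose s : 'End('cV[K]_N) := pa - pb.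
have sE u : s u = pa u - pb u by rewrite add_lfunE opp_lfunE.
have pa_id u : u \in Va -> s u = u.
  move=> uV; have E : pa u = u by apply: daddv_pi_id.
  by have := dec u; rewrite sE E => /eqP; rewrite addrC -subr_eq0 addrK => /eqP ->; rewrite subr0.
have pb_id u : u \in Vb -> s u = - u.
  move=> uV; have E : pb u = u by apply: daddv_pi_id.
  by have := dec u; rewrite sE E => /eqP; rewrite -subr_eq0 addrK => /eqP ->; rewrite sub0r.
have two0 : (2%:R : K) != 0 by rewrite (natr_eq0 charK).
have eq0 (v : 'cV[K]_N) : v + v = 0 -> v = 0.
  by rewrite -mulr2n -scaler_nat => /eqP; rewrite scaler_eq0 (negPf two0) => /eqP.
have in_a u : s u = u -> u \in Va.
  move=> su; have /addrI/eqP : pa u + - pb u = pa u + pb u by rewrite dec -sE.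
  by rewrite eq_sym -addr_eq0 => /eqP/eq0 b0; rewrite -(dec u) b0 addr0.
have in_b u : s u = - u -> u \in Vb.
  move=> su; have /addIr/eqP : pa u + - pb u = - pa u + - pb u by rewrite -opprD dec -sE.
  by rewrite -addr_eq0 => /eqP/eq0 a0; rewrite -(dec u) a0 add0r.
pose sg : gl := \matrix_(i, j) s (delta_mx j 0) i 0.
have sgE u : sg *m u = s u.
  have cE (w : 'cV[K]_N) : w = \sum_i w i 0 *: delta_mx i 0.
    by rewrite {1}[w]matrix_sum_delta; apply: eq_bigr => i _; rewrite big_ord1.
  rewrite {2}[u]cE linear_sum; apply/colP => i; rewrite mxE summxE; apply: eq_bigr => j _.
  by rewrite linearZ !mxE mulrC.
have mx_eq (x y : gl) : (forall u : 'cV_N, x *m u = y *m u) -> x = y.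
  move=> h; apply/matrixP => i j; have /colP/(_ i) := h (delta_mx j 0); by rewrite -!colE !mxE.
have sg2 : sg *m sg = 1%:M.
  apply: mx_eq => u; rewrite -mulmxA !sgE mul1mx [s u]sE linearB /= pa_id // pb_id //.
  by rewrite opprK dec.
pose star x := - (sg *m x *m sg).
have starM f z : star f = f -> f *m star z = - star (f *m z) /\ star z *m f = - star (z *m f).
  by move=> sf; split; rewrite -{1}sf /star !mulmxN !mulNmx !opprK !mulmxA -(mulmxA _ sg sg) sg2 mulmx1 ?mulmxA.
have usg : sg \in unitmx by case: (mulmx1_unit sg2).
have conj x : simmx (- x) (star x).
  have := simmx_conj (- x) usg; rewrite (invmx_eq sg2); by rewrite mulmxN mulNmx.
have starB x y : star (x - y) = star x - star y.
  by rewrite /star mulmxBr mulmxBl opprB opprK addrC.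
exists star.
  split=> // [x|f z sf].
    rewrite pE /=; split=> [[ab ba]|sx].
      apply: mx_eq => u; rewrite /star mulNmx -!mulmxA !sgE [s u]sE mulmxBr linearB /=.
      rewrite (pb_id _ (ab _ (paV u))) (pa_id _ (ba _ (pbV u))) -opprD opprK -mulmxDr dec //.
    have anti : sg *m x = - (x *m sg).
      by rewrite -{1}sx /star mulmxN !mulmxA sg2 mul1mx.
    split=> u uV; [apply: in_b|apply: in_a]; rewrite -sgE mulmxA anti mulNmx -mulmxA sgE.
      by rewrite pa_id.
    by rewrite pb_id // mulmxN opprK.
  have [h1 h2] := starM f z sf; by rewrite /itw h1 h2 starB opprD opprK opprK.
move=> x y sy yx; apply: idim_siml.
apply: simmx_trans (simmx_sym (conj x)) _.
apply: simmx_trans (simmxN (simmx_sym yx)) _.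
by apply: simmx_trans (conj y) _; rewrite sy.
Qed.

Section Slice.
Variables (e h f : gl).
Hypotheses (sl2 : sl2_mx e h f) (nile : exists k, e ^+ k = 0).

(** Both x and star x lie on the slice. *)
Lemma symmetric_slice theta star x : p_symmetry theta star -> star e = e -> star f = f ->
  itw f f (x - e) = 0 -> (idim e e <= idim (star x) x)%N -> star x = x.
Proof.
case=> sB _ anti se sf xs le; apply/esym/(slice_unique charK sl2 nile) => //.
have s0 : star 0 = 0 by have := sB 0 0; rewrite !subrr.
by rewrite -{1}se -sB anti // xs s0 oppr0.
Qed.
End Slice.
End Stars.

(** * The theorem *)

Theorem theorem3p2p1 (K : closedFieldType) (charK : [pchar K] =i pred0)
  (N : nat)
  (G : set 'End('M[K]_N)) (hG : adjoint_group G)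
  (theta : 'End('M[K]_N)) (htheta : lie_involution theta)
  (htype : type_AI theta \/ type_AII theta \/ type_AIII theta)
  (S : set 'M[K]_N) (hS : sheet G S) (hSp : S `&` p_space theta !=set0)
  (e h f : 'M[K]_N) (he : (S `&` p_space theta) e) (enil : nilpotent_mx e)
  (htriple : normal_sl2_triple theta e h f)
  (X : set 'M[K]_N)
  (hX : translate_set e X = S `&` translate_set e (lie_centralizer f)) :
  orbit_saturation G (translate_set e (X `&` p_space theta))
    = orbit_saturation G (S `&` p_space theta)
  /\ (type_AI theta \/ type_AII theta -> translate_set e X `<=` p_space theta).
Proof.
have [[Se pe] [[hhe hhf hef] _ pf _]] := (he, htriple).
have sl2 : sl2_mx e h f by [].
have in_slice x : translate_set e X x -> S x /\ itw f f (x - e) = 0.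
  rewrite hX => -[Sx [y fy xE]]; split=> //; by rewrite -xE addrC addKr.
have slice_in x : S x -> itw f f (x - e) = 0 -> X (x - e).
  move=> Sx fx; have : translate_set e X x.
    by rewrite hX; split=> //; exists (x - e) => //; rewrite addrC subrK.
  by case=> y Xy <-; rewrite addrC addKr.
have [star [sB sP anti] sim] : exists2 star, p_symmetry theta star &
    forall x y, star y = y -> simmx y x -> idim (star x) x = idim x x.
  case: htype => [h1|[h1|h1]]; last exact: summand_symmetry.
    by have [|star sp si] := @form_symmetry K N theta; [left|exists star].
  by have [|star sp si] := @form_symmetry K N theta; [right|exists star].
have se := proj1 (sP e) pe; have sf := proj1 (sP f) pf.
split; last first.
  move=> /form_symmetry[st [stB stP stanti] stsim] x /in_slice[Sx fx]; apply/stP.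
  apply: (symmetric_slice charK sl2 enil (And3 stB stP stanti)) => //; try exact/stP.
  by rewrite stsim (sheet_idim charK hG hS Sx Se).
apply/seteqP; split=> _ [g Gg [x hx <-]].
  case: hx => y [Xy py] <-; exists g => //; exists (e + y) => //; split.
    by have [] := in_slice (e + y); first by exists y.
  have s0 : star 0 = 0 by have := sB 0 0; rewrite !subrr.
  have sN z : star (- z) = - star z by have := sB 0 z; rewrite !sub0r s0 sub0r.
  by apply/sP; rewrite -[y]opprK sB sN se (proj1 (sP y) py).
case: hx => Sx px.
(* The conjugate of x in the slice; it is again in S, and it is in p because it
   is similar to x. *)
have [||x' /[dup] xx' /simmx_Ad[a ua x'E] fx'] := slice_meets charK sl2 enil (y := x).
- by move=> i k iN; apply: (sheet_kappa charK hG hS Se Sx iN).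
- exact: (sheet_idim charK hG hS Sx Se).
have Sx' : S x' by rewrite x'E; apply: (sheet_Ad charK hG hS).
have px' : star x' = x'.
  apply: (symmetric_slice charK sl2 enil (And3 sB sP anti)) => //.
  by rewrite (sim x' x) // ?(sheet_idim charK hG hS Sx' Se) //; apply/sP.
exists (g \o Ad (invmx a))%VF.
  by apply: (Gmul hG) => //; apply: (Ad_in_G charK hG); rewrite unitmx_inv.
exists x'; last by rewrite comp_lfunE x'E -[Ad _ (Ad _ _)]comp_lfunE AdK // id_lfunE.
exists (x' - e); last by rewrite addrC subrK.
by split; [exact: slice_in|apply/sP; rewrite sB px' se].
Qed.
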